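(* Let $p\ge 11$ be prime, let $0\le s_\varepsilon\le p-2$, and let $G^{(\varepsilon)}(w,T)=1+\sum_{n\ge1}g_n(w)T^n$ be the associated ghost series. For every $w_\star\in\mathfrak m_{\mathbb C_p}$: (1) any two near-Steinberg ranges $\mathrm{nS}_{w_\star,k}$, $\mathrm{nS}_{w_\star,k'}$ are disjoint or one contains the other; (2) the integer abscissae of the vertices of $\mathrm{NP}(G^{(\varepsilon)}(w_\star,-))$ are precisely the (nonnegative) integers outside all near-Steinberg ranges $\mathrm{nS}_{w_\star,k}$; (3) on the closure of a maximal near-Steinberg range $\mathrm{nS}_{w_\star,k}$ the finite coefficient points $(n,v_p(g_n(w_\star)))$ have a straight lower convex hull, with the following slope: if no coefficient $g_n(w_\star)$ there vanishes, the slope belongs to $\mathbb Z+\mathbb Z\alpha$, where $$\alpha=\max\bigl(\{0\}\cup\{v_p(w_\star-w_{k'}):m_n(k')>0\text{ for some integer }n\in\mathrm{nS}_{w_\star,k}\}\bigr);$$ at a classical point $w_\star=w_{k_0}$ ($k_0$ a relevant weight), after removing the vanishing factor $(w-w_{k_0})^{m_n(k_0)}$ from the coefficients, the slope is integral.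
   Context: $v_p$ is the valuation on $\mathbb C_p$ with $v_p(p)=1$ and $v_p(0)=+\infty$; $\mathfrak m_{\mathbb C_p}$ is the maximal ideal of $\mathcal O_{\mathbb C_p}$. $\mathrm{NP}(\sum F_nT^n)$ is the lower convex hull of the points $(n,v_p(F_n))$, $n\ge0$. $s_\varepsilon$ indexes the character $\varepsilon=\omega^{-s_\varepsilon}\times\omega^{s_\varepsilon}$. Let $\{x\}\in\{0,\dots,p-2\}$ be the residue of $x$ mod $p-1$, $k_\varepsilon=2+\{2s_\varepsilon\}$, $\delta_\varepsilon=\lfloor2s_\varepsilon/(p-1)\rfloor$, $t_\varepsilon=s_\varepsilon+\delta_\varepsilon+1$. A relevant weight is $k=k_\varepsilon+(p-1)k_\bullet$ with $k_\bullet\in\mathbb Z_{\ge0}$; put $w_k=\exp(p(k-2))-1$ and $$d_k^{\mathrm{Iw}}=k_\bullet+1-\delta_\varepsilon,\qquad d_k^{\mathrm{ur}}=\Bigl\lfloor\frac{k_\bullet-t_\varepsilon}{p+1}\Bigr\rfloor+1,\qquad d_k^{\mathrm{new}}=d_k^{\mathrm{Iw}}-2d_k^{\mathrm{ur}}$$ (the first two are the $\mathcal O$-ranks of the classical Iwahori-level and unramified spaces attached to a primitive projective-augmented module of très ramifiée type $\left(\begin{smallmatrix}\omega&*\\0&1\end{smallmatrix}\right)$). Put $m_n(k)=\min\{n-d_k^{\mathrm{ur}},d_k^{\mathrm{Iw}}-d_k^{\mathrm{ur}}-n\}$ if $d_k^{\mathrm{ur}}<n<d_k^{\mathrm{Iw}}-d_k^{\mathrm{ur}}$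 and $m_n(k)=0$ otherwise; $g_n(w)=\prod_{k}(w-w_k)^{m_n(k)}$ over all relevant $k$ (a finite product), $g_0=1$, and $g_{n,\widehat k}(w)=g_n(w)/(w-w_k)^{m_n(k)}$. For a relevant weight $k$, an index $\ell\in\frac12\mathbb Z$ is admissible if $|\ell|\le\frac12d_k^{\mathrm{new}}$ and $\frac12d_k^{\mathrm{Iw}}+\ell\in\mathbb Z$. For admissible $\ell$ put $$\Delta'_{k,\ell}=v_p\bigl(g_{\frac12d_k^{\mathrm{Iw}}+\ell,\widehat k}(w_k)\bigr)-\frac{k-2}2\ell,$$ let $\underline\Delta_k$ be the lower convex hull of the points $(\ell,\Delta'_{k,\ell})$, and let $\Delta_{k,\ell}$ be its ordinate at $\ell$. Near-Steinberg ranges: for $w_\star\in\mathfrak m_{\mathbb C_p}$ let $L_{w_\star,k}$ be the largest member $L$ of $\{1,2,\dots,\frac12d_k^{\mathrm{new}}\}$ if $d_k^{\mathrm{Iw}}$ is even, of $\{\frac32,\frac52,\dots,\frac12d_k^{\mathrm{new}}\}$ if $d_k^{\mathrm{Iw}}$ is odd (the set being empty if its upper endpoint is smaller than its first member), such that $v_p(w_\star-w_k)\ge\Delta_{k,L}-\Delta_{k,L-1}$. If such $L$ exists, $\mathrm{nS}_{w_\star,k}=(\frac12d_k^{\mathrm{Iw}}-L_{w_\star,k},\frac12d_k^{\mathrm{Iw}}+L_{w_\star,k})$ (open interval); otherwise $\mathrm{nS}_{w_\star,k}=\varnothing$. *)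

(* Defs.v *)
From HB Require Import structures.
From mathcomp Require Import all_boot all_order all_algebra.
From mathcomp Require Import all_classical all_reals all_analysis.

Set Implicit Arguments.
Unset Strict Implicit.
Unset Printing Implicit Defensive.

Import Order.TTheory GRing.Theory Num.Theory.
Import numFieldNormedType.Exports.

Local Open Scope classical_set_scope.
Local Open Scope ring_scope.

(* C_p is characterized, up to isomorphism of valued fields, as an             *)
(* algebraically closed field that is complete for a valuation v with          *)
(* v(p) = 1 and in which the elements algebraic over Q_p are dense, where Q_p  *)
(* is the closure of Q.                                                        *)

Definition vlimit (R : realType) (C : fieldType) (v : C -> \bar R)
    (u : nat -> C) (l : C) : Prop :=
  v (u n - l) @[n --> \oo] --> +oo%E.

Definition vcauchy (R : realType) (C : fieldType) (v : C -> \bar R)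
    (u : nat -> C) : Prop :=
  forall M : R, exists N : nat, forall m n : nat,
    (N <= m)%N -> (N <= n)%N -> (M%:E <= v (u m - u n)%R)%E.

Definition is_valuation (R : realType) (C : fieldType)
    (v : C -> \bar R) : Prop :=
  [/\ forall x, v x = +oo%E <-> x = 0,
      forall x, v x <> -oo%E,
      forall x y, v (x * y) = (v x + v y)%E &
      forall x y, (Order.min (v x) (v y) <= v (x + y)%R)%E].

Definition in_Qp (R : realType) (C : fieldType) (v : C -> \bar R)
    (x : C) : Prop :=
  exists q : nat -> rat, vlimit v (fun n => ratr (q n)) x.

Definition algebraic_over_Qp (R : realType) (C : fieldType)
    (v : C -> \bar R) (x : C) : Prop :=
  exists P : {poly C}, [/\ P != 0, forall i : nat, in_Qp v P`_i & root P x].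

Definition is_Cp (p : nat) (R : realType) (C : closedFieldType)
    (v : C -> \bar R) : Prop :=
  [/\ is_valuation v,
      v p%:R = 1%E,
      forall u, vcauchy v u -> exists l, vlimit v u l &
      forall (x : C) (M : R),
        exists2 y, algebraic_over_Qp v y & (M%:E <= v (x - y)%R)%E].

Definition padic_exp (R : realType) (C : fieldType) (v : C -> \bar R)
    (x : C) : C :=
  xget 0 [set l | vlimit v (fun n => \sum_(i < n) x ^+ i / i`!%:R) l].

(* Lower convex hulls. The lower hull of a set of points of the plane is seen  *)
(* as a function of the abscissa, equal to +oo outside of the projection of    *)
(* the convex hull.                                                            *)

Definition convex_hull (R : realType) (P : set (R^o * R^o)) :
    set (R^o * R^o) :=
  smallest (@convex_set R (R^o * R^o)%type) P.

Definition lower_hull (R : realType) (P : set (R^o * R^o)) (x : R) : \bar R :=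
  ereal_inf [set y%:E | y in [set y : R | convex_hull P (x, y)]].

(* A vertex is a point of the graph of h that lies strictly below every chord  *)
(* spanning it, i.e. an extreme point of the region above h.                   *)
Definition vertex_abscissa (R : realType) (h : R -> \bar R) (x : R) : Prop :=
  h x \is a fin_num /\
  forall x1 x2 : R, x1 < x -> x < x2 ->
    (h x < ((x2 - x) / (x2 - x1))%R%:E * h x1
           + ((x - x1) / (x2 - x1))%R%:E * h x2)%E.

(* The points (n, u n) with n in A and u n finite. *)
Definition finite_points (R : realType) (A : set R) (u : nat -> \bar R) :
    set (R^o * R^o) :=
  [set z | exists n : nat, [/\ A n%:R, z.1 = n%:R & u n = z.2%:E]].

Definition newton_polygon (R : realType) (C : fieldType) (v : C -> \bar R)
    (F : nat -> C) : R -> \bar R :=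
  lower_hull (finite_points setT (fun n => v (F n))).

(* A relevant weight k = k_eps + (p-1) k_bullet  *)
(* is represented by kb = k_bullet, and s stands for s_eps.                    *)

Definition k_eps (p s : nat) : nat := 2 + (2 * s) %% (p - 1).
Definition delta_eps (p s : nat) : nat := (2 * s) %/ (p - 1).
Definition t_eps (p s : nat) : nat := s + delta_eps p s + 1.

Definition weight (p s kb : nat) : nat := k_eps p s + (p - 1) * kb.

Definition d_Iw (p s kb : nat) : int := kb%:Z + 1 - (delta_eps p s)%:Z.
Definition d_ur (p s kb : nat) : int :=
  ((kb%:Z - (t_eps p s)%:Z) %/ (p%:Z + 1))%Z + 1.
Definition d_new (p s kb : nat) : int := d_Iw p s kb - 2 * d_ur p s kb.

Definition ghost_mult (p s n kb : nat) : nat :=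
  if d_ur p s kb < n%:Z < d_Iw p s kb - d_ur p s kb then
    absz (Num.min (n%:Z - d_ur p s kb) (d_Iw p s kb - d_ur p s kb - n%:Z))
  else 0%N.

Definition w_wt (p s : nat) (R : realType) (C : fieldType) (v : C -> \bar R)
    (kb : nat) : C :=
  padic_exp v (p%:R * (weight p s kb - 2)%:R) - 1.

(* For fixed n, all but finitely many factors are equal to 1. *)
Definition ghost (p s : nat) (R : realType) (C : fieldType) (v : C -> \bar R)
    (n : nat) : {poly C} :=
  if n is 0%N then 1 else
  \big[*%R/1]_(kb \in [set: nat])
    ('X - (w_wt p s v kb)%:P) ^+ ghost_mult p s n kb.

Definition ghost_hat (p s : nat) (R : realType) (C : fieldType)
    (v : C -> \bar R) (n kb : nat) : {poly C} :=
  ghost p s v n %/ ('X - (w_wt p s v kb)%:P) ^+ ghost_mult p s n kb.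

Definition admissible (p s : nat) (R : realType) (kb : nat) (l : R) : Prop :=
  [/\ 2 * l \is a Num.int,
      `|l| <= (d_new p s kb)%:~R / 2 &
      (d_Iw p s kb)%:~R / 2 + l \is a Num.int].

(* For admissible l the index d_Iw / 2 + l is a natural number. *)
Definition Delta' (p s : nat) (R : realType) (C : fieldType)
    (v : C -> \bar R) (kb : nat) (l : R) : \bar R :=
  (v (ghost_hat p s v (Num.truncn ((d_Iw p s kb)%:~R / 2 + l)%R) kb).[w_wt p s v kb]
   - ((weight p s kb - 2)%:R / 2 * l)%R%:E)%E.

Definition Delta (p s : nat) (R : realType) (C : fieldType)
    (v : C -> \bar R) (kb : nat) : R -> \bar R :=
  lower_hull [set z | admissible p s kb z.1 /\ Delta' p s v kb z.1 = z.2%:E].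

Definition nS_candidate (p s : nat) (R : realType) (kb : nat) (L : R) : Prop :=
  (exists j : nat, L = (if (2 %| d_Iw p s kb)%Z then 1 else 3 / 2) + j%:R) /\
  L <= (d_new p s kb)%:~R / 2.

Definition nS_close (p s : nat) (R : realType) (C : fieldType)
    (v : C -> \bar R) (w : C) (kb : nat) (L : R) : Prop :=
  (Delta p s v kb L - Delta p s v kb (L - 1)%R <= v (w - w_wt p s v kb)%R)%E.

Definition is_nS_radius (p s : nat) (R : realType) (C : fieldType)
    (v : C -> \bar R) (w : C) (kb : nat) (L : R) : Prop :=
  [/\ nS_candidate p s kb L, nS_close p s v w kb L &
      forall L', nS_candidate p s kb L' -> nS_close p s v w kb L' -> L' <= L].

Definition nS (p s : nat) (R : realType) (C : fieldType)
    (v : C -> \bar R) (w : C) (kb : nat) : set R :=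
  [set x | exists2 L : R, is_nS_radius p s v w kb L &
    (d_Iw p s kb)%:~R / 2 - L < x < (d_Iw p s kb)%:~R / 2 + L].

Definition maximal_nS (p s : nat) (R : realType) (C : fieldType)
    (v : C -> \bar R) (w : C) (kb : nat) : Prop :=
  nS p s v w kb !=set0 /\
  forall kb', nS p s v w kb `<=` nS p s v w kb' ->
    nS p s v w kb' = nS p s v w kb.

Definition alpha_set (p s : nat) (R : realType) (C : fieldType)
    (v : C -> \bar R) (w : C) (kb : nat) : set (\bar R) :=
  [set 0%E] `|`
  [set v (w - w_wt p s v kb') | kb' in
    [set kb' | exists2 n : nat, nS p s v w kb n%:R &
                                (0 < ghost_mult p s n kb')%N]].

Definition is_maximum (R : realType) (A : set (\bar R)) (a : \bar R) : Prop :=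
  A a /\ ubound A a.

(* Main.v *)
(* Put x_i = v(w - w_i). The ordinate f(n) = v(g_n(w)) is piecewise linear in
   n: every weight i contributes to the second difference of f a convex kink of
   size x_i at the ends d^ur, d^Iw - d^ur of its interval and a concave one at
   d^Iw / 2. All points are compared through the single rule that among x_i, x_j
   and X_ij = v(w_i - w_j) = 1 + v_p(i - j) the minimum is attained twice.
   The convex kinks at n come from the p + 1 consecutive weights with d^ur = n
   and from the weights with d^Iw - d^ur = n; the reflection i - k |-> -p(i - k)
   about a fixed weight k exchanges the latter with the multiples of p among the
   former at the mirrored abscissa. With Legendre's formula this gives ghost
   duality and a closed form, in valuations of factorials, for the increments of
   the points Delta'_{k,l}. The increments grow like (p - 1) l, whereas concave
   kinks other than that of k are logarithmic in l.
   The radius of nS_{w,k} is the largest minimizer of Delta'_{k,l} - l x_k.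
   Inside that range every kink has X_ik < x_k, hence x_i = X_ik, so f is
   Delta'_k - |l| x_k up to an affine function and its hull there is a segment;
   just outside, f stays strictly above the line of the segment. Two ranges that
   overlap or touch force X_kk' to be at least the smaller of x_k and x_k', so
   one range is tiny compared with the other, which yields nesting and the strict
   increase of slopes at abscissae outside all ranges. The case x_k = +oo is
   reached by truncating x at a large real. *)

Require Import Defs.
From mathcomp Require Import all_boot all_order all_algebra.
From mathcomp Require Import all_classical all_reals all_analysis.
From mathcomp Require Import zify ring lra.

Set Implicit Arguments.
Unset Strict Implicit.
Unset Printing Implicit Defensive.

Import Order.TTheory GRing.Theory Num.Theory.
Import numFieldNormedType.Exports.

(** * Valuations of factorials *)

(** Ranges and convexity are studied for an arbitrary positive real vector [x] obeying the
    ultrametric rule; the field enters only through [v(w_i - w_j)]. The obstacle is the region just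
    outside a range [(a', a + 1)] of [k]: the comparison with [Delta'_{k,l}] fails at weights with
    [X_ik > x_k], because there [x_i] is smaller than [X_ik]. Such a weight still adds [x_k] to a
    convex kink, and this repays the whole deficit. The margin comes from [p >= 11]: with
    [j = a - a'], the bound [(p - 3) / 2 >= 4] gives [x_k >= 4 j + 1], and [v_p(m) <= m / p] then
    gives [X_ik < x_k] for every weight within distance [44 j] of [k]. The constants 20 and 41 below
    are what remains of 44. Truncation is harmless because truncated heights bound the true
    valuations from below and, for a large bound, are exact at abscissae outside all ranges, where
    no factor vanishes. *)

Section Arith.
Variable p : nat.
Hypothesis p_pr : prime p.

(** This is [v_p((p m)!)], the sum of [1 + v_p(i)] over [1 <= i <= m]: a partial sum of the
    distances [v(w_i - w_k)] on one side of [k]. *)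
Definition log_fact_sum (m : nat) := m + logn p m`!.

Lemma log_fact_sum0 : log_fact_sum 0 = 0.
Proof. by rewrite /log_fact_sum logn1. Qed.

Lemma logn_factS m : logn p m.+1`! = logn p m.+1 + logn p m`!.
Proof. by rewrite factS lognM // fact_gt0. Qed.

Lemma log_fact_sumS m : log_fact_sum m.+1 = log_fact_sum m + (1 + logn p m.+1).
Proof. by rewrite /log_fact_sum logn_factS; lia. Qed.

(** Legendre's formula: only the multiples of [p] up to [a] contribute to the valuation of [a!]. *)
Lemma log_fact_sum_div a : log_fact_sum (a %/ p) = logn p a`!.
Proof.
have p1 := prime_gt1 p_pr; have p0 := prime_gt0 p_pr.
elim: a => [|a IHa]; first by rewrite div0n.
rewrite logn_factS divnS // -IHa.
case: (boolP (p %| a.+1)) => [/dvdnP[b Eb]|ndiv]; last first.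
  by rewrite (lognE p a.+1) (negbTE ndiv) !andbF.
have b0 : 0 < b by case: b Eb.
have -> : a %/ p = b.-1.
  by have := divnS a p0; rewrite Eb dvdn_mull // mulnK // => ->.
case: b Eb b0 => // b Eb _.
by rewrite add1n log_fact_sumS Eb lognM // ?prime_gt0 // (logn_prime p p_pr) eqxx /=; lia.
Qed.

Lemma logn_le_div m : p * logn p m <= m.
Proof.
have p1 := prime_gt1 p_pr.
case: m => [|m]; first by rewrite logn0 muln0.
have: p ^ logn p m.+1 <= m.+1 by apply: dvdn_leq => //; apply: pfactor_dvdnn.
case: (logn p m.+1) => [|e]; first by rewrite muln0.
rewrite expnS; apply: leq_trans; rewrite leq_mul2l; apply/orP; right.
exact: ltn_expl.
Qed.

Lemma logn_fact_le m : logn p m`! <= m.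
Proof.
have p1 := prime_gt1 p_pr.
elim/ltn_ind: m => -[|m] IHm; first by rewrite logn1.
have h : m.+1 %/ p < m.+1 by rewrite ltn_Pdiv.
have h2 := IHm _ h; rewrite -log_fact_sum_div /log_fact_sum.
have : 2 * (m.+1 %/ p) <= m.+1.
  by apply: leq_trans (leq_trunc_div m.+1 p); rewrite mulnC leq_mul.
by lia.
Qed.

Lemma dvdn_logn_le m n : 0 < n -> m %| n -> logn p m <= logn p n.
Proof. by move=> n0 dv; apply: dvdn_leq_log. Qed.

Lemma fact_dvd_add m n : m`! * n`! %| (m + n)`!.
Proof.
have /eqP := bin_fact (leq_addr n m); rewrite addKn => /eqP <-.
by rewrite dvdn_mull.
Qed.

Lemma logn_fact_split y z : logn p y`! + logn p z`! <= logn p (y + z)`!.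
Proof.
rewrite -lognM ?fact_gt0 //; apply: dvdn_logn_le; [exact: fact_gt0|exact: fact_dvd_add].
Qed.

Lemma logn_fact_mono m n : m <= n -> logn p m`! <= logn p n`!.
Proof. by move=> mn; have := logn_fact_split m (n - m); rewrite subnKC //; lia. Qed.

(** Deleting [b] from the [(p + 1) j >= 12 j] consecutive integers after [Mm] leaves at least
    [2 j - 1] consecutive ones on one side; their product is divisible by [(2 j - 1)!], hence by
    [j! (j - 1)!]. *)
Lemma logn_fact_pick Mm Mp b j : 0 < j -> 11 <= p ->
  Mp = Mm + (p + 1) * j -> Mm < b <= Mp ->
  logn p b + logn p j`! + logn p j.-1`! + logn p Mm`! <= logn p Mp`!.
Proof.
move=> j0 p11 EMp /andP[b1 b2].
have h1 : logn p Mm`! + logn p (b.-1 - Mm)`! <= logn p b.-1`!.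
  have := logn_fact_split Mm (b.-1 - Mm).
  by rewrite subnKC //; lia.
have h2 : logn p b + logn p b.-1`! = logn p b`!.
  by case: b b1 b2 h1 => // b *; rewrite logn_factS.
have h3 : logn p b`! + logn p (Mp - b)`! <= logn p Mp`!.
  by have := logn_fact_split b (Mp - b); rewrite subnKC.
have h4 : logn p j`! + logn p j.-1`! <= logn p (j + j.-1)`! by exact: logn_fact_split.
have big : (j + j.-1 <= b.-1 - Mm) || (j + j.-1 <= Mp - b).
  have : 12 * j <= (p + 1) * j by rewrite leq_mul2r; lia.
  by move: EMp; set P := (p + 1) * j; lia.
case/orP: big => /logn_fact_mono h5; lia.
Qed.

End Arith.

Local Open Scope classical_set_scope.
Local Open Scope ring_scope.

(** * Increments and ghost duality *)

Section Slopes.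
Variables (R : realFieldType) (p s d : nat).

(* [k < ur_bound n] iff [d_ur k <= n], and [Iw_bound n <= k] iff
   [n < d_Iw k - d_ur k]: see [d_ur_le] and [d_Iw_lt]. *)
Definition ur_bound n := (s + d + 1 + n * (p + 1))%N.
Local Notation T := ur_bound.
Definition Iw_bound n := (n + d + (n + (p - 1 - s)) %/ p)%N.
Local Notation K := Iw_bound.

(* For [x i = v(w - w_i)], [height x n] is [v(g_n(w))] (see [ghost_mult_F]),
   [slope x n] its increment from [n] to [n + 1], and [kink x n] its second
   difference at [n + 1]. *)
Definition psum (x : nat -> R) k := \sum_(i < k) x i.
Local Notation Y := psum.
Definition slope (x : nat -> R) n :=
  Y x (T n) + Y x (K n) - Y x (2 * n + d).+1 - Y x (2 * n + d).
Local Notation E := slope.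
Definition height (x : nat -> R) n := \sum_(i < n) E x i.
Local Notation F := height.
Definition kink (x : nat -> R) n := E x n.+1 - E x n.
Local Notation S := kink.

(* [(k - 2) / 2] for the weight of index [k] *)
Definition half_weight k : R := s%:R + (p%:R - 1) / 2 * (k%:R - d%:R).
Local Notation cw := half_weight.

Lemma psumS x k : Y x k.+1 = Y x k + x k.
Proof. by rewrite /Y big_ord_recr. Qed.

Lemma psum0 x : Y x 0 = 0.
Proof. by rewrite /Y big_ord0. Qed.

Lemma heightS x n : F x n.+1 = F x n + E x n.
Proof. by rewrite /F big_ord_recr. Qed.

Lemma height0 x : F x 0 = 0.
Proof. by rewrite /F big_ord0. Qed.

Lemma psum_sub x a b : (a <= b)%N -> Y x b - Y x a = \sum_(a <= i < b) x i.
Proof.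
by move=> ab; rewrite /Y -!(big_mkord xpredT) (big_cat_nat (leq0n a) ab) //= addrAC subrr add0r.
Qed.

Lemma leq_ur_bound : {homo T : m n / (m <= n)%N}.
Proof. by move=> m n mn; rewrite /T leq_add2l leq_mul2r mn orbT. Qed.

Lemma leq_Iw_bound : {homo K : m n / (m <= n)%N}.
Proof.
move=> m n mn; rewrite /K !leq_add //.
by apply: leq_div2r; rewrite leq_add2r.
Qed.

(** The subtracted terms belong to the weights with [d_Iw] equal to [2n + 1], [2n + 2] and [2n + 3]:
    an even [d_Iw] has a sharp peak with kink -2, an odd one a flat top whose two corners carry -1
    each. *)
Lemma kink_window x n :
  S x n = \sum_(T n <= i < T n.+1) x i + \sum_(K n <= i < K n.+1) x i
          - x (2 * n + d)%N - 2 * x (2 * n + d).+1 - x (2 * n + d).+2.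
Proof.
rewrite -!psum_sub ?leq_ur_bound ?leq_Iw_bound // /S /E.
have -> : (2 * n.+1 + d = (2 * n + d).+2)%N by lia.
by rewrite !psumS; ring.
Qed.

Hypotheses (p_pr : prime p) (p11 : (11 <= p)%N) (s_le : (s <= p - 2)%N).

(* The map [i - k |-> - p (i - k)] turns the weights with [d_Iw - d_ur = n] into
   weights with [d_ur = d_Iw k - n]. Here [a + a' + 1] is [d_Iw k]. *)
Lemma Iw_bound_mirror a a' k k3 : (a + a' + d = k)%N ->
  (K a <= k3)%N = (k + p * k < T a' + p * k3)%N.
Proof.
move=> <-; rewrite /K /T; have p0 : (0 < p)%N by lia.
have := divn_eq (a + (p - 1 - s)) p; have := ltn_pmod (a + (p - 1 - s)) p0.
move: (_ %/ _)%N (_ %% _)%N => q r rp Eq.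
case: (leqP (a + d + q) k3) => h; symmetry.
  by have := leq_mul (leqnn p) h; lia.
apply/negbTE; rewrite -leqNgt.
have := leq_mul (leqnn p) h; lia.
Qed.

(** Counting form of the mirror: the weights [i < k] with [K a <= i] match the multiples of [p] from
    1 to [T a' - k - 1]. This lets Legendre's formula remove [Iw_bound] from the closed forms. *)
Lemma Iw_bound_sub a a' k : (a + a' + d = k)%N -> (k < T a')%N ->
  (K a <= k)%N /\ (k - K a = (T a' - k - 1) %/ p)%N.
Proof.
move=> Ek kT.
have Ka : (K a <= k)%N by rewrite (Iw_bound_mirror _ Ek) ltn_add2r.
split=> //; have p0 : (0 < p)%N by lia.
move: Ka kT; rewrite -{}Ek /K /T.
have := divn_eq (a + (p - 1 - s)) p; have := ltn_pmod (a + (p - 1 - s)) p0.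
move: (_ %/ _)%N (_ %% _)%N => q r rp Eq Ka kT.
have -> : (s + d + 1 + a' * (p + 1) - (a + a' + d) - 1 = (a' - q) * p + (p - 1 - r))%N.
  by have qa : (q <= a')%N; [lia|move: (leq_mul qa (leqnn p)); rewrite mulnBl; lia].
by rewrite divnMDl // divn_small; lia.
Qed.

(* [v(w_i - w_j)] for [i <> j]; the natural subtractions add up to [|i - j|]. *)
Definition wdist i j : nat := (1 + logn p (i - j + (j - i)))%N.
Local Notation X := wdist.
(** The values at [w = w_k]. The entry 0 at [k] deletes the vanishing factor, so the height of this
    row at [n] is the valuation of [g_n] without that factor. *)
Definition dist_row k i : R := if i == k then 0 else (X i k)%:R.
Local Notation xh := dist_row.

Lemma wdistC i j : X i j = X j i.
Proof. by rewrite /X [X in logn _ X]addnC. Qed.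

Lemma psum_dist_le k m : (m <= k)%N -> Y (xh k) m = (log_fact_sum p k)%:R - (log_fact_sum p (k - m))%:R.
Proof.
elim: m => [|m IHm] mk; first by rewrite psum0 subn0 subrr.
rewrite psumS IHm 1?ltnW // /xh /X (ltn_eqF mk).
have -> : (k - m = (k - m.+1).+1)%N by lia.
rewrite log_fact_sumS //.
have -> : (m - k + (k - m.+1).+1 = (k - m.+1).+1)%N by lia.
by rewrite natrD; ring.
Qed.

Lemma psum_dist_gt k m : Y (xh k) (k + m).+1 = (log_fact_sum p k)%:R + (log_fact_sum p m)%:R.
Proof.
elim: m => [|m IHm].
  by rewrite addn0 psumS psum_dist_le // subnn /xh eqxx /log_fact_sum logn1; ring.
rewrite psumS addnS IHm log_fact_sumS // /xh /X.
have -> : ((k + m).+1 == k) = false by lia.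
have -> : ((k + m).+1 - k + (k - (k + m).+1) = m.+1)%N by lia.
by rewrite natrD; ring.
Qed.

Definition hat_height k := F (xh k).
Local Notation H := hat_height.
Definition hat_slope k := E (xh k).
Local Notation Eh := hat_slope.

(** * Increments mirrored about half of [d_Iw] *)

Section Pair.
Variables (a a' k : nat).
Hypotheses (Ek : (a + a' + d = k)%N) (ka : (k < T a)%N) (ka' : (k < T a')%N).
Let Mp := (T a - k - 1)%N.
Let Mm := (T a' - k - 1)%N.

(** For [a' < a], three of the four partial sums run past [k] and are two-sided sums of distances.
    The one up to [K a] stops at or below [k]; by [Iw_bound_sub] and Legendre its missing tail is
    [v_p(Mm!)]. *)
Lemma hat_slope_right : (a' <= a)%N ->
  Eh k a = (log_fact_sum p Mp)%:R - (logn p Mm`!)%:R - (log_fact_sum p (a - a'))%:R - (log_fact_sum p (a - a').-1)%:R.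
Proof.
move=> aa; rewrite /Eh /E.
have [Ka EK] := Iw_bound_sub Ek ka'.
have -> : T a = (k + Mp).+1 by rewrite /Mp; lia.
rewrite psum_dist_gt (psum_dist_le Ka) EK log_fact_sum_div //.
have -> : (2 * a + d = k + (a - a'))%N by lia.
rewrite psum_dist_gt; case: (posnP (a - a')) => [->|j0].
  by rewrite addn0 psum_dist_le // subnn log_fact_sum0; ring.
have -> : (k + (a - a') = (k + (a - a').-1).+1)%N by lia.
by rewrite psum_dist_gt; ring.
Qed.

Lemma hat_slope_left : (a' <= a)%N ->
  Eh k a' = (log_fact_sum p Mm)%:R - (logn p Mp`!)%:R + (log_fact_sum p (a - a'))%:R + (log_fact_sum p (a - a').-1)%:R.
Proof.
move=> aa; rewrite /Eh /E.
have [Ka EK] : (K a' <= k)%N /\ (k - K a' = (T a - k - 1) %/ p)%N.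
  by apply: Iw_bound_sub ka; lia.
have -> : T a' = (k + Mm).+1 by rewrite /Mm; lia.
rewrite psum_dist_gt (psum_dist_le Ka) EK log_fact_sum_div // -/Mp.
have E2 : (2 * a' + d = k - (a - a'))%N by lia.
rewrite E2 (psum_dist_le (leq_subr _ _)) subKn; last by lia.
case: (posnP (a - a')) => [->|j0].
  by rewrite subn0 -[X in X.+1]addn0 psum_dist_gt log_fact_sum0; ring.
have -> : ((k - (a - a')).+1 = k - (a - a').-1)%N by lia.
rewrite (psum_dist_le (leq_subr _ _)) subKn; last by lia.
by ring.
Qed.

(** The right side is [k - 2] for the weight [k]. In the sum of the two closed forms all factorials
    cancel and [Mp + Mm] remains, so this identity is the constant of ghost duality. *)
Lemma weight_splitting : (Mp + Mm)%:R = 2 * cw k :> R.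
Proof.
rewrite /cw; have : (Mp + Mm + (a + a') = 2 * s + p * (a + a'))%N.
  by rewrite /Mp /Mm; move: ka ka' Ek; rewrite /T; lia.
move/(congr1 (fun n : nat => n%:R : R)); rewrite -Ek !natrD !natrM !natrD; lra.
Qed.

Lemma hat_slope_dual_le : (a' <= a)%N -> Eh k a + Eh k a' = 2 * cw k.
Proof.
by move=> aa; rewrite hat_slope_right // hat_slope_left // -weight_splitting /log_fact_sum !natrD; ring.
Qed.

End Pair.

Lemma hat_slope_dual a a' k : (a + a' + d = k)%N -> (k < T a)%N -> (k < T a')%N ->
  Eh k a + Eh k a' = 2 * cw k.
Proof.
move=> Ek ka ka'; case/orP: (leq_total a' a) => aa; first exact: hat_slope_dual_le.
by rewrite addrC; apply: hat_slope_dual_le => //; lia.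
Qed.

(** With [j = a - a'], [Mp + Mm = 2 cw] and [Mp - Mm = (p + 1) j] turn the leading part
    [Mp - 2 j + 1] of the closed form into [cw + (p - 3) / 2 j + 1]; [logn_fact_pick] pays for the
    negative factorial terms and still leaves [v_p(b)]. The free [b] will be [i - k] or [p (k - i)]
    for a weight [i] with a convex kink inside the range. *)
Lemma hat_slope_ge a a' k b : (a + a' + d = k)%N -> (k < T a')%N -> (a' < a)%N ->
  (T a' <= k + b < T a)%N ->
  cw k + (p%:R - 3) / 2 * (a - a')%:R + 1 + (logn p b)%:R <= Eh k a.
Proof.
move=> Ek ka' aa /andP[b1 b2].
have ka : (k < T a)%N by apply: leq_trans ka' (leq_ur_bound (ltnW aa)).
rewrite (hat_slope_right Ek ka ka') 1?ltnW //.
set j := (a - a')%N; have j0 : (0 < j)%N by rewrite /j; lia.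
set Mp := (T a - k - 1)%N; set Mm := (T a' - k - 1)%N.
have EM : (Mp = Mm + (p + 1) * j)%N.
  have := leq_ur_bound (ltnW aa); rewrite /Mp /Mm /j; move: ka ka'; rewrite /T.
  have -> : (a = a' + (a - a'))%N by lia.
  by move: (a - a')%N => jj; lia.
have /(logn_fact_pick p_pr j0 p11 EM) : (Mm < b <= Mp)%N by rewrite /Mm /Mp; lia.
rewrite -(ler_nat R) !natrD => main.
have := weight_splitting Ek ka ka'; rewrite -/Mp -/Mm natrD => sumM.
move: (congr1 (fun n : nat => n%:R : R) EM); rewrite natrD natrM natrD => EM'.
have jj : j%:R = j.-1%:R + 1 :> R by rewrite -{1}(prednK j0) -natr1.
rewrite /log_fact_sum; move: main sumM EM'; rewrite jj.
set P := p%:R; move: (j.-1%:R) => u; lra.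
Qed.

End Slopes.

Lemma sum_ge1 (R : realFieldType) (y : nat -> R) m n : (forall i, (m <= i < n)%N -> 1 <= y i) ->
  (n - m)%:R <= \sum_(m <= i < n) y i.
Proof.
move=> h; have -> : (n - m)%:R = \sum_(m <= i < n) (1 : R) by rewrite sumr_const_nat.
exact: ler_sum_nat.
Qed.

Lemma sum_ge1D (R : realFieldType) (y : nat -> R) m n i0 : (forall i, (m <= i < n)%N -> 1 <= y i) ->
  (m <= i0 < n)%N -> y i0 + (n - m)%:R - 1 <= \sum_(m <= i < n) y i.
Proof.
move=> h /andP[h1 h2].
rewrite (big_cat_nat h1 (ltnW h2)) /= (big_ltn h2).
have g1 : (i0 - m)%:R <= \sum_(m <= i < i0) y i.
  by apply: sum_ge1 => i ?; apply: h; lia.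
have g2 : (n - i0.+1)%:R <= \sum_(i0.+1 <= i < n) y i.
  by apply: sum_ge1 => i ?; apply: h; lia.
have -> : (n - m)%:R = (i0 - m)%:R + (n - i0.+1)%:R + 1 :> R.
  by rewrite -natrD natr1; congr _%:R; lia.
lra.
Qed.

(** * Near-Steinberg ranges of an ultrametric vector *)

Section Ranges.
Variables (R : realFieldType) (p s d : nat).
Hypotheses (p_pr : prime p) (p11 : (11 <= p)%N) (s_le : (s <= p - 2)%N).

Local Notation T := (ur_bound p s d).
Local Notation K := (Iw_bound p s d).
Local Notation E := (@slope R p s d).
Local Notation F := (@height R p s d).
Local Notation S := (@kink R p s d).
Local Notation X := (wdist p).
Local Notation xh := (@dist_row R p).
Local Notation H := (@hat_height R p s d).
Local Notation Eh := (@hat_slope R p s d).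
Local Notation cw := (@half_weight R p s d).

Lemma kink_ext (x y : nat -> R) n :
  (forall i, (T n <= i < T n.+1)%N -> x i = y i) ->
  (forall i, (K n <= i < K n.+1)%N -> x i = y i) ->
  (forall i, (2 * n + d <= i <= (2 * n + d).+2)%N -> x i = y i) ->
  S x n = S y n.
Proof.
move=> hT hK hC; rewrite !kink_window // (eq_big_nat _ _ hT) (eq_big_nat _ _ hK).
by rewrite !hC //; lia.
Qed.

Lemma psum_linear (x y : nat -> R) c m :
  psum (fun i => x i + c * y i) m = psum x m + c * psum y m.
Proof. by rewrite /psum big_split /= mulr_sumr. Qed.

Lemma slope_linear (x y : nat -> R) c m :
  E (fun i => x i + c * y i) m = E x m + c * E y m.
Proof. by rewrite /E !psum_linear; ring. Qed.

Definition indic (k i : nat) : R := (i == k)%:R.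

Lemma psum_indic k m : psum (indic k) m = (k < m)%N%:R.
Proof.
elim: m => [|m IHm]; first by rewrite psum0 ltn0.
have -> : (k < m.+1)%N = (k < m)%N || (k == m) by lia.
rewrite psumS IHm /indic eq_sym.
by case: (ltngtP k m) => _; rewrite ?addr0 ?add0r.
Qed.

Lemma slope_indic a a' k : (a + a' + d = k)%N -> (k < T a)%N -> (k < T a')%N ->
  E (indic k) a = 1 - (a' <= a)%N%:R - (a' < a)%N%:R.
Proof.
move=> Ek ka ka'; have [Ka _] := Iw_bound_sub p_pr p11 s_le Ek ka'.
rewrite /E !psum_indic ka (ltnNge k) Ka addr0 -Ek.
have -> : (a + a' + d < (2 * a + d).+1)%N = (a' <= a)%N by lia.
by have -> : (a + a' + d < 2 * a + d)%N = (a' < a)%N by lia.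
Qed.

Lemma height_antisym (x : nat -> R) chord_slope lo D :
  (forall i i', (lo <= i)%N -> (lo <= i')%N -> (i + i' + 1 = D)%N -> E x i + E x i' = 2 * chord_slope) ->
  forall n n', (n + n' = D)%N -> (lo <= n)%N -> (lo <= n')%N ->
  F x n' - F x n = chord_slope * (n'%:R - n%:R).
Proof.
move=> hE; suff main m n : (n + (n + m) = D)%N -> (lo <= n)%N ->
    F x (n + m)%N - F x n = chord_slope * m%:R.
  move=> n n' EnD hn hn'; case/orP: (leq_total n n') => nn'.
    have -> : n' = (n + (n' - n))%N by lia.
    rewrite main //; last by lia.
    by rewrite natrD; ring.
  have := main (n - n')%N n'; rewrite subnKC //.
  move=> /(_ ltac:(lia) hn') h; rewrite -opprB h natrB //; ring.
elim/ltn_ind: m n => -[|[|m]] IHm n EnD hn.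
- by rewrite addn0 subrr mulr0.
- rewrite addn1 heightS; have := hE n n hn hn ltac:(lia); lra.
have := IHm m ltac:(lia) n.+1 ltac:(lia) ltac:(lia).
rewrite !addnS heightS addSn !heightS -addnS.
have := hE n (n + m).+1 hn ltac:(lia) ltac:(lia).
rewrite -(natr1 m.+1) -(natr1 m) addnS; lra.
Qed.

Lemma hat_height_dual k n n' : (n + n' + d = k.+1)%N -> (k < T n)%N -> (k < T n')%N ->
  H k n' - H k n = cw k * (n'%:R - n%:R).
Proof.
move=> Ek kn kn'; apply: (@height_antisym _ _ (minn n n') (n + n')); try by lia.
move=> i i' hi hi' Ei; apply: hat_slope_dual => //; first by lia.
  by case: (leqP n n') hi => nn' hi; [apply: leq_trans kn _|apply: leq_trans kn' _];
     apply: leq_ur_bound; lia.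
by case: (leqP n n') hi' => nn' hi'; [apply: leq_trans kn _|apply: leq_trans kn' _];
   apply: leq_ur_bound; lia.
Qed.

Section Ultrametric.
Variable x : nat -> R.
Hypothesis x_gt0 : forall i, 0 < x i.
Hypothesis x_min : forall i j, i != j -> Num.min (x i) (X i j)%:R <= x j.
Hypothesis x_min2 : forall i j, i != j -> Num.min (x i) (x j) <= (X i j)%:R.

Lemma ultra_eq i k : i != k -> (X i k)%:R < x k -> x i = (X i k)%:R.
Proof.
move=> ik lt; have ki : k != i by rewrite eq_sym.
have := x_min ki; rewrite wdistC (min_r (ltW lt)).
have := x_min2 ik; rewrite minEle; case: ifP => h h1 h2.
  by apply/eqP; rewrite eq_le h1.
by move: (le_lt_trans h1 lt); rewrite ltxx.
Qed.

Lemma wdist_ge1 i k : 1 <= (X i k)%:R :> R.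
Proof. by rewrite ler1n. Qed.

Lemma ultra_ge1 k i : 1 <= x k -> 1 <= x i.
Proof.
case: (eqVneq k i) => [->//|ki] k1; apply: le_trans (x_min ki).
by rewrite le_min k1 wdist_ge1.
Qed.

Lemma p_ge11_mul (u : R) : 0 <= u -> 11 * u <= p%:R * u.
Proof. by move=> u0; apply: ler_wpM2r => //; rewrite ler_nat. Qed.

Definition concave_part (y : nat -> R) n :=
  y (2 * n + d)%N + 2 * y (2 * n + d).+1 + y (2 * n + d).+2.

(* The weights whose kink differs from the one they have at [w = w_k]; their
   value is still at least [x k]. *)
Definition saturated k i := (i == k) || (x k < (X i k)%:R).

Lemma saturated_ge k i : saturated k i -> x k <= x i.
Proof.
case: (eqVneq i k) => [->//|ik]; rewrite /saturated (negbTE ik) /= => lt.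
have ki : k != i by rewrite eq_sym.
by have := x_min ki; rewrite wdistC (min_l (ltW lt)).
Qed.

Lemma not_saturated k i : ~~ saturated k i -> xh k i <= x i.
Proof.
rewrite /saturated negb_or -leNgt => /andP[ik h]; rewrite /xh (negbTE ik).
by have := @x_min k i; rewrite eq_sym => /(_ ik); rewrite wdistC (min_r h).
Qed.

Lemma ur_bound_width n : (T n.+1 - T n = p + 1)%N.
Proof. by clear p_pr p11 s_le; rewrite /T; lia. Qed.

Lemma Iw_bound_width n : (1 <= K n.+1 - K n)%N.
Proof.
rewrite /K; have : (((n + (p - 1 - s)) %/ p <= (n.+1 + (p - 1 - s)) %/ p))%N.
  by apply: leq_div2r; lia.
lia.
Qed.

(** The [T] window holds [p + 1] weights and the [K] window at least one, each worth at least 1. A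
    saturated weight raises one of these units to [x k]. *)
Lemma kink_ge n : (forall i, 1 <= x i) -> p%:R + 2 - concave_part x n <= S x n.
Proof.
move=> x1; rewrite kink_window // /concave_part.
have h1 := @sum_ge1 R x (T n) (T n.+1) (fun i _ => x1 i).
have h2 := @sum_ge1 R x (K n) (K n.+1) (fun i _ => x1 i).
have := Iw_bound_width n; rewrite -(ler_nat R); rewrite ur_bound_width natrD in h1; lra.
Qed.

Lemma kink_saturated k n i : (forall i, 1 <= x i) -> saturated k i ->
  (T n <= i < T n.+1)%N || (K n <= i < K n.+1)%N ->
  x k + p%:R + 1 - concave_part x n <= S x n.
Proof.
move=> x1 /saturated_ge xki; rewrite kink_window // /concave_part.
have h1 := @sum_ge1 R x (T n) (T n.+1) (fun i _ => x1 i).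
have h2 := @sum_ge1 R x (K n) (K n.+1) (fun i _ => x1 i).
have := Iw_bound_width n; rewrite -(ler_nat R); rewrite ur_bound_width natrD in h1.
move=> hK; case/orP => hi.
  have := @sum_ge1D R x (T n) (T n.+1) i (fun i _ => x1 i) hi.
  by rewrite ur_bound_width natrD; lra.
have := @sum_ge1D R x (K n) (K n.+1) i (fun i _ => x1 i) hi; lra.
Qed.

Lemma kink_unsaturated k n : 
  (forall i, (T n <= i < T n.+1)%N || (K n <= i < K n.+1)%N -> ~~ saturated k i) ->
  S (xh k) n + concave_part (xh k) n - concave_part x n <= S x n.
Proof.
move=> h; rewrite !kink_window // /concave_part.
have h1 : \sum_(T n <= i < T n.+1) xh k i <= \sum_(T n <= i < T n.+1) x i.
  by apply: ler_sum_nat => i hi; apply: not_saturated; apply: h; rewrite hi.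
have h2 : \sum_(K n <= i < K n.+1) xh k i <= \sum_(K n <= i < K n.+1) x i.
  by apply: ler_sum_nat => i hi; apply: not_saturated; apply: h; rewrite hi orbT.
lra.
Qed.

Lemma kink_case k n :
  (exists2 i, (T n <= i < T n.+1)%N || (K n <= i < K n.+1)%N & saturated k i) \/
  (forall i, (T n <= i < T n.+1)%N || (K n <= i < K n.+1)%N -> ~~ saturated k i).
Proof.
case: (boolP (has (saturated k) (index_iota (T n) (T n.+1) ++ index_iota (K n) (K n.+1)))).
  by case/hasP => i; rewrite mem_cat !mem_index_iota; left; exists i.
move/hasPn => h; right => i hi; apply: h.
by rewrite mem_cat !mem_index_iota.
Qed.

(* The range [(a', a + 1)] of [k], with [a + a' + 1 = d_Iw k]: the abscissa
   [a + 1] is the largest minimizer of [Delta'_{k,l} - l x_k]. *)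
Definition steinberg_range k a a' : Prop :=
  [/\ (a + a' + d = k)%N, (a' < a)%N, (k < T a')%N &
   forall n n', (n + n' + d = k.+1)%N -> (k < T n)%N -> (k < T n')%N ->
     ((n <= a.+1)%N -> H k a.+1 - H k n <= (cw k + x k) * (a.+1%:R - n%:R)) /\
     ((a.+1 < n)%N -> (cw k + x k) * (n%:R - a.+1%:R) < H k n - H k a.+1)].

(** On the range, [F x] differs from [H k - |l| x k] by an affine function. The slope of this
    function, read off at the increment [a] where [-|l| x k] has slope [- x k], plus the slope
    [cw k] of the mirrored chords of [H k], is the slope of the chord over the range. *)
Definition chord_slope k a := E x a - (Eh k a - cw k - x k).

(** * The height function on one range and beside it *)

Section Range.
Variables k a a' : nat.
Hypothesis rg : steinberg_range k a a'.

Lemma range_sum : (a + a' + d = k)%N. Proof. by case: rg. Qed.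
Lemma range_lt : (a' < a)%N. Proof. by case: rg. Qed.
Lemma range_ur_bound : (k < T a')%N. Proof. by case: rg. Qed.
Lemma range_ur_bound_ge n : (a' <= n)%N -> (k < T n)%N.
Proof. by move=> h; apply: (leq_trans range_ur_bound); apply: leq_ur_bound. Qed.

Lemma range_slope_le : Eh k a <= cw k + x k.
Proof.
have [Ek aa ka' h] := rg.
have [h1 _] := h a a'.+1 ltac:(lia) (range_ur_bound_ge (ltnW aa)) (range_ur_bound_ge (leqnSn _)).
by move: (h1 (leqnSn a)); rewrite /H heightS -/(H k) -natr1 -/(Eh k a); lra.
Qed.

Lemma range_ge b : (T a' <= k + b < T a)%N ->
  (p%:R - 3) / 2 * (a - a')%:R + 1 + (logn p b)%:R <= x k.
Proof.
move=> hb; have := hat_slope_ge R p_pr p11 s_le range_sum range_ur_bound range_lt hb.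
have := range_slope_le; lra.
Qed.

(** The factor 4 is [(p - 3) / 2] at [p = 11]. *)
Lemma range_x_ge : 4 * (a - a')%:R + 1 <= x k.
Proof.
have aa := range_lt; have ka' := range_ur_bound.
have hb : (T a' <= k + (T a' - k) < T a)%N.
  rewrite subnKC ?(ltnW ka') // leqnn /=.
  by apply: leq_trans (leq_ur_bound p s d aa); rewrite /T; lia.
apply: le_trans (range_ge hb).
have := ler0n R (logn p (T a' - k)); have := p_ge11_mul (ler0n R (a - a')).
lra.
Qed.

Lemma range_x_ge1 i : 1 <= x i.
Proof.
apply: (@ultra_ge1 k); apply: le_trans range_x_ge.
by have := ler0n R (a - a'); lra.
Qed.

(** Since [v_p(m) <= m / p <= m / 11], a distance below [44 j] has valuation below [4 j], the margin
    of [range_x_ge]. *)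
Lemma near_far i : (i - k + (k - i) < 44 * (a - a'))%N -> (X i k)%:R < x k.
Proof.
move=> h; apply: lt_le_trans range_x_ge.
have : (X i k < 4 * (a - a') + 1)%N.
  rewrite /X; move: h; move: (i - k + (k - i))%N => m h.
  have := logn_le_div p_pr m.
  have : (11 * logn p m <= p * logn p m)%N by rewrite leq_mul2r p11 orbT.
  lia.
by rewrite -(ltr_nat R) natrD natrM.
Qed.

(** Take [b = i - k] in [range_ge]; the positive multiple of [a - a'] makes the inequality
    strict. *)
Lemma window_ur_far n i : (a' <= n < a)%N -> (T n <= i < T n.+1)%N ->
  i != k /\ (X i k)%:R < x k.
Proof.
move=> /andP[n1 n2] /andP[i1 i2]; have kn := range_ur_bound_ge n1.
have ki : (k < i)%N by apply: leq_trans kn i1.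
split; first by rewrite gtn_eqF.
have /range_ge : (T a' <= k + (i - k) < T a)%N.
  by have := leq_ur_bound p s d n1; have := leq_ur_bound p s d n2; lia.
apply: lt_le_trans; rewrite /X.
have -> : (i - k + (k - i) = i - k)%N by lia.
have aa : 1 <= (a - a')%:R :> R by rewrite ler1n; have := range_lt; lia.
by have := p_ge11_mul (ler0n R (a - a')); rewrite natrD; lra.
Qed.

(** Here [b = p (k - i)]: the mirror image of [i] satisfies the hypothesis of [range_ge], and its
    valuation is even one larger than that of [k - i]. *)
Lemma window_Iw_far n i : (a' <= n < a)%N -> (K n <= i < K n.+1)%N ->
  i != k /\ (X i k)%:R < x k.
Proof.
move=> /andP[n1 n2]; have Ek := range_sum; have aa := range_lt.
set n' := (a + a' - n)%N; have En : (n + n' + d = k)%N by rewrite /n'; lia.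
have En1 : (n.+1 + n'.-1 + d = k)%N by rewrite /n'; lia.
rewrite ltnNge (Iw_bound_mirror p_pr p11 s_le _ En) (Iw_bound_mirror p_pr p11 s_le _ En1) -leqNgt => /andP[i1 i2].
have kT : (k < T n'.-1)%N by apply: range_ur_bound_ge; rewrite /n'; lia.
have ik : (i < k)%N.
  rewrite ltnNge; apply/negP => ki; have := leq_mul (leqnn p) ki.
  by move: i2 kT; move: (T _) => t; lia.
split; first by rewrite ltn_eqF.
have pik : (p * k = p * i + p * (k - i))%N by rewrite -mulnDr subnKC // ltnW.
have /range_ge : (T a' <= k + p * (k - i) < T a)%N.
  apply/andP; split.
    by apply: leq_trans (leq_ur_bound p s d (_ : a' <= n'.-1)%N) _; [rewrite /n'; lia|lia].
  by apply: leq_trans (leq_ur_bound p s d (_ : n' <= a)%N); [lia|rewrite /n'; lia].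
apply: lt_le_trans; rewrite /X.
have -> : (i - k + (k - i) = k - i)%N by lia.
have -> : logn p (p * (k - i)) = (logn p (k - i)).+1.
  by rewrite lognM ?(prime_gt0 p_pr) ?subn_gt0 // (logn_prime p p_pr) eqxx.
rewrite -natr1.
have a1 : 1 <= (a - a')%:R :> R by rewrite ler1n; lia.
by have := p_ge11_mul (ler0n R (a - a')); rewrite natrD /=; lra.
Qed.

(** Downward induction from [a]: every weight other than [k] that takes part in a kink inside the
    range has [X i k < x k], hence [x i = X i k], so these kinks are those of
    [xh k + x k * indic k]. *)
Lemma range_slope n : (a' <= n <= a)%N ->
  E x n - chord_slope k a = Eh k n - cw k + x k * E (indic k) n.
Proof.
move=> /andP[n1 n2]; have aa := range_lt; have Ek := range_sum.
have -> : n = (a - (a - n))%N by lia.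
have : (a - n <= a - a')%N by lia.
elim: (a - n)%N => [_|m IHm hm].
  rewrite subn0 (slope_indic Ek (range_ur_bound_ge (ltnW aa)) (range_ur_bound_ge (leqnn _))) (ltnW aa) aa /chord_slope /=; ring.
have {}IHm := IHm (ltnW hm).
set q := (a - m.+1)%N in IHm *; have Eq : (a - m = q.+1)%N by rewrite /q; lia.
have : S x q = S (fun i => xh k i + x k * indic k i) q.
  have hq : (a' <= q < a)%N by rewrite /q; lia.
  apply: kink_ext => i hi.
  - have [ik h] := window_ur_far hq hi; rewrite (ultra_eq ik h) /xh /indic (negbTE ik) /=; ring.
  - have [ik h] := window_Iw_far hq hi; rewrite (ultra_eq ik h) /xh /indic (negbTE ik) /=; ring.
  rewrite /xh /indic; case: eqVneq => [->|ik] /=; first by ring.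
  rewrite (ultra_eq ik); first by ring.
  by apply: near_far; lia.
rewrite /S !slope_linear -/(Eh k q) -/(Eh k q.+1) -Eq; rewrite Eq in IHm *; lra.
Qed.

Lemma range_slope_dual i i' : (a' <= i)%N -> (a' <= i')%N -> (i + i' + 1 = a.+1 + a')%N ->
  E x i + E x i' = 2 * chord_slope k a.
Proof.
move=> hi hi' Ei; have Ek := range_sum.
have /range_slope h1 : (a' <= i <= a)%N by lia.
have /range_slope h2 : (a' <= i' <= a)%N by lia.
have Ek1 : (i + i' + d = k)%N by lia.
have Ek2 : (i' + i + d = k)%N by lia.
have := hat_slope_dual R p_pr p11 s_le Ek1 (range_ur_bound_ge hi) (range_ur_bound_ge hi').
rewrite (slope_indic Ek1) ?range_ur_bound_ge // in h1; rewrite (slope_indic Ek2) ?range_ur_bound_ge // in h2.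
by case: (ltngtP i i') h1 h2 => _ /=; lra.
Qed.

Lemma range_chord n n' : (a' <= n)%N -> (a' <= n')%N -> (n + n' = a.+1 + a')%N ->
  F x n' - F x n = chord_slope k a * (n'%:R - n%:R).
Proof.
by move=> hn hn' En; apply: (height_antisym range_slope_dual).
Qed.

(** The right half is the minimizing property of [a + 1]; the left half is its reflection through
    [range_chord]. *)
Lemma range_line n : (a' <= n <= a.+1)%N ->
  F x a.+1 - chord_slope k a * (a.+1%:R - n%:R) <= F x n.
Proof.
have Ek := range_sum; have aa := range_lt.
have right m : (a' <= m)%N -> (a.+1 + a' - m <= m)%N -> (m <= a.+1)%N ->
    F x a.+1 - chord_slope k a * (a.+1%:R - m%:R) <= F x m.
  move=> m1 m2 m3; have [_ _ _ hr] := rg.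
  have m4 : (a' <= a.+1 + a' - m)%N by lia.
  have m5 : (m + (a.+1 + a' - m) + d = k.+1)%N by lia.
  have [/(_ m3) hH _] := hr _ _ m5 (range_ur_bound_ge m1) (range_ur_bound_ge m4).
  suff : F x a.+1 - F x m = H k a.+1 - H k m + (chord_slope k a - cw k - x k) * (a.+1%:R - m%:R).
    by move: hH; lra.
  have Em : (a.+1 = m + (a.+1 - m))%N by lia.
  rewrite {1 2}Em -natrB //.
  have : (a.+1 - m <= a.+1 - m)%N by [].
  move: {1 3 4 5}(a.+1 - m)%N => r; elim: r => [_|r IHr hr'].
    by rewrite addn0 !subrr mulr0 addr0.
  rewrite addnS !heightS -addrAC IHr 1?ltnW // -natr1 /H heightS -/(Eh k _).
  have /range_slope : (a' <= m + r <= a)%N by lia.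
  rewrite (@slope_indic (m + r) (a + a' - (m + r)) k) ?range_ur_bound_ge //; try lia.
  have -> : (a + a' - (m + r) <= m + r)%N by lia.
  have -> : (a + a' - (m + r) < m + r)%N by lia.
  move=> /= hE; lra.
move=> /andP[n1 n2]; case: (leqP (a.+1 + a' - n) n) => h; first exact: right.
have := right (a.+1 + a' - n)%N ltac:(lia) ltac:(lia) ltac:(lia).
have := @range_chord n (a.+1 + a' - n)%N n1 ltac:(lia) ltac:(lia).
lra.
Qed.

Lemma range_left : F x a' = F x a.+1 - chord_slope k a * (a.+1%:R - a'%:R).
Proof.
have := @range_chord a' a.+1 (leqnn _) (ltnW (leqW range_lt)) (addnC _ _); lra.
Qed.

(** A primitive of the logarithmic part of the concave kinks met beyond an end of the range (see
    [concave_part_dist]), so the loss after [r] steps telescopes. By [v_p(m!) <= m] it grows at most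
    like [4 r], against a gain of [p - 2] per step. *)
Definition fact_logs r : nat :=
  (logn p (a - a' + 2 * r).-1`! + logn p (a - a' + 2 * r)`!)%N.

Lemma fact_logs_le r : (fact_logs r)%:R <= 2 * (a - a')%:R + 4 * r%:R :> R.
Proof.
have := logn_fact_le p_pr (a - a' + 2 * r); have := logn_fact_le p_pr (a - a' + 2 * r).-1.
move=> h1 h2; have : (fact_logs r <= 2 * (a - a') + 4 * r)%N by rewrite /fact_logs; lia.
by rewrite -(ler_nat R) natrD !natrM.
Qed.

(* [e] lists the increments beyond an end of the range relative to the chord.
   They dominate those of the hat function until the first saturated kink, which
   adds [x k] and leaves a margin that concave kinks cannot exhaust. *)
Lemma tail_pos (ka e : nat -> R) rmax :
  e 0%N = Eh k a - cw k - x k ->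
  (forall r, (r < rmax)%N -> e r.+1 = e r + ka r) ->
  (forall r, (r < rmax)%N -> p%:R - 2 - ((fact_logs r.+1)%:R - (fact_logs r)%:R) <= ka r) ->
  (forall r, (r < rmax)%N -> (r <= a')%N -> (k < T (a' - r))%N ->
     x k + p%:R - 3 - ((fact_logs r.+1)%:R - (fact_logs r)%:R) <= ka r \/
     [/\ (r < a')%N, (k < T (a' - r.+1))%N & Eh k (a + r).+1 - Eh k (a + r) <= ka r]) ->
  forall r, (0 < r <= rmax)%N -> 0 < \sum_(q < r) e q.+1.
Proof.
move=> e0 eS hgen hdich r.
have aa := range_lt; have Ek := range_sum.
set j := (a - a')%:R : R; have j0 : 1 <= j by rewrite ler1n; lia.
(* [fact_logs q <= 2 j + 4 q], while [p - 2 >= 9]. *)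
have pos q : 0 < 4 * j + q%:R * (p%:R - 2) - (fact_logs q)%:R.
  have := fact_logs_le q; have := p_ge11_mul (ler0n R q); have := ler0n R q.
  by rewrite -/j; lra.
(* The first bound holds at every step and falls short of the safe one by [x k - 1], exactly the
   surplus of a saturated kink over a generic one. The disjunction records whether such a kink has
   been met. *)
suff main : (r <= rmax)%N ->
    4 * j + 1 - x k + r%:R * (p%:R - 2) - (fact_logs r)%:R <= e r /\
    ([/\ (r <= a')%N, (k < T (a' - r))%N, Eh k (a + r) - cw k - x k <= e r &
         H k (a.+1 + r) - H k a.+1 - (cw k + x k) * r%:R <= \sum_(q < r) e q.+1] \/
     [/\ 4 * j + r%:R * (p%:R - 2) - (fact_logs r)%:R <= e r, (0 < r)%N &
         0 < \sum_(q < r) e q.+1]).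
  move=> /andP[r0 /main[_ [[ra kT _ hs]|[]//]]]; apply: lt_le_trans hs.
  have [_ _ _ hr] := rg.
  have E1 : (a.+1 + r + (a' - r) + d = k.+1)%N by lia.
  have kT1 : (k < T (a.+1 + r))%N by apply: range_ur_bound_ge; lia.
  have [_ /(_ _)] := hr _ _ E1 kT1 kT; rewrite natrD.
  by move=> /(_ ltac:(lia)); lra.
elim: r => [_|r IHr rm].
  split.
    have h0 : 0 <= (fact_logs 0)%:R :> R by exact: ler0n.
    rewrite e0; have := @range_ge (T a' - k)%N.
    have kT := range_ur_bound; rewrite subnKC ?(ltnW kT) // leqnn /=.
    have -> : (T a' < T a)%N by apply: leq_trans (leq_ur_bound p s d aa); rewrite /T; lia.
    move=> _; have := hat_slope_ge R p_pr p11 s_le Ek kT aa (b := (T a' - k)%N).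
    rewrite subnKC ?(ltnW kT) // leqnn /=.
    have -> : (T a' < T a)%N by apply: leq_trans (leq_ur_bound p s d aa); rewrite /T; lia.
    move=> /(_ isT); have := ler0n R (logn p (T a' - k)).
    have := p_ge11_mul (ler0n R (a - a')); rewrite -/j -/(Eh k a) -/(cw k); lra.
  left; rewrite subn0 addn0 e0 big_ord0 addn0 subrr mulr0 subr0; split => //.
  exact: range_ur_bound.
have {IHr} [g1 g2] := IHr (ltnW rm).
have rr : r.+1%:R = r%:R + 1 :> R by rewrite -natr1.
have gen := hgen r rm; rewrite big_ord_recr /= (eS r rm) rr.
split; first by lra.
case: g2 => [[ra kT ge gs]|[g r0 gs]]; last first.
  right; split => //; first by lra.
  by have := pos r.+1; rewrite rr; lra.
have {}gs0 : 0 <= \sum_(q < r) e q.+1.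
  case: (posnP r) => [->|r0]; first by rewrite big_ord0.
  apply: le_trans gs; have [_ _ _ hr] := rg.
  have E1 : (a.+1 + r + (a' - r) + d = k.+1)%N by lia.
  have kT1 : (k < T (a.+1 + r))%N by apply: range_ur_bound_ge; lia.
  have [_ /(_ _)] := hr _ _ E1 kT1 kT; rewrite natrD.
  by move=> /(_ ltac:(lia)); lra.
case: (hdich r rm ra kT) => [hb|[ra' kT' hg]]; [right|left].
  have := pos r.+1; rewrite rr; split => //; lra.
split => //; first by rewrite addnS; lra.
rewrite addnS /H heightS -!/(H k _) -/(Eh k _) addSn; move: gs; rewrite addSn.
lra.
Qed.

Lemma concave_part_dist n r :
  (2 * n + d = k + (a - a' + 2 * r))%N \/ (2 * n + d + (a - a' + 2 * r).+2 = k)%N ->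
  concave_part (xh k) n = 4 + ((fact_logs r.+1)%:R - (fact_logs r)%:R).
Proof.
have aa := range_lt; rewrite /concave_part /fact_logs => hn.
have {}aa : (0 < a - a')%N by lia.
move: aa hn; move: (a - a')%N => j; have -> : (2 * r.+1 = (2 * r).+2)%N by lia.
move=> j0; rewrite !addnS; move: (2 * r)%N => u.
have -> : (j + u = (j + u).-1.+1)%N by lia.
move: (j + u).-1 => v hn /=; rewrite !logn_factS /xh /X.
case: hn => hn.
  have h0 : (2 * n + d == k) = false by lia.
  have h1 : ((2 * n + d).+1 == k) = false by lia.
  have h2 : ((2 * n + d).+2 == k) = false by lia.
  rewrite h0 h1 h2.
  have -> : (2 * n + d - k + (k - (2 * n + d)) = v.+1)%N by lia.
  have -> : ((2 * n + d).+1 - k + (k - (2 * n + d).+1) = v.+2)%N by lia.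
  have -> : ((2 * n + d).+2 - k + (k - (2 * n + d).+2) = v.+3)%N by lia.
  by rewrite !natrD; ring.
have h0 : (2 * n + d == k) = false by lia.
have h1 : ((2 * n + d).+1 == k) = false by lia.
have h2 : ((2 * n + d).+2 == k) = false by lia.
rewrite h0 h1 h2.
have -> : (2 * n + d - k + (k - (2 * n + d)) = v.+3)%N by lia.
have -> : ((2 * n + d).+1 - k + (k - (2 * n + d).+1) = v.+2)%N by lia.
have -> : ((2 * n + d).+2 - k + (k - (2 * n + d).+2) = v.+1)%N by lia.
by rewrite !natrD; ring.
Qed.

(** With [j = a - a' >= 1] these weights are within [j + 2 r + 2 <= 43 j] of [k], inside the reach
    of [near_far]; this fixes the factor 20. *)
Lemma concave_part_eq n r : (r <= 20 * (a - a'))%N ->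
  (2 * n + d = k + (a - a' + 2 * r))%N \/ (2 * n + d + (a - a' + 2 * r).+2 = k)%N ->
  concave_part x n = concave_part (xh k) n.
Proof.
have aa := range_lt; move=> hr hn.
have ev i : (2 * n + d <= i <= (2 * n + d).+2)%N -> x i = xh k i.
  move=> hi; have ik : i != k by lia.
  rewrite /xh (negbTE ik); apply: ultra_eq => //; apply: near_far; lia.
by rewrite /concave_part !ev //; lia.
Qed.

Lemma range_right r : (0 < r <= 20 * (a - a'))%N ->
  F x a.+1 + chord_slope k a * r%:R < F x (a.+1 + r).
Proof.
move=> hr; have aa := range_lt; have Ek := range_sum.
pose e q := E x (a + q) - chord_slope k a; pose ka q := S x (a + q).
suff : 0 < \sum_(q < r) e q.+1.
  have -> : \sum_(q < r) e q.+1 = F x (a.+1 + r) - F x a.+1 - chord_slope k a * r%:R.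
    elim: r {hr} => [|r IHr]; first by rewrite big_ord0 addn0 subrr mulr0 subr0.
    by rewrite big_ord_recr /= IHr /e !addnS !addSn (@heightS _ _ _ _ _ (a + r).+1) -(natr1 r); ring.
  lra.
apply: (@tail_pos ka e (20 * (a - a'))) => //.
- by rewrite /e addn0 /chord_slope; ring.
- by move=> q _; rewrite /e /ka /S addnS; ring.
- move=> q hq; have C1 : (2 * (a + q) + d = k + (a - a' + 2 * q))%N by lia.
  have := kink_ge (a + q) range_x_ge1.
  rewrite (concave_part_eq (ltnW hq) (or_introl C1)) (concave_part_dist (or_introl C1)) /ka; lra.
move=> q hq qa kT; have C1 : (2 * (a + q) + d = k + (a - a' + 2 * q))%N by lia.
have Cx := concave_part_eq (ltnW hq) (or_introl C1).
case: (kink_case k (a + q)) => [[i hi bi]|hg].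
  left; have := kink_saturated range_x_ge1 bi hi.
  rewrite Cx (concave_part_dist (or_introl C1)) /ka; lra.
right; have := kink_unsaturated hg; rewrite Cx /S -/(Eh k _) -/(Eh k _) -/(S x _).
(* As [k] is itself saturated, it is not in the window. By the mirror, [a' - q - 1] then still
   satisfies [k < T _], and the comparison with [H k] goes on for one more step. *)
have nk : ~~ (K (a + q) <= k < K (a + q).+1)%N.
  apply/negP => hk; have := hg k; rewrite hk orbT => /(_ isT).
  by rewrite /saturated eqxx.
have K1' : (K (a + q) <= k)%N.
  have -> : (K (a + q) <= k)%N = (k + p * k < T (a' - q) + p * k)%N.
    by apply: Iw_bound_mirror => //; lia.
  by rewrite ltn_add2r.
have K2 : (K (a + q).+1 <= k)%N by move: nk; rewrite K1' /= -leqNgt.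
have qa' : (q < a')%N.
  by move: K2; rewrite /K; move: (_ %/ _)%N => u; lia.
have kT' : (k < T (a' - q.+1))%N.
  move: K2; suff -> : (K (a + q).+1 <= k)%N = (k + p * k < T (a' - q.+1) + p * k)%N.
    by rewrite ltn_add2r.
  by apply: Iw_bound_mirror => //; lia.
move=> h; split => //; rewrite /ka; lra.
Qed.

(** The same tail estimate read from right to left: [hat_slope_dual] converts the increments of
    [H k] on the left into those on the right that [tail_pos] asks for. *)
Lemma range_leftward r : (0 < r <= 20 * (a - a'))%N -> (r <= a')%N ->
  F x a' - chord_slope k a * r%:R < F x (a' - r).
Proof.
move=> hr ra; have aa := range_lt; have Ek := range_sum.
pose e q := chord_slope k a - E x (a' - q); pose ka q := S x (a' - q.+1).
suff : 0 < \sum_(q < r) e q.+1.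
  have -> : \sum_(q < r) e q.+1 = F x (a' - r) - F x a' + chord_slope k a * r%:R.
    elim: r ra {hr} => [|r IHr] ra; first by rewrite big_ord0 subn0 subrr mulr0 addr0.
    rewrite big_ord_recr /= IHr 1?ltnW // -natr1 /e.
    have -> : (a' - r = (a' - r.+1).+1)%N by lia.
    by rewrite heightS; ring.
  lra.
apply: (@tail_pos ka e r).
- have E1 : (a + a' + 1 = a.+1 + a')%N by lia.
  by have := range_slope_dual (ltnW aa) (leqnn a') E1; rewrite /e subn0 /chord_slope; lra.
- move=> q hq; rewrite /e /ka /S.
  have -> : (a' - q = (a' - q.+1).+1)%N by lia.
  by ring.
- move=> q hq; have C1 : (2 * (a' - q.+1) + d + (a - a' + 2 * q).+2 = k)%N by lia.
  have qj : (q <= 20 * (a - a'))%N by lia.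
  have := kink_ge (a' - q.+1) range_x_ge1.
  rewrite (concave_part_eq qj (or_intror C1)) (concave_part_dist (or_intror C1)) /ka; lra.
- move=> q hq qa kT; have C1 : (2 * (a' - q.+1) + d + (a - a' + 2 * q).+2 = k)%N by lia.
  have qj : (q <= 20 * (a - a'))%N by lia.
  have Cx := concave_part_eq qj (or_intror C1).
  case: (kink_case k (a' - q.+1)) => [[i hi bi]|hg].
    left; have := kink_saturated range_x_ge1 bi hi.
    rewrite Cx (concave_part_dist (or_intror C1)) /ka; lra.
  right; have := kink_unsaturated hg; rewrite Cx /S -/(Eh k _) -/(Eh k _) -/(S x _).
  have Eq : (a' - q = (a' - q.+1).+1)%N by lia.
  have kT' : (k < T (a' - q.+1))%N.
    rewrite ltnNge; apply/negP => hk; have := hg k.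
    by rewrite hk -Eq kT /= => /(_ isT); rewrite /saturated eqxx.
  have kTa : (k < T (a + q))%N by apply: range_ur_bound_ge; lia.
  have kTa1 : (k < T (a + q).+1)%N by apply: range_ur_bound_ge; lia.
  have D1 := @hat_slope_dual R _ s d p_pr p11 s_le (a + q) (a' - q) k ltac:(lia) kTa kT.
  have D2 := @hat_slope_dual R _ s d p_pr p11 s_le (a + q).+1 (a' - q.+1) k ltac:(lia) kTa1 kT'.
  move: D1 D2; rewrite -Eq -/(Eh k _) -/(cw k) /ka => D1 D2 h.
  by split => //; [lia|lra].
by lia.
Qed.

End Range.
End Ultrametric.
End Ranges.

(** * Convexity away from the ranges *)

Section Polygon.
Variables (R : realFieldType) (p s d : nat).
Hypotheses (p_pr : prime p) (p11 : (11 <= p)%N) (s_le : (s <= p - 2)%N).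

Local Notation T := (ur_bound p s d).
Local Notation K := (Iw_bound p s d).
Local Notation E := (@slope R p s d).
Local Notation F := (@height R p s d).
Local Notation S := (@kink R p s d).
Local Notation X := (wdist p).
Local Notation xh := (@dist_row R p).
Local Notation H := (@hat_height R p s d).
Local Notation Eh := (@hat_slope R p s d).
Local Notation cw := (@half_weight R p s d).

Lemma argmin k (xi : R) : (d <= k.+1)%N -> 0 < xi -> exists N N',
  [/\ (N + N' + d = k.+1)%N, (k < T N)%N, (k < T N')%N, (N' <= N)%N &
   forall n n', (n + n' + d = k.+1)%N -> (k < T n)%N -> (k < T n')%N ->
     ((n <= N)%N -> H k N - H k n <= (cw k + xi) * (N%:R - n%:R)) /\
     ((N < n)%N -> (cw k + xi) * (n%:R - N%:R) < H k n - H k N)].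
Proof.
move=> dk xi0; pose D := (k.+1 - d)%N.
pose ok n := [&& (n <= D)%N, (k < T n)%N & (k < T (D - n))%N].
pose phi n := H k n - (cw k + xi) * n%:R.
have TE n : (d + 1 + 12 * n <= T n)%N.
  have : (n * 11 <= n * p)%N by rewrite leq_mul2l p11 orbT.
  by rewrite /T; lia.
have [n0 ok0] : exists n0, ok n0.
  (* The middle index satisfies both constraints because [T n] is at least [12 n + d + 1]. *)
  exists (D./2); rewrite /ok; have := odd_double_half D; rewrite -addnn => DD.
  have := TE D./2; have := TE (D - D./2)%N.
  by move: (T _) (T _) => t1 t2 *; rewrite /D in DD *; lia.
pose ok' (i : 'I_D.+1) := ok i.
have n0D : (n0 < D.+1)%N by case/and3P: ok0; rewrite ltnS.
have [/= i0 oki0 i0min] := @arg_minP _ _ _ (Ordinal n0D) ok' (fun i : 'I_D.+1 => phi i) ok0.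
have imin n : ok n -> phi i0 <= phi n.
  by move=> okn; have nD : (n < D.+1)%N by [case/and3P: okn; rewrite ltnS];
     have := i0min (Ordinal nD) okn.
pose isN n := ok n && (phi n == phi i0).
have exN : exists n, isN n by exists i0; rewrite /isN eqxx andbT.
have bdN n : isN n -> (n <= D)%N by case/andP => /and3P[].
have [N /andP[okN /eqP EN] maxN] := ex_maxnP exN bdN.
have /and3P[ND kN kN'] := okN.
have Nmin n : ok n -> phi N <= phi n by rewrite EN; apply: imin.
have sumN : (N + (D - N) + d = k.+1)%N by rewrite /D in ND *; lia.
exists N, (D - N)%N; split => //.
  (* Otherwise the mirrored index does better: by duality [phi] changes by [- xi] times the positive
     difference of the two indices. *)
  rewrite leqNgt; apply/negP => NN'.
  have : ok (D - N)%N.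
    by rewrite /ok leq_subr kN' /=; have -> : (D - (D - N) = N)%N by lia.
  move/Nmin; rewrite /phi; have := hat_height_dual R p_pr p11 s_le sumN kN kN'.
  have : N%:R < (D - N)%:R :> R by rewrite ltr_nat.
  rewrite -subr_gt0 => /(mulr_gt0 xi0); lra.
move=> n n' En kn kn'.
have okn : ok n.
  have nD : (n <= D)%N by rewrite /D; lia.
  by rewrite /ok nD kn /=; have -> : (D - n = n')%N by rewrite /D; lia.
have := Nmin n okn; rewrite /phi => h; split => hn; first by lra.
suff : phi N < phi n by rewrite /phi; lra.
rewrite lt_neqAle Nmin // andbT; apply/negP => /eqP eqn.
by have := maxN n; rewrite /isN okn -eqn EN eqxx => /(_ isT); lia.
Qed.

Section Ultrametric.
Variable x : nat -> R.
Hypothesis x_gt0 : forall i, 0 < x i.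
Hypothesis x_min : forall i j, i != j -> Num.min (x i) (X i j)%:R <= x j.
Hypothesis x_min2 : forall i j, i != j -> Num.min (x i) (x j) <= (X i j)%:R.
Hypothesis d_le : (d <= 1)%N.

Local Notation range := (@steinberg_range R p s d x).
Local Notation mu := (@chord_slope R p s d x).
Local Notation bad := (@saturated R p x).
Local Notation conc := (@concave_part R d).

Lemma wdist_near i j : (0 < i - j + (j - i) < p)%N -> X i j = 1%N.
Proof.
rewrite /X; move: (i - j + (j - i))%N => m /andP[m0 mp].
have := logn_le_div p_pr m; case: (logn p m) => // e.
rewrite mulnS; lia.
Qed.

Lemma ultra_near i k : 1 < x k -> (0 < i - k + (k - i) < p)%N -> x i = 1.
Proof.
move=> xk hi; have ik : i != k by lia.
by rewrite (ultra_eq x_min x_min2 ik) wdist_near.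
Qed.

Lemma dist_row_near i k : (0 < i - k + (k - i) < p)%N -> xh k i = 1.
Proof.
move=> hi; have ik : i != k by lia.
by rewrite /xh (negbTE ik) wdist_near.
Qed.

Lemma concave_part_near k n : 1 < x k -> (2 * n + d <= k <= (2 * n + d).+2)%N ->
  conc (xh k) n - conc x n = - (1 + (k == (2 * n + d).+1)%:R) * x k.
Proof.
move=> xk hk; rewrite /concave_part.
have h i : (2 * n + d <= i <= (2 * n + d).+2)%N -> i != k -> x i = xh k i.
  move=> hi ik; rewrite (@ultra_near i k) ?dist_row_near //; lia.
have kk : xh k k = 0 by rewrite /xh eqxx.
case: (eqVneq k (2 * n + d)%N) => [E0|n0].
  have -> : (k == (2 * n + d).+1) = false by lia.
  by rewrite -E0 kk (h k.+1) ?(h k.+2) /=; try lia; ring.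
case: (eqVneq k (2 * n + d).+1) => [E1|n1] /=.
  by rewrite -E1 kk (h k.+1) ?(h (2 * n + d)%N) /=; try lia; ring.
have E2 : k = (2 * n + d).+2 by lia.
by rewrite -E2 kk (h (2 * n + d)%N) ?(h (2 * n + d).+1) /=; try lia; ring.
Qed.

Lemma concave_part_center k n : 1 < x k -> (2 * n + d <= k <= (2 * n + d).+2)%N ->
  conc x n = (if k == (2 * n + d).+1 then 2 else 3) + (1 + (k == (2 * n + d).+1)%:R) * x k.
Proof.
move=> xk hk; have := concave_part_near xk hk.
have h i : (0 < i - k + (k - i) < p)%N -> xh k i = 1 by apply: dist_row_near.
have kk : xh k k = 0 by rewrite /xh eqxx.
suff -> : conc (xh k) n = (if k == (2 * n + d).+1 then 2 else 3) by lra.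
rewrite /concave_part; case: (eqVneq k (2 * n + d)%N) => [E0|n0].
  have -> : (k == (2 * n + d).+1) = false by lia.
  by rewrite -E0 kk (h k.+1) ?(h k.+2) /=; try lia; ring.
case: (eqVneq k (2 * n + d).+1) => [E1|n1] /=.
  by rewrite -E1 kk (h k.+1) ?(h (2 * n + d)%N) /=; try lia; ring.
have E2 : k = (2 * n + d).+2 by lia.
by rewrite -E2 kk (h (2 * n + d)%N) ?(h (2 * n + d).+1) /=; try lia; ring.
Qed.

Lemma argmin_not_range k n :
  (forall a a', range k a a' -> ~~ (a' <= n < a)%N) ->
  (2 * n + d <= k <= (2 * n + d).+2)%N ->
  exists N N', [/\ (N + N' + d = k.+1)%N, (k < T N)%N, (k < T N')%N, (N' <= N <= N'.+1)%N &
   forall n n', (n + n' + d = k.+1)%N -> (k < T n)%N -> (k < T n')%N ->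
     (N < n)%N -> (cw k + x k) * (n%:R - N%:R) < H k n - H k N].
Proof.
move=> nr hk; have [N [N' [EN kN kN' NN h]]] := @argmin k (x k) ltac:(lia) (x_gt0 k).
exists N, N'; split => //; last by move=> m m' Em km km'; have [] := h m m' Em km km'.
rewrite NN /= leqNgt; apply/negP => N2.
have /nr : range k N.-1 N'.
  have N1 : N.-1.+1 = N by lia.
  split; [lia|lia|done|rewrite N1; exact: h].
by lia.
Qed.

(** A value below 1 is below every [X i j], so the ultrametric rule makes [x] constant. *)
Lemma kink_const n : x 0%N < 1 -> 0 < S x n.
Proof.
move=> x1; have xE i : x i = x 0%N.
  case: (eqVneq i 0%N) => [->//|i0]; have i0' : 0%N != i by rewrite eq_sym.
  have X1 := wdist_ge1 R p; apply/eqP; rewrite eq_le; apply/andP; split; last first.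
    by apply: le_trans (x_min i0'); rewrite le_min lexx (le_trans (ltW x1)).
  have := x_min i0; rewrite ge_min => /orP[//|h].
  by move: (le_lt_trans h x1); rewrite ltNge X1.
have sumE m1 m2 : \sum_(m1 <= i < m2) x i = x 0%N * (m2 - m1)%N%:R.
  rewrite (eq_bigr (fun=> x 0%N)); last by move=> i _.
  by rewrite sumr_const_nat mulr_natr.
rewrite kink_window // !xE !sumE ur_bound_width //.
have := x_gt0 0; have := Iw_bound_width d p_pr p11 s_le n; rewrite -(ler_nat R) => hK x0.
have hp : 11 <= p%:R :> R by rewrite ler_nat.
rewrite natrD; set u := (K n.+1 - K n)%N%:R in hK *; set P : R := p%:R in hp *.
have -> : x 0 * (P + 1) + x 0 * u - x 0 - 2 * x 0 - x 0 = x 0 * (P - 3 + u) :> R by ring.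
by apply: mulr_gt0 => //; lra.
Qed.

(** Weights at distance less than [p] have [X = 1], so at most one central weight [k] has [x k > 1],
    and only its concave kink is dangerous. It is offset by saturated weights in the convex windows
    or, when there are none, by the kink of [H k]: as no range of [k] covers [n + 1], the largest
    minimizer of [Delta'_{k,l} - l x_k] is at [l = 0] or [l = 1/2], which forces [H k] to bend by
    more than the concave kink. *)
Lemma kink_gt0 n : (forall k a a', range k a a' -> ~~ (a' <= n < a)%N) -> 0 < S x n.
Proof.
move=> nr; case: (ltP (x 0%N) 1) => [/kink_const//|x01].
have x1 i : 1 <= x i by apply: (ultra_ge1 x_min i x01).
have hp : 11 <= p%:R :> R by rewrite ler_nat.
case: (pselect (exists2 k, 1 < x k & (2 * n + d <= k <= (2 * n + d).+2)%N)); last first.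
  move=> nk; have xc i : (2 * n + d <= i <= (2 * n + d).+2)%N -> x i = 1.
    move=> hi; apply/eqP; rewrite eq_le x1 andbT leNgt; apply/negP => xi.
    by apply: nk; exists i.
  have := kink_ge d p_pr p11 s_le n x1; rewrite /concave_part !xc; try lia; lra.
case=> k xk hk; have xk0 := x_gt0 k.
have [N [N' [EN kN kN' NN hN]]] := argmin_not_range (nr k) hk.
have cn := concave_part_near xk hk; have cl := concave_part_center xk hk.
have nbad i : ~~ bad k i -> i != k by rewrite /saturated negb_or => /andP[].
(* Off the centre the concave kink of [k] is [x k], and one saturated weight suffices; at the centre
   it is [2 x k], and both windows must contribute. *)
case: (eqVneq k (2 * n + d).+1) cn cl => [E1|n1] /= cn cl; last first.
  case: (@kink_case R p s d x k n) => [[i hi bi]|hg].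
    have := kink_saturated p_pr p11 s_le x_min x1 bi hi; lra.
  have := kink_unsaturated (s := s) (d := d) x_min hg.
  rewrite -/(S x n) -/(S (xh k) n) -/(conc x n) => hS.
  suff : x k < S (xh k) n by lra.
  case: (eqVneq k (2 * n + d)%N) => [E0|n0].
    have EN1 : N = n.+1 by lia.
    have EN2 : N' = n by lia.
    rewrite {}EN1 {}EN2 in EN kN kN' hN NN.
    have Kn : (K n <= k)%N by rewrite (Iw_bound_mirror p_pr p11 s_le _ (_ : n + n + d = k)%N) ?ltn_add2r //; lia.
    have Kn1 : (K n.+1 <= k)%N.
      rewrite leqNgt; apply/negP => h; have := hg k; rewrite h Kn orbT => /(_ isT) /nbad.
      by rewrite eqxx.
    have n0' : (0 < n)%N by move: Kn1; rewrite /K; move: (_ %/ _)%N => u; lia.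
    have E2 : (n.+1 + n.-1 + d = k)%N by lia.
    have kT : (k < T n.-1)%N.
      by move: Kn1; rewrite (Iw_bound_mirror p_pr p11 s_le _ E2) ltn_add2r.
    have kT2 : (k < T n.+2)%N by apply: (leq_trans kT); apply: leq_ur_bound; lia.
    have := hN n.+2 n.-1 ltac:(lia) kT2 kT (leqnn _); rewrite {1}/H heightS -/(H k _) -/(Eh k _).
    have := hat_slope_dual R p_pr p11 s_le (_ : n + n + d = k)%N kN' kN'.
    rewrite /S -/(Eh k _) -/(Eh k _) -(natr1 n.+1) => /(_ ltac:(lia)); lra.
  have EN1 : N = n.+2 by lia.
  have EN2 : N' = n.+1 by lia.
  rewrite {}EN1 {}EN2 in EN kN kN' hN NN.
  have kT : (k < T n)%N.
    rewrite ltnNge; apply/negP => h; have := hg k; rewrite h kN' => /(_ isT) /nbad.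
    by rewrite eqxx.
  have kT3 : (k < T n.+3)%N by apply: (leq_trans kT); apply: leq_ur_bound; lia.
  have := hN n.+3 n ltac:(lia) kT3 kT (leqnn _); rewrite {1}/H heightS -/(H k _) -/(Eh k _).
  have := hat_slope_dual R p_pr p11 s_le (_ : n.+1 + n.+1 + d = k)%N kN' kN'.
  have := hat_slope_dual R p_pr p11 s_le (_ : n.+2 + n + d = k)%N kN kT.
  rewrite /S -/(Eh k _) -/(Eh k _) -(natr1 n.+2) => /(_ ltac:(lia)) h1 /(_ ltac:(lia)); lra.
have EN1 : N = n.+1 by lia.
have EN2 : N' = n.+1 by lia.
rewrite {}EN1 {}EN2 in EN kN kN' hN NN.
have A1 : (n.+1 + n + d = k)%N by lia.
have A2 : (n + n.+1 + d = k)%N by lia.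
have Kn : (K n <= k)%N by rewrite (Iw_bound_mirror p_pr p11 s_le _ A2) ltn_add2r.
have K1E i3 := Iw_bound_mirror p_pr p11 s_le i3 A1; have K2E i3 := Iw_bound_mirror p_pr p11 s_le i3 A2.
(* One weight from each window. The mirror between [k + p m] and [k - m] changes [X _ k] by one,
   hence the slack in [2 x k - 1]; what remains is at least [p - 3]. *)
have two i i3 : (T n <= i < T n.+1)%N -> (K n <= i3 < K n.+1)%N ->
    2 * x k - 1 <= x i + x i3 -> 0 < S x n.
  move=> hi hi3 hx; rewrite kink_window // -addrA -opprD -!addrA -opprD.
  have g1 := @sum_ge1D R x (T n) (T n.+1) i (fun i _ => x1 i) hi.
  have g2 := @sum_ge1D R x (K n) (K n.+1) i3 (fun i _ => x1 i) hi3.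
  have := Iw_bound_width d p_pr p11 s_le n; rewrite -(ler_nat R).
  rewrite ur_bound_width natrD in g1; move: cl; rewrite /concave_part; lra.
case: (ltnP k (T n)) => kTn; last first.
  have kW : (T n <= k < T n.+1)%N by rewrite kTn.
  apply: (two k k kW); last by lra.
  by rewrite Kn ltnNge K1E ltn_add2r -leqNgt.
have Kn1 : (K n.+1 <= k)%N by rewrite K1E ltn_add2r.
have XM m : (0 < m)%N -> X (k + p * m) k = (X (k - m) k).+1 \/ (k < m)%N.
  move=> m0; case: (leqP m k) => mk; [left|by right]; rewrite /X.
  have -> : (k + p * m - k + (k - (k + p * m)) = p * m)%N by lia.
  have -> : (k - m - k + (k - (k - m)) = m)%N by lia.
  by rewrite lognM ?(prime_gt0 p_pr) // (logn_prime p p_pr) eqxx.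
case: (@kink_case R p s d x k n) => [[i /orP[hi|hi] bi]|hg].
- have ki : (k < i)%N by case/andP: hi => hi _; apply: leq_trans kTn hi.
  have xi := saturated_ge x_min bi.
  move: bi; rewrite /saturated gtn_eqF //= => bi.
  have : (1 < X i k)%N by rewrite -(ltr_nat R); apply: lt_trans xk bi.
  rewrite /X; have -> : (i - k + (k - i) = i - k)%N by lia.
  rewrite add1n ltnS logn_gt0 mem_primes p_pr subn_gt0 ki /= => /dvdnP[m Em].
  have {}Em : i = (k + p * m)%N by rewrite mulnC; lia.
  have m0 : (0 < m)%N by case: m Em => // Em; move: ki; rewrite Em muln0 addn0 ltnn.
  have mk : (m <= k)%N.
    rewrite leqNgt; apply/negP => km; have := leq_mul (leqnn p) km.
    case/andP: hi => _; rewrite /T Em {1}E1 => hi.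
    have : (p * k.+1 = 2 * (p * n) + p * d + 2 * p)%N by rewrite E1; lia.
    move: hi; move: (p * k.+1)%N (p * m)%N => u v; lia.
  have [XE|] := XM m m0; last by lia.
  have Ep : (p * k = p * (k - m) + p * m)%N by rewrite -mulnDr subnK.
  apply: (two i (k - m)%N hi).
    by rewrite [(_ < K n.+1)%N]ltnNge K1E K2E -leqNgt Ep; lia.
  have nkm : k != (k - m)%N by lia.
  move: bi; rewrite Em XE -natr1 => bi.
  have := x_min nkm; rewrite wdistC ge_min -Em => /orP[]; lra.
- have ik : (i < k)%N by case/andP: hi => _ hi; apply: leq_trans hi Kn1.
  move: bi; rewrite /saturated ltn_eqF //= => bi.
  have m0 : (0 < k - i)%N by lia.
  have [XE|] := XM _ m0; last by lia.
  have Ep : (p * k = p * i + p * (k - i))%N by rewrite -mulnDr subnKC // ltnW.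
  have hT : (T n <= k + p * (k - i) < T n.+1)%N.
    by move: hi; rewrite [(_ < K n.+1)%N]ltnNge K1E K2E -leqNgt Ep; lia.
  have ki : k != i by lia.
  apply: (two _ i hT hi); move: XE; rewrite subKn 1?ltnW // => XE.
  have gx := x_min ki; rewrite wdistC (min_l (ltW bi)) in gx.
  suff : x k <= x (k + p * (k - i))%N by lra.
  apply: (saturated_ge x_min); rewrite /saturated XE -natr1; apply/orP; right; lra.
have := kink_unsaturated (s := s) (d := d) x_min hg.
rewrite -/(S x n) -/(S (xh k) n) -/(conc x n) => hS.
suff : 2 * x k < S (xh k) n by lra.
have kT2 : (k < T n.+2)%N by apply: (leq_trans kN); apply: leq_ur_bound.
have := hN n.+2 n ltac:(lia) kT2 kTn (leqnn _); rewrite {1}/H heightS -/(H k _) -/(Eh k _).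
have := hat_slope_dual R p_pr p11 s_le A1 kN kTn.
rewrite /S -/(Eh k _) -/(Eh k _) -(natr1 n.+1); lra.
Qed.

End Ultrametric.
End Polygon.

(** * Nesting and supporting lines *)

Section Global.
Variables (R : realFieldType) (p s d : nat).
Hypotheses (p_pr : prime p) (p11 : (11 <= p)%N) (s_le : (s <= p - 2)%N).

Local Notation T := (ur_bound p s d).
Local Notation E := (@slope R p s d).
Local Notation F := (@height R p s d).
Local Notation S := (@kink R p s d).
Local Notation X := (wdist p).
Local Notation H := (@hat_height R p s d).
Local Notation cw := (@half_weight R p s d).

Variable x : nat -> R.
Hypothesis x_gt0 : forall i, 0 < x i.
Hypothesis x_min : forall i j, i != j -> Num.min (x i) (X i j)%:R <= x j.
Hypothesis x_min2 : forall i j, i != j -> Num.min (x i) (x j) <= (X i j)%:R.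
Hypothesis d_le : (d <= 1)%N.

Local Notation range := (@steinberg_range R p s d x).
Local Notation mu := (@chord_slope R p s d x).

Let rline := @range_line R p s d p_pr p11 s_le x x_min x_min2.
Let rright := @range_right R p s d p_pr p11 s_le x x_min x_min2.
Let rleft := @range_leftward R p s d p_pr p11 s_le x x_min x_min2.
Let rends := @range_left R p s d p_pr p11 s_le x x_min x_min2.

Lemma range_unique k a a' b b' : range k a a' -> range k b b' -> a = b /\ a' = b'.
Proof.
suff main a1 a1' b1 b1' : range k a1 a1' -> range k b1 b1' -> (b1 <= a1)%N.
  move=> ra rb; have := main _ _ _ _ ra rb; have := main _ _ _ _ rb ra.
  have := range_sum ra; have := range_sum rb; lia.
move=> ra rb; rewrite leqNgt; apply/negP => ab.
have Ea := range_sum ra; have Eb := range_sum rb.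
have la := range_lt ra; have lb := range_lt rb.
have [_ _ _ ha] := ra; have [_ _ _ hb] := rb.
have h1 : (b1.+1 + b1' + d = k.+1)%N by lia.
have h2 : (a1.+1 + a1' + d = k.+1)%N by lia.
have ba : (b1' <= b1.+1)%N by lia.
have aa : (a1' <= a1.+1)%N by lia.
have [_ /(_ ab)] := ha _ _ h1 (range_ur_bound_ge rb ba) (range_ur_bound rb).
have [/(_ (ltnW ab)) + _] := hb _ _ h2 (range_ur_bound_ge ra aa) (range_ur_bound ra); lra.
Qed.

(* Of two ranges that overlap or touch, one is tiny compared with the other. *)
Lemma range_far k a a' k2 b b' : range k a a' -> range k2 b b' -> k != k2 ->
  x k2 <= x k -> (a' <= b.+1)%N -> (b' <= a.+1)%N -> (41 * (b - b') <= a - a')%N.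
Proof.
move=> ra rb kk xx h1 h2.
have Ea := range_sum ra; have Eb := range_sum rb.
have la := range_lt ra; have lb := range_lt rb.
(* Closer centres would give [X k k2 < x k2] by [near_far], against [x_min2]. Overlap or contact
   bounds the distance of [k] and [k2] by [(a - a') + (b - b') + 2], and [44 - 1 - 2 = 41]. *)
have : (44 * (b - b') <= k - k2 + (k2 - k))%N.
  rewrite leqNgt; apply/negP => /(near_far p_pr p11 s_le rb) h.
  have := x_min2 kk; rewrite (min_r xx) leNgt h; by [].
lia.
Qed.

(** If the smaller range stuck out, its ends would lie on or above the line of the larger one, one
    of them strictly. At the end of the larger range that it covers, its chord would then pass above
    the graph, against [range_line]. *)
Lemma range_nested_le k a a' k2 b b' : range k a a' -> range k2 b b' ->
  x k2 <= x k -> (a' <= b)%N -> (b' <= a)%N -> (a' <= b')%N /\ (b <= a)%N.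
Proof.
move=> ra rb xx h1 h2.
case: (eqVneq k k2) => [kk|kk].
  by move: rb; rewrite -kk => rb; have [-> ->] := range_unique ra rb.
have la := range_lt ra; have lb := range_lt rb.
have far := range_far ra rb kk xx ltac:(lia) ltac:(lia).
have eb := rends rb; have ea := rends ra.
case: (leqP b a) => ba; last first.
  have g1 := rright ra (_ : 0 < b - a <= 20 * (a - a'))%N.
  have g2 := rline ra (_ : a' <= b' <= a.+1)%N.
  have g3 := rline rb (_ : b' <= a.+1 <= b.+1)%N.
  have {}g1 := g1 ltac:(lia); have {}g2 := g2 ltac:(lia); have {}g3 := g3 ltac:(lia).
  rewrite addSn subnKC 1?ltnW // natrB 1?ltnW // in g1.
  have d1 : 0 < (b.+1%:R - a.+1%:R : R) by rewrite subr_gt0 ltr_nat.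
  have d2 : 0 < (a.+1%:R - b'%:R : R) by rewrite subr_gt0 ltr_nat; lia.
  rewrite -(natr1 b) -(natr1 a) in d1 d2 g2 g3 eb *.
  set A := a%:R in g1 g2 g3 d1 d2 *; set B := b%:R in g1 g2 g3 eb d1 d2 *.
  set C := b'%:R in g1 g2 g3 eb d1 d2 *.
  exfalso; have : (mu k a - mu k2 b) * (B - A) < 0 by lra.
  rewrite pmulr_llt0; last by lra.
  move=> m1; have : 0 <= (mu k a - mu k2 b) * (A + 1 - C) by lra.
  by rewrite pmulr_lge0 //; lra.
case: (leqP a' b') => ab; first by [].
have g1 := rleft ra (_ : 0 < a' - b' <= 20 * (a - a'))%N (leq_subr _ _).
have g2 := rline ra (_ : a' <= b.+1 <= a.+1)%N.
have g3 := rline rb (_ : b' <= a' <= b.+1)%N.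
have {}g1 := g1 ltac:(lia); have {}g2 := g2 ltac:(lia); have {}g3 := g3 ltac:(lia).
rewrite subKn 1?ltnW // natrB 1?ltnW // in g1.
have d1 : 0 < (a'%:R - b'%:R : R) by rewrite subr_gt0 ltr_nat.
have d2 : 0 < (b.+1%:R - a'%:R : R) by rewrite subr_gt0 ltr_nat; lia.
exfalso; have : 0 < (mu k a - mu k2 b) * (a'%:R - b'%:R) by lra.
rewrite pmulr_lgt0 // => m1.
have : (mu k a - mu k2 b) * (b.+1%:R - a'%:R) <= 0 by lra.
rewrite pmulr_lle0 //; lra.
Qed.

Lemma range_nested k a a' k2 b b' : range k a a' -> range k2 b b' ->
  (a' <= b)%N -> (b' <= a)%N ->
  (a' <= b')%N && (b <= a)%N || (b' <= a')%N && (a <= b)%N.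
Proof.
move=> ra rb h1 h2; case/orP: (le_total (x k2) (x k)) => xx.
  by have [-> ->] := range_nested_le ra rb xx h1 h2.
by have [-> ->] := range_nested_le rb ra xx h2 h1; rewrite orbT.
Qed.

(** The far end of the smaller range is within reach of [range_right] or [range_leftward] for the
    larger one, so it lies strictly above the line of the latter. *)
Lemma range_adjacent k a a' k2 b : range k a a' -> range k2 b a.+1 -> mu k a < mu k2 b.
Proof.
move=> ra rb; have la := range_lt ra; have lb := range_lt rb.
have kk : k != k2 by have := range_sum ra; have := range_sum rb; lia.
have eb := rends rb; have ea := rends ra.
case/orP: (le_total (x k2) (x k)) => xx.
  have far := range_far ra rb kk xx ltac:(lia) ltac:(lia).
  have := rright ra (_ : 0 < b - a <= 20 * (a - a'))%N => /(_ ltac:(lia)).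
  rewrite addSn subnKC 1?ltnW 1?ltnW // natrB 1?ltnW 1?ltnW // => g1.
  have d1 : 0 < (b%:R - a%:R : R) by rewrite subr_gt0 ltr_nat; lia.
  rewrite -(ltr_pM2r d1); rewrite -(natr1 b) -(natr1 a) in eb; lra.
have far := range_far rb ra (_ : k2 != k) xx ltac:(lia) ltac:(lia).
have {}far := far ltac:(by rewrite eq_sym).
have := rleft rb (_ : 0 < a.+1 - a' <= 20 * (b - a.+1))%N (leq_subr _ _) => /(_ ltac:(lia)).
have aa : (a' <= a.+1)%N by lia.
rewrite subKn // natrB // => g1.
have d1 : 0 < (a.+1%:R - a'%:R : R) by rewrite subr_gt0 ltr_nat; lia.
rewrite -(ltr_pM2r d1); lra.
Qed.

Definition outside_ranges m := forall k a a', range k a a' -> ~~ (a' < m <= a)%N.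

(** An end interior to another range yields, by nesting, a longer range around [m]. Lengths are
    bounded, since the weight [k] of a range over [m] satisfies [k < T m]. *)
Lemma maximal_range m k a a' : range k a a' -> (a' < m <= a)%N ->
  exists k a a', [/\ range k a a', (a' < m <= a)%N, outside_ranges a' & outside_ranges a.+1].
Proof.
have bound k0 b b' : range k0 b b' -> (b' < m <= b)%N -> (b - b' <= T m)%N.
  move=> rb hm; have : (k0 < T m)%N by apply: (range_ur_bound_ge rb); lia.
  have := range_sum rb; lia.
have [j] := ubnP (T m - (a - a')); elim: j k a a' => // j IHj k a a' hj ra hm.
case: (pselect (outside_ranges a' /\ outside_ranges a.+1)) => [[h1 h2] | nout]; first by exists k, a, a'.
have : exists k2 b b', range k2 b b' /\ ((b' < a' <= b) || (b' < a.+1 <= b))%N.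
  apply: contrapT => nex; apply: nout; split=> k2 b b' rb; apply/negP => hb;
    by apply: nex; exists k2, b, b'; split; rewrite // hb ?orbT.
case=> k2 [b [b' [rb hb]]].
have la := range_lt ra; have lb := range_lt rb.
have h1 : (a' <= b)%N by lia. have h2 : (b' <= a)%N by lia.
have hn := range_nested ra rb h1 h2.
have hm2 : (b' < m <= b)%N by lia.
have b2 := bound _ _ _ rb hm2.
by apply: (IHj k2 b b') => //; lia.
Qed.

(** Candidate one-sided slopes of the Newton polygon at abscissae outside all ranges: an edge is
    either a single increment or the chord of a maximal range. *)
Definition right_slope n r :=
  (outside_ranges n.+1 /\ r = E x n) \/ (exists k a, [/\ range k a n, outside_ranges a.+1 & r = mu k a]).

Definition left_slope n l :=
  (outside_ranges n /\ l = E x n) \/ (exists k a', [/\ range k n a', outside_ranges a' & l = mu k n]).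

Lemma right_slope_ex n : outside_ranges n -> exists r, right_slope n r.
Proof.
move=> on; case: (pselect (outside_ranges n.+1)) => o1; first by exists (E x n); left.
have : exists k a a', range k a a' /\ (a' < n.+1 <= a)%N.
  apply: contrapT => nex; apply: o1 => k a a' ra; apply/negP => ha.
  by apply: nex; exists k, a, a'.
case=> k [a [a' [ra ha]]].
have [{ha ra}k [{}a [{}a' [ra ha _ oa]]]] := maximal_range ra ha.
have En : a' = n by have := on _ _ _ ra; lia.
by exists (mu k a); right; exists k, a; rewrite -En.
Qed.

Lemma left_slope_ex n : outside_ranges n.+1 -> exists l, left_slope n l.
Proof.
move=> on; case: (pselect (outside_ranges n)) => o1; first by exists (E x n); left.
have : exists k a a', range k a a' /\ (a' < n <= a)%N.
  apply: contrapT => nex; apply: o1 => k a a' ra; apply/negP => ha.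
  by apply: nex; exists k, a, a'.
case=> k [a [a' [ra ha]]].
have [{ha ra}k [{}a [{}a' [ra ha oa _]]]] := maximal_range ra ha.
have En : a = n by have := on _ _ _ ra; lia.
by exists (mu k n); right; exists k, a'; rewrite -En.
Qed.

Lemma left_lt_right n l r : outside_ranges n.+1 -> left_slope n l -> right_slope n.+1 r -> l < r.
Proof.
move=> on [[_ ->]|[k [a' [ra _ ->]]]] [[_ ->]|[k2 [b [rb _ ->]]]].
- rewrite -subr_gt0; apply: (kink_gt0 p_pr p11 s_le x_gt0 x_min x_min2 d_le (n := n)).
  by move=> k a a' ra; have := on _ _ _ ra; lia.
- have lb := range_lt rb.
  have := rleft rb (_ : 0 < 1 <= 20 * (b - n.+1))%N (isT : (0 < n.+1)%N).
  by rewrite subn1 heightS /= mulr1 => /(_ ltac:(lia)); lra.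
- have la := range_lt ra.
  have := rright ra (_ : 0 < 1 <= 20 * (n - a'))%N => /(_ ltac:(lia)).
  by rewrite addn1 [F x n.+2]heightS mulr1; lra.
- exact: range_adjacent ra rb.
Qed.

Lemma right_support n r m : outside_ranges n -> right_slope n r -> (n <= m)%N ->
  F x n + r * (m%:R - n%:R) <= F x m.
Proof.
have [j] := ubnP (m - n); elim: j n r => // j IHj n r hj on hr nm.
case: (eqVneq n m) => [->|nm']; first by rewrite subrr mulr0 addr0.
have step n1 : (n < n1)%N -> outside_ranges n1 -> left_slope n1.-1 r ->
    F x n1 = F x n + r * (n1%:R - n%:R) -> (n1 <= m)%N ->
    F x n + r * (m%:R - n%:R) <= F x m.
  move=> nn1 on1 ls En1 n1m; have [r1 hr1] := right_slope_ex on1.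
  have := IHj n1 r1 ltac:(lia) on1 hr1 n1m; rewrite En1.
  move: on1 ls hr1; rewrite -(prednK (leq_ltn_trans (leq0n n) nn1)) => on1 ls hr1.
  have lr := left_lt_right on1 ls hr1; rewrite (prednK (leq_ltn_trans (leq0n n) nn1)).
  have : 0 <= (r1 - r) * (m%:R - n1%:R).
    by apply: mulr_ge0; rewrite subr_ge0 ?ler_nat // ltW.
  lra.
case: (hr) => [[u1 Er]|[k [a [ra oa Er]]]].
  apply: (step n.+1) => //; first by left.
  - by rewrite heightS -natr1 Er; ring.
  - by lia.
have la := range_lt ra; have := rends ra; rewrite -Er => ea.
case: (leqP m a.+1) => ma.
  have := rline ra (_ : n <= m <= a.+1)%N; rewrite nm ma -Er => /(_ isT); lra.
apply: (step a.+1) => //; try by lia.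
- by right; exists k, n; split => //=.
- by lra.
Qed.

Lemma left_support n l m : outside_ranges n.+1 -> left_slope n l -> (m <= n.+1)%N ->
  F x n.+1 - l * (n.+1%:R - m%:R) <= F x m.
Proof.
have [j] := ubnP (n.+1 - m); elim: j n l => // j IHj n l hj on hl mn.
case: (eqVneq n.+1 m) => [->|nm']; first by rewrite subrr mulr0 subr0.
have step n1 : (n1 < n.+1)%N -> outside_ranges n1 -> right_slope n1 l ->
    F x n.+1 = F x n1 + l * (n.+1%:R - n1%:R) -> (m <= n1)%N ->
    F x n.+1 - l * (n.+1%:R - m%:R) <= F x m.
  move=> nn1 on1 rs En1 mn1; rewrite {}En1.
  case: (eqVneq n1 m) => [->|]; first by lra.
  case: n1 nn1 on1 rs mn1 => [|n1] nn1 on1 rs mn1 n1m; first by lia.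
  have [l1 hl1] := left_slope_ex on1.
  have := IHj n1 l1 ltac:(lia) on1 hl1 mn1.
  have lr := left_lt_right on1 hl1 rs.
  have : 0 <= (l - l1) * (n1.+1%:R - m%:R).
    by apply: mulr_ge0; rewrite subr_ge0 ?ler_nat // ltW.
  lra.
case: (hl) => [[u1 El]|[k [a' [ra oa El]]]].
  apply: (step n) => //; first by left.
  - by rewrite heightS -natr1 El; ring.
  - by lia.
have la := range_lt ra; have := rends ra; rewrite -El => ea.
case: (leqP a' m) => ma.
  have := rline ra (_ : a' <= m <= n.+1)%N; rewrite mn ma -El => /(_ isT); lra.
apply: (step a') => //; try by lia.
- by right; exists k, n.
- by lra.
Qed.

(** Take the mean of the one-sided slopes and half of their gap; at 0, where there is no left slope,
    any slope below the right one works. The gain linear in [|m - n|] survives the passage to the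
    hull of infinitely many points. *)
Lemma outside_support n : outside_ranges n -> exists c eps : R, 0 < eps /\
  forall m, F x n + c * (m%:R - n%:R) + eps * `|m%:R - n%:R| <= F x m.
Proof.
move=> on; have [r hr] := right_slope_ex on.
case: n on hr => [|n] on hr.
  exists (r - 1), 1; split => // m.
  have := right_support on hr (leq0n m); rewrite subr0 ger0_norm ?ler0n //; lra.
have [l hl] := left_slope_ex on; have lr := left_lt_right on hl hr.
exists ((l + r) / 2), ((r - l) / 2); split; first by lra.
move=> m; case: (leqP n.+1 m) => nm.
  have := right_support on hr nm; have : 0 <= m%:R - n.+1%:R :> R by rewrite subr_ge0 ler_nat.
  move=> h; rewrite ger0_norm //; lra.
have := left_support on hl (ltnW nm); have : m%:R - n.+1%:R <= 0 :> R.
  by rewrite subr_le0 ler_nat ltnW.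
move=> h; rewrite ler0_norm //; lra.
Qed.

Lemma maximal_support k a a' m : range k a a' -> outside_ranges a' -> outside_ranges a.+1 ->
  F x a.+1 - mu k a * (a.+1%:R - m%:R) <= F x m.
Proof.
move=> ra o1 o2; have la := range_lt ra; have ea := rends ra.
case: (leqP a.+1 m) => am.
  have [r hr] := right_slope_ex o2.
  have hl : left_slope a (mu k a) by right; exists k, a'.
  have lr := left_lt_right o2 hl hr; have := right_support o2 hr am.
  have : 0 <= (r - mu k a) * (m%:R - a.+1%:R).
    by apply: mulr_ge0; rewrite subr_ge0 ?ler_nat // ltW.
  lra.
have hl : left_slope a (mu k a) by right; exists k, a'.
exact: (left_support o2 hl (ltnW am)).
Qed.

End Global.

(** * The p-adic exponential *)

Section Valuation.
Variables (R : realType) (C : fieldType) (v : C -> \bar R).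
Hypothesis v_val : is_valuation v.

Lemma val_eq0 x : v x = +oo%E <-> x = 0. Proof. by case: v_val. Qed.
Lemma valM x y : v (x * y) = (v x + v y)%E. Proof. by case: v_val. Qed.
Lemma v_add_ge x y : (Order.min (v x) (v y) <= v (x + y)%R)%E. Proof. by case: v_val. Qed.

Lemma v_fin x : x != 0 -> v x \is a fin_num.
Proof.
move=> x0; have [h1 h2 _ _] := v_val; rewrite fin_numE; apply/andP; split.
  by apply/eqP/h2.
by apply/eqP => /h1 /eqP; rewrite (negbTE x0).
Qed.

Lemma val1 : v 1 = 0%E.
Proof.
have := valM 1 1; rewrite mulr1; have := v_fin (oner_neq0 C).
case: (v 1) => // r _ [] /eqP; rewrite eq_sym -subr_eq0 addrK => /eqP ->; by [].
Qed.

Lemma valN1 : v (-1) = 0%E.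
Proof.
have := valM (-1) (-1); rewrite mulrNN mulr1 val1.
have : v (-1) \is a fin_num by apply: v_fin; rewrite oppr_eq0 oner_neq0.
case: (v (-1)) => // r _ [] /eqP; rewrite eq_sym -mulr2n mulrn_eq0 /= => /eqP ->; by [].
Qed.

Lemma valN x : v (- x) = v x.
Proof. by rewrite -mulN1r valM valN1 add0e. Qed.

Lemma valB x y : v (x - y) = v (y - x).
Proof. by rewrite -opprB valN. Qed.

Lemma valV x (a : R) : v x = a%:E -> v x^-1 = (- a)%:E.
Proof.
move=> vx; have x0 : x != 0.
  by apply/negP => /eqP /val_eq0; rewrite vx.
have := valM x x^-1; rewrite divff // val1 vx.
have := v_fin (invr_neq0 x0); case: (v x^-1) => // b _ [] h; congr _%:E; lra.
Qed.

Definition vge (a : R) x := (a%:E <= v x)%E.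

Lemma vgeD a x y : vge a x -> vge a y -> vge a (x + y).
Proof. by move=> hx hy; apply: le_trans (v_add_ge x y); rewrite le_min; apply/andP. Qed.

Lemma vgeM a b x y : vge a x -> vge b y -> vge (a + b) (x * y).
Proof. by move=> hx hy; rewrite /vge valM EFinD; apply: leeD. Qed.

Lemma vge_le a b x : a <= b -> vge b x -> vge a x.
Proof. by move=> ab; apply: le_trans; rewrite lee_fin. Qed.

Lemma vge0 a : vge a 0.
Proof. by rewrite /vge; have /val_eq0 -> := erefl (0 : C); rewrite leey. Qed.

Lemma vge_sum a (I : Type) (r : seq I) (P : pred I) (f : I -> C) :
  (forall i, P i -> vge a (f i)) -> vge a (\sum_(i <- r | P i) f i).
Proof.
by move=> h; elim/big_ind: _ => //; [exact: vge0|move=> x y; exact: vgeD].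
Qed.

Lemma vge_nat n : vge 0 n%:R.
Proof.
elim: n => [|n IHn]; first exact: vge0.
by rewrite -natr1; apply: vgeD => //; rewrite /vge val1.
Qed.

Lemma valX x n a : v x = a%:E -> v (x ^+ n) = (n%:R * a)%:E.
Proof.
move=> vx; elim: n => [|n IHn]; first by rewrite expr0 val1 mul0r.
by rewrite exprS valM vx IHn -EFinD; congr _%:E; rewrite -natr1; ring.
Qed.

Lemma v_lt_add x y : (v x < v y)%E -> v (x + y) = v x.
Proof.
move=> lt; apply/eqP; rewrite eq_le; apply/andP; split; last first.
  by have := v_add_ge x y; rewrite (min_l (ltW lt)).
have := v_add_ge (x + y) (- y); rewrite valN addrK ge_min => /orP[//|h].
by move: (lt_le_trans lt h); rewrite ltxx.
Qed.

Lemma fact1 : 1`! = 1%N. Proof. by []. Qed.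

Variable p : nat.
Hypotheses (p_pr : prime p) (vp : v p%:R = 1%E).

Lemma v_nat n : (0 < n)%N -> v n%:R = (logn p n)%:R%:E.
Proof.
move=> n0; have p0 := prime_gt0 p_pr.
have coprime_case m : coprime p m -> (0 < m)%N -> v m%:R = 0%E.
  (* Bezout: [a m = b p + 1] has valuation 0, and both factors have nonnegative valuation. *)
  move=> cp m0; have [a b Eab _] := egcdnP p m0.
  have {}Eab : (a * m = b * p + 1)%N by rewrite Eab gcdnC; move: cp => /eqP ->.
  apply/eqP; rewrite eq_le; apply/andP; split; last exact: vge_nat.
  have h1 : (0 < v (b * p)%:R)%E.
    apply: (@lt_le_trans _ _ 1%E); first by rewrite lte_fin ltr01.
    rewrite natrM valM vp -[X in (X <= _)%E]add0e; apply: leeD => //; exact: vge_nat.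
  have h2 : v (a * m)%:R = 0%E.
    by rewrite Eab natrD addrC v_lt_add val1.
  by rewrite -h2 natrM valM -[X in (X <= _)%E]add0e; apply: leeD => //; exact: vge_nat.
have [m cpm Em] := pfactor_coprime p_pr n0.
rewrite {1}Em natrM valM natrX (@valX p%:R _ 1) // coprime_case ?add0e ?mulr1 //.
by case: m Em {cpm} => // Em; move: n0; rewrite Em mul0n.
Qed.


Definition exp_sum (m n : nat) : C := \sum_(i < n) (p%:R * m%:R) ^+ i / i`!%:R.

Lemma logn_fact_small i : (11 <= p)%N -> (logn p i`! <= 2 * (i %/ p))%N.
Proof. by move=> p11; rewrite -log_fact_sum_div // /log_fact_sum; have := logn_fact_le p_pr (i %/ p); lia. Qed.

Lemma exp_term_ge m i : (11 <= p)%N -> vge (i%:R / 2) ((p%:R * m%:R) ^+ i / i`!%:R).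
Proof.
move=> p11; rewrite exprMn -[m%:R ^+ i]natrX.
have h1 : vge (i%:R) (p%:R ^+ i) by rewrite /vge (@valX _ _ 1) // mulr1.
have h2 : vge (- (logn p i`!)%:R) (i`!%:R^-1).
  by rewrite /vge (valV (v_nat (fact_gt0 i))).
rewrite [_ * (m ^ i)%:R]mulrC -mulrA.
have := vgeM (vge_nat (m ^ i)) (vgeM h1 h2); apply: vge_le.
have : (2 * logn p i`! <= i)%N.
  have := logn_fact_small i p11; have := leq_trunc_div i p.
  have := leq_mul (leqnn (i %/ p)) p11; lia.
rewrite -(ler_nat R) natrM; lra.
Qed.

Hypothesis p11 : (11 <= p)%N.

Lemma vlimit_ge u l (M : R) : vlimit v u l ->
  exists N, forall n, (N <= n)%N -> vge M (u n - l).
Proof.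
move=> /cvgeyPge /(_ M) [N _ hN]; exists N => n nN; exact: hN.
Qed.

Lemma exp_sum_cauchy m : vcauchy v (exp_sum m).
Proof.
move=> M; have [N _ hN] := nbhs_infty_ger (2 * M).
exists N.
have tail a b : (N <= a)%N -> (a <= b)%N -> vge M (exp_sum m b - exp_sum m a).
  move=> Na ab; rewrite /exp_sum -!(big_mkord xpredT (fun i => (p%:R * m%:R) ^+ i / i`!%:R)).
  rewrite (big_cat_nat (leq0n a) ab) /= addrAC subrr add0r big_seq.
  apply: vge_sum => i; rewrite mem_index_iota => /andP[ai _].
  have := hN i (leq_trans Na ai) => /= hi.
  by apply: vge_le (exp_term_ge m i p11); lra.
move=> a b Na Nb; case/orP: (leq_total a b) => ab.
  by rewrite valB; apply: tail.
exact: tail.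
Qed.

(** The linear term dominates: for [k >= 2] the difference of [k]-th powers keeps the factor
    [m1 - m2], and [p^k / k!] has valuation at least 2. *)
Lemma exp_sum_sub m1 m2 n : (m2 < m1)%N -> (2 <= n)%N ->
  v (exp_sum m1 n - exp_sum m2 n) = (1 + logn p (m1 - m2))%:R%:E.
Proof.
move=> mm n2; rewrite /exp_sum -sumrB.
case: n n2 => [|[|n]] // _; rewrite !big_ord_recl /= subrr add0r.
rewrite /bump /= addn0 !expr1 fact1 !divr1 -mulrBr -natrB 1?ltnW //.
have v1t : v (p%:R * (m1 - m2)%:R) = (1 + logn p (m1 - m2))%:R%:E.
  by rewrite valM vp v_nat ?subn_gt0 // natrD EFinD.
rewrite v_lt_add // v1t.
have : vge (2 + (logn p (m1 - m2))%:R) (\sum_(i < n)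
   ((p%:R * m1%:R) ^+ (1 + (1 + i)) / (1 + (1 + i))`!%:R -
    (p%:R * m2%:R) ^+ (1 + (1 + i)) / (1 + (1 + i))`!%:R)).
  apply: vge_sum => i _; move: (val i) => {}i.
  set k := (1 + (1 + i))%N; rewrite -mulrBl !exprMn -mulrBr subrXX -natrB 1?ltnW //.
  have -> : \sum_(i0 < k) (m1%:R : C) ^+ (k.-1 - i0) * m2%:R ^+ i0 =
      (\sum_(i0 < k) m1 ^ (k.-1 - i0) * m2 ^ i0)%:R.
    by rewrite natr_sum; apply: eq_bigr => i0 _; rewrite natrM !natrX.
  have h1 : vge k%:R (p%:R ^+ k) by rewrite /vge (@valX _ _ 1) // mulr1.
  have h2 : vge (- (logn p k`!)%:R) (k`!%:R^-1).
    by rewrite /vge (valV (v_nat (fact_gt0 k))).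
  have h3 : vge (logn p (m1 - m2))%:R (m1 - m2)%:R by rewrite /vge v_nat ?subn_gt0.
  set Q := (\sum_(i0 < k) _)%N.
  have := vgeM (vgeM h1 (vgeM h3 (vge_nat Q))) h2; apply: vge_le.
  have : (logn p k`! + 2 <= k)%N.
    have := logn_fact_small k p11; have := leq_trunc_div k p.
    have := leq_mul (leqnn (k %/ p)) p11.
    have : (k < p)%N -> (k %/ p = 0)%N by move=> ?; apply: divn_small.
    by rewrite /k; move: (_ %/ _)%N (logn _ _) => u z; lia.
  by rewrite -(ler_nat R) natrD; lra.
apply: lt_le_trans; rewrite lte_fin natrD; lra.
Qed.

Hypothesis v_complete : forall u, vcauchy v u -> exists l, vlimit v u l.

Lemma padic_expP m : vlimit v (exp_sum m) (padic_exp v (p%:R * m%:R)).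
Proof.
have /v_complete ex := exp_sum_cauchy m.
exact: (xgetPex 0 ex).
Qed.

Lemma padic_exp_sub m1 m2 : (m2 < m1)%N ->
  v (padic_exp v (p%:R * m1%:R) - padic_exp v (p%:R * m2%:R)) = (1 + logn p (m1 - m2))%:R%:E.
Proof.
move=> mm; set L := (1 + logn p (m1 - m2))%:R : R.
have [N1 h1] := vlimit_ge (L + 1) (padic_expP m1).
have [N2 h2] := vlimit_ge (L + 1) (padic_expP m2).
set l1 := padic_exp _ _ in h1 *; set l2 := padic_exp _ _ in h2 *.
pose n := (N1 + N2 + 2)%N.
have {}h1 := h1 n ltac:(by rewrite /n; lia).
have {}h2 := h2 n ltac:(by rewrite /n; lia).
have h := exp_sum_sub mm (_ : 2 <= n)%N.
have {}h := h ltac:(by rewrite /n; lia).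
have -> : l1 - l2 = (exp_sum m1 n - exp_sum m2 n) +
    ((l1 - exp_sum m1 n) + (exp_sum m2 n - l2)) by ring.
have g : vge (L + 1) ((l1 - exp_sum m1 n) + (exp_sum m2 n - l2)).
  by apply: vgeD => //; rewrite /vge valB.
by rewrite v_lt_add h //; apply: lt_le_trans g; rewrite lte_fin -/L; lra.
Qed.

Lemma padic_exp_sub1 m : vge 1 (padic_exp v (p%:R * m%:R) - 1).
Proof.
have [N hN] := vlimit_ge 1 (padic_expP m).
have {}hN := hN N.+1 (leqnSn N); set l := padic_exp _ _ in hN *.
have -> : l - 1 = (l - exp_sum m N.+1) + (exp_sum m N.+1 - 1) by ring.
apply: vgeD; first by rewrite /vge valB.
rewrite /exp_sum big_ord_recl expr0 fact0 divr1 addrAC subrr add0r.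
apply: vge_sum => i _; rewrite /= /bump /= add1n.
case: (nat_of_ord i) => [|k].
  rewrite expr1 fact1 divr1 -[1]addr0.
  by apply: vgeM (vge_nat m); rewrite /vge vp.
apply: vge_le (exp_term_ge m k.+2 p11).
by rewrite -(natr1 k.+1) -(natr1 k); have := ler0n R k; lra.
Qed.

End Valuation.

(** * Valuations of ghost coefficients *)

Section Ghost.
Variables (p s : nat).
Hypotheses (p_pr : prime p) (p11 : (11 <= p)%N) (s_le : (s <= p - 2)%N).

Local Notation d := (delta_eps p s).
Local Notation T := (ur_bound p s d).
Local Notation K := (Iw_bound p s d).

Lemma delta_le1 : (d <= 1)%N.
Proof. by rewrite /delta_eps -ltnS ltn_divLR; lia. Qed.

Lemma half_weightE (R : realType) k : (weight p s k - 2)%:R / 2 = half_weight R p s d k :> R.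
Proof.
rewrite /weight /k_eps -addnA addKn /half_weight.
have := divn_eq (2 * s) (p - 1); rewrite -/d; move: (_ %% _)%N => r.
move/(congr1 (fun n : nat => n%:R : R)); rewrite natrD natrM natrM (natrB _ (prime_gt0 p_pr)) => h.
by rewrite natrD natrM (natrB _ (prime_gt0 p_pr)); lra.
Qed.

Lemma d_ur_le n k : (d_ur p s k <= n%:Z) = (k < T n)%N.
Proof.
rewrite /d_ur -ltzD1 ltrD2r ltz_divLR //.
by rewrite /t_eps /ur_bound; lia.
Qed.

Lemma d_ur_ge0 k : 0 <= d_ur p s k.
Proof.
rewrite /d_ur -lerBlDr lez_divRL; last by lia.
by rewrite /t_eps; have := delta_le1; lia.
Qed.

Lemma d_Iw_sub k n n' : (n + n' + d = k.+1)%N -> d_Iw p s k = n%:Z + n'%:Z.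
Proof. by rewrite /d_Iw; lia. Qed.

Lemma d_Iw_lt n k : (n%:Z < d_Iw p s k - d_ur p s k) = (K n <= k)%N.
Proof.
case: (leqP (n + d) k) => h.
  have Ek : (n + (k - d - n) + d = k)%N by lia.
  rewrite (Iw_bound_mirror p_pr p11 s_le _ Ek) ltn_add2r -d_ur_le /d_Iw; lia.
have -> : (K n <= k)%N = false by rewrite /Iw_bound; move: (_ %/ _)%N => u; lia.
by have := d_ur_ge0 k; rewrite /d_Iw; lia.
Qed.

Lemma d_ur_half k : 2 * d_ur p s k <= d_Iw p s k.
Proof.
have d1 := delta_le1; have [D ED] : exists D, k.+1 = (D + d)%N by exists (k.+1 - d)%N; lia.
have : d_ur p s k <= (D./2)%:Z.
  rewrite d_ur_le /ur_bound; have := odd_double_half D; rewrite -addnn.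
  have := leq_mul (leqnn D./2) p11; lia.
by have := odd_double_half D; rewrite -addnn /d_Iw; lia.
Qed.

Lemma ghost_mult0 k : ghost_mult p s 0 k = 0%N.
Proof. by rewrite /ghost_mult; have := d_ur_ge0 k; case: ifP => //; lia. Qed.

Lemma ghost_mult_gt0 n k :
  (0 < ghost_mult p s n k)%N = (d_ur p s k < n%:Z < d_Iw p s k - d_ur p s k).
Proof. by rewrite /ghost_mult; case: ifP => // /andP[h1 h2]; rewrite minEle; case: ifP; lia. Qed.

Lemma ghost_mult_ge n k : (T n <= k)%N -> ghost_mult p s n k = 0%N.
Proof.
move=> h; apply/eqP; rewrite -leqn0 leqNgt ghost_mult_gt0; apply/negP => /andP[h1 _].
by have := ltW h1; rewrite d_ur_le ltnNge h.
Qed.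

(** The tent [m_n(k)] has slope 1 from [d_ur] on, 0 on the middle step of an odd [d_Iw], then -1 up
    to [d_Iw - d_ur]; the four indicators switch at these places. The additive form avoids truncated
    subtraction. *)
Lemma ghost_multS n k :
  (ghost_mult p s n.+1 k + (k < (2 * n + d).+1) + (k < 2 * n + d) =
   ghost_mult p s n k + (k < T n) + (k < K n))%N.
Proof.
rewrite (ltnNge k (K n)) -d_Iw_lt -d_ur_le.
have h0 := d_ur_ge0 k; have h1 := d_ur_half k.
have -> : (k < (2 * n + d).+1)%N = (d_Iw p s k <= 2 * n%:Z + 1) by rewrite /d_Iw; lia.
have -> : (k < 2 * n + d)%N = (d_Iw p s k <= 2 * n%:Z) by rewrite /d_Iw; lia.
rewrite /ghost_mult; move: (d_Iw p s k) (d_ur p s k) h0 h1 => D u h0 h1.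
rewrite !minEle; repeat (case: ifP => ?); lia.
Qed.

Section Sums.
Variable R : realType.
Local Notation F := (@height R p s d).

Lemma psum_ord (x : nat -> R) m b : (m <= b)%N -> psum x m = \sum_(k < b) (k < m)%N%:R * x k.
Proof.
move=> mb; rewrite /psum (big_ord_widen b x mb) big_mkcond /=.
by apply: eq_bigr => k _; case: (k < m)%N; rewrite ?mul1r ?mul0r.
Qed.

Lemma ghost_mult_F (x : nat -> R) n b : (T n <= b)%N ->
  F x n = \sum_(k < b) (ghost_mult p s n k)%:R * x k.
Proof.
elim: n => [_|n IHn nb].
  by rewrite height0 big1 // => k _; rewrite ghost_mult0 mul0r.
have le_T := leq_ur_bound p s d (leqnSn n).
have KT : (K n <= T n)%N.
  rewrite /Iw_bound /ur_bound; have : ((n + (p - 1 - s)) %/ p <= n + 1)%N.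
    by rewrite -ltnS ltn_divLR; have := leq_pmulr n (prime_gt0 p_pr); lia.
  by move: (_ %/ _)%N => u; nia.
have h2 : ((2 * n + d).+1 <= T n.+1)%N by rewrite /ur_bound; nia.
rewrite heightS IHn; last exact: leq_trans le_T nb.
rewrite /slope !(@psum_ord x _ b); try by lia.
rewrite -!sumrN -!big_split /=; apply: eq_bigr => k _.
have /(congr1 (fun n : nat => n%:R : R)) := ghost_multS n k.
rewrite !natrD => h.
have -> : (ghost_mult p s n.+1 k)%:R = (ghost_mult p s n k)%:R + (k < T n)%N%:R + (k < K n)%N%:R
   - (k < (2 * n + d).+1)%N%:R - (k < 2 * n + d)%N%:R :> R by lra.
by ring.
Qed.
End Sums.

Section Poly.
Variables (R : realType) (C : closedFieldType) (v : C -> \bar R).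
Hypothesis hC : is_Cp p v.
Local Notation F := (@height R p s d).

Let v_val : is_valuation v. Proof. by case: hC. Qed.
Let vp : v p%:R = 1%E. Proof. by case: hC. Qed.
Let v_compl : forall u, vcauchy v u -> exists l, vlimit v u l. Proof. by case: hC. Qed.

(** The two weights differ by [(p - 1)(i - j)], and [p - 1] is prime to [p]. *)
Lemma w_wt_sub i j : i != j -> v (w_wt p s v i - w_wt p s v j) = (wdist p i j)%:R%:E.
Proof.
suff main i1 j1 : (j1 < i1)%N -> v (w_wt p s v i1 - w_wt p s v j1) = (wdist p i1 j1)%:R%:E.
  by move=> /eqP ij; case: (ltngtP j i) => h; [exact: main|rewrite (valB v_val) wdistC; exact: main|lia].
move=> ij; rewrite /w_wt opprB addrA subrK.
have mm : (weight p s j1 - 2 < weight p s i1 - 2)%N.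
  rewrite /weight /k_eps -!addnA !addKn ltn_add2l ltn_mul2l ij andbT; lia.
rewrite (padic_exp_sub v_val p_pr vp p11 v_compl mm) /wdist; congr (_%:R%:E); congr (1 + _)%N.
have -> : (weight p s i1 - 2 - (weight p s j1 - 2) = (p - 1) * (i1 - j1))%N.
  by rewrite /weight /k_eps -!addnA !addKn subnDl mulnBr.
have -> : (i1 - j1 + (j1 - i1) = i1 - j1)%N by lia.
rewrite lognM ?subn_gt0 // ?prime_gt1 // [X in (X + _)%N](_ : _ = 0%N) //.
apply: logn_coprime; rewrite prime_coprime // gtnNdvd //; lia.
Qed.

Lemma w_wt_ge1 i : (1%:E <= v (w_wt p s v i))%E.
Proof. exact: (padic_exp_sub1 v_val p_pr vp p11 v_compl). Qed.

Local Notation fac k := ('X - (w_wt p s v k)%:P).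

Lemma ghost_prod n b : (T n <= b)%N ->
  ghost p s v n = \prod_(k < b) fac k ^+ ghost_mult p s n k.
Proof.
case: n => [_|n nb]; rewrite /ghost.
  by rewrite big1 // => k _; rewrite ghost_mult0 expr0.
rewrite (@fsbigE _ _ _ _ _ (iota 0 b)) ?iota_uniq //.
- rewrite (eq_bigl xpredT); last by move=> i; rewrite in_setT.
  by rewrite -(big_mkord xpredT (fun k => fac k ^+ ghost_mult p s n.+1 k)) /index_iota subn0.
- move=> i _; rewrite mem_iota add0n /= => ib.
  by rewrite ghost_mult_ge ?expr0 //; lia.
Qed.

Lemma ghost_hat_prod n k b : (T n <= b)%N -> (k < b)%N ->
  ghost_hat p s v n k = \prod_(i < b | i != k :> nat) fac i ^+ ghost_mult p s n i.
Proof.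
move=> nb kb; rewrite /ghost_hat (ghost_prod nb) (bigD1 (Ordinal kb)) //= mulrC mulpK.
  by apply: eq_bigl => i; rewrite -val_eqE.
by rewrite expf_neq0 // polyXsubC_eq0.
Qed.

Lemma ghost_hat_mult0 n k : ghost_mult p s n k = 0%N -> ghost_hat p s v n k = ghost p s v n.
Proof. by move=> h; rewrite /ghost_hat h expr0 divp1. Qed.

Lemma v_prod_fac (x : nat -> R) (w : C) (P : pred nat) n b :
  (forall k, P k -> (0 < ghost_mult p s n k)%N -> v (w - w_wt p s v k) = (x k)%:E) ->
  v (\prod_(k < b | P k) fac k ^+ ghost_mult p s n k).[w] =
  (\sum_(k < b | P k) (ghost_mult p s n k)%:R * x k)%:E.
Proof.
move=> h; rewrite horner_prod (big_morph v (valM v_val) (val1 v_val)) -sumEFin.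
apply: eq_bigr => k Pk; rewrite horner_exp hornerXsubC.
case: (posnP (ghost_mult p s n k)) => [->|m0]; first by rewrite expr0 (val1 v_val) mul0r.
exact: (valX v_val _ (h _ Pk m0)).
Qed.

Lemma v_ghost (x : nat -> R) (w : C) n :
  (forall k, (0 < ghost_mult p s n k)%N -> v (w - w_wt p s v k) = (x k)%:E) ->
  v (ghost p s v n).[w] = (F x n)%:E.
Proof.
move=> h; rewrite (ghost_prod (leqnn _)) (@v_prod_fac x w xpredT) ?(ghost_mult_F _ (leqnn _)) //.
by move=> k _; apply: h.
Qed.

Lemma v_ghost_hat (x : nat -> R) (w : C) n k : x k = 0 ->
  (forall i, i != k -> (0 < ghost_mult p s n i)%N -> v (w - w_wt p s v i) = (x i)%:E) ->
  v (ghost_hat p s v n k).[w] = (F x n)%:E.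
Proof.
move=> xk h; pose b := (T n + k.+1)%N.
have nb : (T n <= b)%N by rewrite leq_addr.
have kb : (k < b)%N by rewrite /b; lia.
rewrite (ghost_hat_prod nb kb) (@v_prod_fac x w (fun i => i != k)) // (ghost_mult_F _ nb).
congr _%:E; rewrite [RHS](bigD1 (Ordinal kb)) //= xk mulr0 add0r.
by apply: eq_bigl => i; rewrite -val_eqE.
Qed.

Lemma v_ghost_ge (x : nat -> R) (w : C) n :
  (forall k, ((x k)%:E <= v (w - w_wt p s v k))%E) -> ((F x n)%:E <= v (ghost p s v n).[w])%E.
Proof.
move=> h; rewrite (ghost_prod (leqnn _)) (ghost_mult_F _ (leqnn _)) horner_prod.
rewrite (big_morph v (valM v_val) (val1 v_val)) -sumEFin.
apply: lee_sum => k _; rewrite horner_exp hornerXsubC.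
elim: (ghost_mult p s n k) => [|m IHm]; first by rewrite expr0 (val1 v_val) mul0r.
by rewrite exprS (valM v_val) -natr1 mulrDl mul1r addrC EFinD leeD.
Qed.


End Poly.
End Ghost.

(** * Lower convex hulls *)

Section Hull.
Variable R : realType.
Implicit Types (P : set (R^o * R^o)) (x y t : R).

Definition convex_fun (phi : R -> R) := forall x y t, 0 <= t -> t <= 1 ->
  phi (t * x + (1 - t) * y) <= t * phi x + (1 - t) * phi y.

Lemma convex_setE P : @convex_set R (R^o * R^o)%type P <->
  forall (z1 z2 : R^o * R^o) t, 0 <= t -> t <= 1 -> P z1 -> P z2 ->
    P (t * z1.1 + (1 - t) * z2.1, t * z1.2 + (1 - t) * z2.2).
Proof.
split=> [cP z1 z2 t t0 t1 P1 P2|cP z1 z2 l].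
  by have := cP z1 z2 (Itv01 t0 t1); rewrite !inE => /(_ P1 P2).
rewrite !inE => P1 P2; have := cP z1 z2 l%:num; apply => //.
Qed.

Lemma convex_hull_convex P : @convex_set R (R^o * R^o)%type (convex_hull P).
Proof.
apply/convex_setE => z1 z2 t t0 t1 h1 h2 A [cA PA].
have /convex_setE := cA; apply => //; [exact: h1|exact: h2].
Qed.

Lemma hull_ge P (phi : R -> R) : convex_fun phi -> (forall z, P z -> phi z.1 <= z.2) ->
  forall x, ((phi x)%:E <= lower_hull P x)%E.
Proof.
move=> cphi hP x; apply: le_ereal_inf_tmp => _ [y /= hy <-]; rewrite lee_fin.
have : convex_hull P `<=` [set z | phi z.1 <= z.2].
  apply: smallest_sub => //; apply/convex_setE => z1 z2 t t0 t1 /= h1 h2.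
  apply: (le_trans (cphi _ _ _ t0 t1)).
  by apply: lerD; apply: ler_wpM2l => //; lra.
by move=> /(_ _ hy).
Qed.

Lemma hull_le P x y : P (x, y) -> (lower_hull P x <= y%:E)%E.
Proof.
by move=> Pxy; apply: ereal_inf_lbound; exists y => //=; apply: sub_gen_smallest.
Qed.

Lemma hull_le_conv P x1 y1 x2 y2 t : 0 <= t -> t <= 1 -> P (x1, y1) -> P (x2, y2) ->
  (lower_hull P (t * x1 + (1 - t) * x2) <= (t * y1 + (1 - t) * y2)%:E)%E.
Proof.
move=> t0 t1 P1 P2; apply: ereal_inf_lbound; exists (t * y1 + (1 - t) * y2) => //=.
have /convex_setE cP := @convex_hull_convex P.
by apply: (cP (x1, y1) (x2, y2)) => //; apply: sub_gen_smallest.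
Qed.

(** Convexity read backwards: a lower bound at a point between [x1] and [x] extrapolates to [x]. *)
Lemma hull_slope P x1 y1 x t c : 0 <= t -> t < 1 -> P (x1, y1) ->
  (c%:E <= lower_hull P (t * x1 + (1 - t) * x)%R)%E ->
  (((c - t * y1) / (1 - t))%:E <= lower_hull P x)%E.
Proof.
move=> t0 t1 P1 hc; apply: le_ereal_inf_tmp => _ [y /= hy <-]; rewrite lee_fin.
have : (lower_hull P (t * x1 + (1 - t) * x) <= (t * y1 + (1 - t) * y)%:E)%E.
  apply: ereal_inf_lbound; exists (t * y1 + (1 - t) * y) => //=.
  have /convex_setE cP := @convex_hull_convex P.
  by apply: (cP (x1, y1) (x, y)) => //; [exact: ltW|apply: sub_gen_smallest].
move=> /(le_trans hc); rewrite lee_fin ler_pdivrMr ?subr_gt0 //; lra.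
Qed.

Lemma convex_affine (a b : R) : convex_fun (fun x => a + b * x).
Proof. by move=> x y t t0 t1 /=; rewrite le_eqVlt; apply/orP; left; apply/eqP; ring. Qed.

Lemma convex_abs (a b e x0 : R) : 0 <= e -> convex_fun (fun x => a + b * (x - x0) + e * `|x - x0|).
Proof.
move=> e0 x y t t0 t1 /=.
have h : `|t * x + (1 - t) * y - x0| <= t * `|x - x0| + (1 - t) * `|y - x0|.
  have -> : t * x + (1 - t) * y - x0 = t * (x - x0) + (1 - t) * (y - x0) by ring.
  apply: le_trans (ler_normD _ _) _; rewrite !normrM (ger0_norm t0).
  by rewrite (@ger0_norm _ (1 - t)) // subr_ge0.
have := ler_wpM2l e0 h; lra.
Qed.

Lemma hull_line P x1 y1 x2 y2 a b : P (x1, y1) -> P (x2, y2) ->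
  y1 = a + b * x1 -> y2 = a + b * x2 -> (forall z, P z -> a + b * z.1 <= z.2) ->
  forall x, x1 <= x -> x <= x2 -> lower_hull P x = (a + b * x)%:E.
Proof.
move=> P1 P2 E1 E2 hP x h1 h2; apply/eqP; rewrite eq_le; apply/andP; split; last first.
  exact: (hull_ge (convex_affine a b)).
case: (eqVneq x1 x2) => [E|ne].
  have -> : x = x1 by apply/eqP; rewrite eq_le h1 E h2.
  by rewrite -E1; apply: hull_le.
have d : 0 < x2 - x1 by rewrite subr_gt0 lt_neqAle ne (le_trans h1).
pose t := (x2 - x) / (x2 - x1).
have t0 : 0 <= t by apply: divr_ge0; lra.
have t1 : t <= 1 by rewrite ler_pdivrMr // mul1r; lra.
have := hull_le_conv t0 t1 P1 P2.
have -> : t * x1 + (1 - t) * x2 = x by rewrite /t; field; lra.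
have -> // : t * y1 + (1 - t) * y2 = a + b * x.
by rewrite E1 E2 /t; field; lra.
Qed.

Lemma hull_vertex P x0 y0 b e : P (x0, y0) -> 0 < e ->
  (forall z, P z -> y0 + b * (z.1 - x0) + e * `|z.1 - x0| <= z.2) ->
  vertex_abscissa (lower_hull P) x0.
Proof.
move=> P0 e0 hP; have ge := hull_ge (convex_abs y0 b x0 (ltW e0)) hP.
have E0 : lower_hull P x0 = y0%:E.
  apply/eqP; rewrite eq_le (hull_le P0) /=.
  by have /= := ge x0; rewrite subrr normr0 !mulr0 !addr0.
split; first by rewrite E0.
move=> x1 x2 h1 h2; rewrite E0.
have d : 0 < x2 - x1 by lra.
have a0 : 0 < (x2 - x0) / (x2 - x1) by apply: divr_gt0; lra.
have b0 : 0 < (x0 - x1) / (x2 - x1) by apply: divr_gt0; lra.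
set ca := (x2 - x0) / (x2 - x1) in a0 *; set cb := (x0 - x1) / (x2 - x1) in b0 *.
have g1 := ge x1; have g2 := ge x2.
have : ((ca * (y0 + b * (x1 - x0) + e * `|x1 - x0|))%:E +
        (cb * (y0 + b * (x2 - x0) + e * `|x2 - x0|))%:E <=
        ca%:E * lower_hull P x1 + cb%:E * lower_hull P x2)%E.
  by apply: leeD; rewrite EFinM lee_pmul2l // lte_fin.
apply: lt_le_trans; rewrite -EFinD lte_fin.
rewrite (ltr0_norm (_ : x1 - x0 < 0)) ?subr_lt0 // (gtr0_norm (_ : 0 < x2 - x0)) ?subr_gt0 //.
have E1 : ca + cb = 1 by rewrite /ca /cb; field; lra.
have E2 : ca * (x1 - x0) + cb * (x2 - x0) = 0 by rewrite /ca /cb; field; lra.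
have p1 : 0 < ca * e * (x0 - x1) by apply: mulr_gt0; [apply: mulr_gt0|lra].
have p2 : 0 < cb * e * (x2 - x0) by apply: mulr_gt0; [apply: mulr_gt0|lra].
have -> : ca * (y0 + b * (x1 - x0) + e * - (x1 - x0)) + cb * (y0 + b * (x2 - x0) + e * (x2 - x0))
  = (ca + cb) * y0 + b * (ca * (x1 - x0) + cb * (x2 - x0)) + ca * e * (x0 - x1) + cb * e * (x2 - x0) by ring.
rewrite E1 E2; lra.
Qed.

Lemma hull_not_vertex P x1 y1 x2 y2 x0 a b : P (x1, y1) -> P (x2, y2) ->
  y1 = a + b * x1 -> y2 = a + b * x2 -> (forall z, P z -> a + b * z.1 <= z.2) ->
  x1 < x0 -> x0 < x2 -> ~ vertex_abscissa (lower_hull P) x0.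
Proof.
move=> P1 P2 E1 E2 hP h1 h2 [_ /(_ x1 x2 h1 h2)].
have line := hull_line P1 P2 E1 E2 hP.
rewrite (line x0) ?ltW // (line x1) ?lexx ?(ltW (lt_trans h1 h2)) //.
rewrite (line x2) ?lexx ?(ltW (lt_trans h1 h2)) // -!EFinM -EFinD lte_fin.
suff -> : (x2 - x0) / (x2 - x1) * (a + b * x1) + (x0 - x1) / (x2 - x1) * (a + b * x2) = a + b * x0.
  by rewrite ltxx.
by field; lra.
Qed.

(** Rules out negative integers as vertex abscissae. *)
Lemma hull_pinfty P x : (forall z, P z -> 0 <= z.1) -> x < 0 -> lower_hull P x = +oo%E.
Proof.
move=> hP x0; rewrite /lower_hull (_ : [set _ | _ in _] = set0) ?ereal_inf0 //.
rewrite -subset0 => _ [y /= hy _].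
have : convex_hull P `<=` [set z | 0 <= z.1].
  apply: smallest_sub => //; apply/convex_setE => z1 z2 t t0 t1 /= g1 g2.
  by apply: addr_ge0; apply: mulr_ge0 => //; lra.
by move=> /(_ _ hy) /=; rewrite leNgt x0.
Qed.

End Hull.

(** * The hull of the points Delta' *)

Section Radius.
Variables (p s : nat) (R : realType) (C : closedFieldType) (v : C -> \bar R).
Hypotheses (p_pr : prime p) (p11 : (11 <= p)%N) (s_le : (s <= p - 2)%N).
Hypothesis hC : is_Cp p v.

Local Notation d := (delta_eps p s).
Local Notation T := (ur_bound p s d).
Local Notation K := (Iw_bound p s d).
Local Notation F := (@height R p s d).
Local Notation X := (wdist p).
Local Notation xh := (@dist_row R p).
Local Notation H := (@hat_height R p s d).
Local Notation cw := (@half_weight R p s d).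
Local Notation range := (@steinberg_range R p s d).

Lemma range_ext (x y : nat -> R) k a a' : x k = y k -> range x k a a' -> range y k a a'.
Proof. by move=> e [h1 h2 h3 h4]; split => //; rewrite -e. Qed.

(** A radius is recorded by the ends [n' < n] of its interval about [d_Iw / 2]: by parity the first
    member 1 or 3/2 becomes [n - n' >= 2], and the upper endpoint [d_new / 2] becomes
    [d_ur <= n']. *)
Lemma nS_candidateP k (L : R) : nS_candidate p s k L <->
  exists n n' : nat, [/\ (n + n' + d = k.+1)%N, (n' + 2 <= n)%N, (k < T n')%N &
    L = (n%:R - n'%:R) / 2].
Proof.
split.
- case=> -[j ->] hL; have d1 := delta_le1 p_pr p11 s_le; have u0 := d_ur_ge0 p_pr p11 s_le k.
  pose D := (k.+1 - d)%N.
  have dD : d_Iw p s k = D%:Z by rewrite /d_Iw /D; lia.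
  have [b [Db hb]] : exists b : bool, D = (D./2.*2 + b)%N /\ (2 %| d_Iw p s k)%Z = ~~ b.
    exists (odd D); split; first by rewrite addnC odd_double_half.
    by rewrite dD dvdzE /= dvdn2.
  rewrite hb in hL *.
  have hL' : ((2 + b + 2 * j)%N%:Z <= d_new p s k).
    rewrite -(ler_int R) -pmulrn (natrD _ (2 + b)) (natrD _ 2) (natrM _ 2).
    by move: hL; case: (b) => /=; lra.
  rewrite /d_new dD in hL'.
  exists (D./2 + b + j + 1)%N, (D./2 - j - 1)%N; split.
  + rewrite /D in Db *; lia.
  + lia.
  + by rewrite -(d_ur_le p_pr p11 s_le); lia.
  + have -> : (D./2 - j - 1)%N%:R = D./2%:R - j%:R - 1 :> R.
      have : (D./2 = D./2 - j - 1 + j.+1)%N by lia.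
      move/(congr1 (fun m : nat => m%:R : R)); rewrite natrD -natr1; lra.
    by rewrite !natrD; case: (b) => /=; field.
- case=> n [n' [En nn kn' ->]]; rewrite /nS_candidate.
  have dI := d_Iw_sub p_pr p11 s_le En.
  have hu : d_ur p s k <= n'%:Z by rewrite (d_ur_le p_pr p11 s_le).
  split; last first.
    rewrite ler_pM2r ?invr_gt0 ?ltr0n // /d_new dI.
    have : (n%:Z - n'%:Z <= n%:Z + n'%:Z - 2 * d_ur p s k) by lia.
    by rewrite -(ler_int R) rmorphB.
  rewrite dI; have -> : (2 %| n%:Z + n'%:Z)%Z = ~~ odd (n - n').
    by rewrite -PoszD dvdzE /= dvdn2 oddD oddB; [case: (odd n); case: (odd n')|lia].
  rewrite -natrB; last by lia.
  have [m ->] : exists m, (n - n' = m + 2)%N by exists (n - n' - 2)%N; lia.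
  exists m./2; rewrite oddD addbF.
  have := congr1 (fun m : nat => m%:R : R) (odd_double_half m).
  rewrite -muln2 natrD natrM (natrD _ m) => <-.
  by case: (odd m) => /=; field.
Qed.

Definition Delta_points k : set (R^o * R^o) :=
  [set z | admissible p s k z.1 /\ Delta' p s v k z.1 = z.2%:E].

Definition Delta_val k n n' : R := H k n - cw k * ((n%:R - n'%:R) / 2).

Lemma Delta'E k n n' : (n + n' + d = k.+1)%N ->
  Delta' p s v k ((n%:R - n'%:R) / 2) = (Delta_val k n n')%:E.
Proof.
move=> En; rewrite /Delta' (d_Iw_sub p_pr p11 s_le En).
have -> : (n%:Z + n'%:Z)%:~R / 2 + (n%:R - n'%:R) / 2 = n%:R :> R.
  by rewrite rmorphD /= -!pmulrn; field.
rewrite natrK (v_ghost_hat p_pr p11 s_le hC (x := xh k)).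
- by rewrite -EFinB half_weightE.
- by rewrite /dist_row eqxx.
- by move=> i ik _; rewrite (w_wt_sub p_pr p11 s_le hC) 1?eq_sym // /dist_row (negbTE ik) wdistC.
Qed.

Lemma Delta_points_in k n n' : (n + n' + d = k.+1)%N -> (k < T n)%N -> (k < T n')%N ->
  Delta_points k ((n%:R - n'%:R) / 2, Delta_val k n n').
Proof.
move=> En kn kn'; split => /=; last exact: Delta'E.
have dI := d_Iw_sub p_pr p11 s_le En.
have hu : d_ur p s k <= n%:Z by rewrite (d_ur_le p_pr p11 s_le).
have hu' : d_ur p s k <= n'%:Z by rewrite (d_ur_le p_pr p11 s_le).
split.
- have -> : 2 * ((n%:R - n'%:R) / 2) = (n%:Z - n'%:Z)%:~R :> R by rewrite rmorphB; field.
  exact: intr_int.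
- move: hu hu'; rewrite /d_new dI; move: (d_ur p s k) => u.
  rewrite -!(ler_int R) rmorphB rmorphM rmorphD rmorph_nat /= -!pmulrn => h1 h2.
  by rewrite ler_norml; apply/andP; split; lra.
- rewrite dI rmorphD /=.
  have -> : (n%:Z%:~R + n'%:Z%:~R) / 2 + (n%:R - n'%:R) / 2 = n%:Z%:~R :> R.
    by rewrite -!pmulrn; field.
  exact: intr_int.
Qed.

Lemma Delta_points_inv k z : Delta_points k z -> exists n n', [/\ (n + n' + d = k.+1)%N, (k < T n)%N,
  (k < T n')%N & z = ((n%:R - n'%:R) / 2, Delta_val k n n')].
Proof.
case: z => l y [/= [_ hl /intrP[m Em]] hy].
have u0 := d_ur_ge0 p_pr p11 s_le k.
have hlm : l = m%:~R - (d_Iw p s k)%:~R / 2 by lra.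
have [h1 h2] : d_ur p s k <= m /\ m <= d_Iw p s k - d_ur p s k.
  move: hl hlm; rewrite ler_norml /d_new; move: (d_ur p s k) (d_Iw p s k) => u D.
  rewrite -!(ler_int R) !rmorphB rmorphM rmorph_nat /= => /andP[] h1 h2 h3; split; lra.
have [n En] : exists n : nat, m = n%:Z by exists `|m|%N; lia.
have [n' En'] : exists n' : nat, d_Iw p s k - m = n'%:Z by exists `|d_Iw p s k - m|%N; lia.
have d1 := delta_le1 p_pr p11 s_le.
have EE : (n + n' + d = k.+1)%N by move: En'; rewrite /d_Iw En; lia.
have hl2 : l = (n%:R - n'%:R) / 2.
  by rewrite hlm (d_Iw_sub p_pr p11 s_le EE) En rmorphD /= -!pmulrn; field.
exists n, n'; split => //.
- by rewrite -(d_ur_le p_pr p11 s_le) -En.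
- by rewrite -(d_ur_le p_pr p11 s_le) -En'; lia.
- by congr pair => //; move: hy; rewrite hl2 Delta'E // => -[].
Qed.

(** Finitely many strict inequalities leave a common extra slope [e], which keeps the hull, and not
    only its points, strictly above the line of slope [xi]. *)
Lemma uniform_slope_gap (P : pred nat) (f : nat -> R) N M :
  (forall n, (N < n <= M)%N -> P n -> 0 < f n) ->
  exists2 e : R, 0 < e & forall n, (N < n <= M)%N -> P n -> e * (n%:R - N%:R) <= f n.
Proof.
elim: M => [_|M IHM hf]; first by exists 1 => // n; lia.
have [|e e0 he] := IHM; first by move=> n hn; apply: hf; lia.
case: (boolP ((N < M.+1)%N && P M.+1)) => [/andP[NM PM]|no]; last first.
  exists e => // n hn Pn; apply: he => //; case: (eqVneq n M.+1) => [E|]; last by lia.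
  by move: no; rewrite -E Pn; lia.
have fM := hf M.+1 ltac:(lia) PM.
have d0 : 0 < M.+1%:R - N%:R :> R by rewrite subr_gt0 ltr_nat.
exists (Num.min e (f M.+1 / (M.+1%:R - N%:R))); first by rewrite lt_min e0 divr_gt0.
move=> n hn Pn; have dn : 0 < n%:R - N%:R :> R by rewrite subr_gt0 ltr_nat; lia.
case: (eqVneq n M.+1) => [->|ne]; first by rewrite -ler_pdivlMr // ge_min lexx orbT.
have nM : (N < n <= M)%N by clear -ne hn; lia.
by apply: le_trans (he n nM Pn); rewrite ler_pM2r // ge_min lexx.
Qed.

(** * Increments of the hull at the largest minimizer *)

Section Argmin.
Variables (k N N' : nat) (xi : R).
Hypotheses (EN : (N + N' + d = k.+1)%N) (kN : (k < T N)%N) (kN' : (k < T N')%N).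
Hypothesis hN : forall n n', (n + n' + d = k.+1)%N -> (k < T n)%N -> (k < T n')%N ->
  ((n <= N)%N -> H k N - H k n <= (cw k + xi) * (N%:R - n%:R)) /\
  ((N < n)%N -> (cw k + xi) * (n%:R - N%:R) < H k n - H k N).

Let radius : R := (N%:R - N'%:R) / 2.

Lemma radius_sub n n' : (n + n' + d = k.+1)%N -> (n%:R - n'%:R) / 2 - radius = n%:R - N%:R.
Proof.
move=> En; have : (n + n' = N + N')%N by lia.
by move/(congr1 (fun m : nat => m%:R : R)); rewrite /radius !natrD; lra.
Qed.

Lemma Delta_val_sub n n' : (n + n' + d = k.+1)%N ->
  Delta_val k n n' - Delta_val k N N' = H k n - H k N - cw k * (n%:R - N%:R).
Proof. by move=> En; rewrite -(radius_sub En) /Delta_val /radius; ring. Qed.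

Lemma Delta_ge x : ((Delta_val k N N' + xi * (x - radius))%:E <= Delta p s v k x)%E.
Proof.
have -> : Delta_val k N N' + xi * (x - radius) = (Delta_val k N N' - xi * radius) + xi * x by ring.
apply: (hull_ge (@convex_affine R (Delta_val k N N' - xi * radius) xi)) => z /Delta_points_inv[n [n' [En kn kn' ->]]] /=.
have Ed := Delta_val_sub En; have Ea := radius_sub En; have [h1 h2] := hN En kn kn'.
have Ea2 : (n%:R - n'%:R) / 2 = radius + (n%:R - N%:R) :> R by lra.
rewrite Ea2; suff : Delta_val k N N' - xi * radius + xi * (radius + (n%:R - N%:R)) <= Delta_val k n n' by [].
by case: (leqP n N) => [/h1|/h2] h; lra.
Qed.

Lemma Delta_close : (Delta p s v k radius - Delta p s v k (radius - 1)%R <= xi%:E)%E.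
Proof.
have h1 := hull_le (Delta_points_in EN kN kN'); have h2 := Delta_ge (radius - 1).
apply: (@le_trans _ _ ((Delta_val k N N')%:E - (Delta_val k N N' + xi * (radius - 1 - radius))%:E)%E).
  by apply: leeB.
by rewrite -EFinB lee_fin; lra.
Qed.

(** From the minimizer to [l] the hull rises with mean slope at least [xi + e], and by convexity its
    last unit increment is no smaller than this mean. *)
Lemma Delta_not_close n n' : (n + n' + d = k.+1)%N -> (k < T n')%N -> (N < n)%N ->
  ~ (Delta p s v k ((n%:R - n'%:R) / 2) - Delta p s v k ((n%:R - n'%:R) / 2 - 1)%R <= xi%:E)%E.
Proof.
move=> En kn' Nn; have kn : (k < T n)%N by apply: (leq_trans kN); apply: leq_ur_bound; exact: ltnW.
pose P m := [&& (m + d <= k.+1)%N, (k < T m)%N & (k < T (k.+1 - d - m))%N].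
have [m /andP[h1 h2] /and3P[h3 h4 h5]|e e0 he] :=
    @uniform_slope_gap P (fun m => H k m - H k N - (cw k + xi) * (m%:R - N%:R)) N k.+1.
  have Em : (m + (k.+1 - d - m) + d = k.+1)%N by lia.
  by have [_ /(_ h1)] := hN Em h4 h5; lra.
pose l : R := (n%:R - n'%:R) / 2; rewrite -/l.
have ll : l - radius = n%:R - N%:R := radius_sub En.
have En1 : (n.-1 + n'.+1 + d = k.+1)%N by lia.
have l1 : (n.-1%:R - n'.+1%:R) / 2 = l - 1 :> R.
  have : (n = n.-1.+1)%N by lia.
  move=> En2; have En3 : n%:R = n.-1%:R + 1 :> R by rewrite natr1 -En2.
  by rewrite -(natr1 n') /l; lra.
have kn1 : (k < T n.-1)%N by apply: (leq_trans kN); apply: leq_ur_bound; lia.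
have kn1' : (k < T n'.+1)%N by apply: (leq_trans kn'); apply: leq_ur_bound; lia.
have up2 := hull_le (Delta_points_in En kn kn').
have up1 := hull_le (Delta_points_in En1 kn1 kn1'); rewrite l1 in up1.
have lo1 := Delta_ge (l - 1).
have lo2 : ((Delta_val k N N' + (xi + e) * (l - radius))%:E <= Delta p s v k l)%E.
  have ll0 : 0 <= l - radius by rewrite ll subr_ge0 ler_nat ltnW.
  have -> : Delta_val k N N' + (xi + e) * (l - radius) =
     Delta_val k N N' + (xi + e / 2) * (l - radius) + e / 2 * `|l - radius| by rewrite ger0_norm //; field.
  apply: (hull_ge (convex_abs (Delta_val k N N') (xi + e / 2) radius (_ : 0 <= e / 2))); first by lra.
  move=> z /Delta_points_inv[m [m' [Em km km' ->]]] /=.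
  rewrite (radius_sub Em); have := Delta_val_sub Em; have [g1 g2] := hN Em km km'.
  case: (leqP m N) => mN.
    have d0 : m%:R - N%:R <= 0 :> R by rewrite subr_le0 ler_nat.
    by rewrite (ler0_norm d0); have := g1 mN; lra.
  have d0 : 0 <= m%:R - N%:R :> R by rewrite subr_ge0 ler_nat ltnW.
  have [hm1 hm2] : (N < m <= k.+1)%N /\ (k.+1 - d - m = m')%N by clear -mN Em; lia.
  have hm3 : (m + d <= k.+1)%N by clear -Em; lia.
  by rewrite (ger0_norm d0); have := he m hm1; rewrite /P hm3 km hm2 km' => /(_ isT); lra.
have fin1 : Delta p s v k (l - 1)%R \is a fin_num.
  by rewrite fin_numE; apply/andP; split; apply/eqP => E;
    [move: lo1; rewrite E|move: up1; rewrite -/(Delta p s v k (l-1)) E].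
have fin2 : Delta p s v k l \is a fin_num.
  by rewrite fin_numE; apply/andP; split; apply/eqP => E;
    [move: lo2; rewrite E|move: up2; rewrite -/(Delta p s v k l) E].
move: up1; rewrite -/(Delta p s v k (l - 1)) => up1.
case: (eqVneq n N.+1) => [nN|nN].
  have [E1 E2] : n.-1 = N /\ n'.+1 = N' by lia.
  move: up1 lo2; rewrite E1 E2 ll nN -natr1.
  move: fin1 fin2; case: (Delta p s v k (l - 1)%R) => // r1 _; case: (Delta p s v k l) => // r2 _.
  by rewrite -EFinB !lee_fin; lra.
(* For this [t] the point [l - 1] is [t * radius + (1 - t) * l]. It is below 1 because the case
   [n = N + 1] is settled. *)
pose t : R := (l - radius)^-1.
have m2 : 2 <= l - radius.
  by rewrite ll -natrB 1?ltnW // ler_nat; lia.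
have t0 : 0 < t by rewrite invr_gt0; lra.
have t1 : t < 1 by rewrite invf_lt1; lra.
have tm : t * (l - radius) = 1 by rewrite /t mulVf // gt_eqF //; lra.
have := @hull_slope R (Delta_points k) radius (Delta_val k N N') l t (fine (Delta p s v k (l - 1)))
  (ltW t0) t1 (Delta_points_in EN kN kN').
have -> : t * radius + (1 - t) * l = l - 1 by lra.
rewrite -/(Delta p s v k) fineK // lexx => /(_ isT).
move: lo2 fin1 fin2.
case: (Delta p s v k (l - 1)%R) => // r1; case: (Delta p s v k l) => // r2 lo2 _ _.
rewrite -EFinB !lee_fin /= ler_pdivrMr ?subr_gt0 // => g2 g3.
rewrite lee_fin in lo2.
have : t * ((xi + e) * (l - radius)) <= t * (r2 - Delta_val k N N') by rewrite ler_pM2l //; lra.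
have -> : t * ((xi + e) * (l - radius)) = (xi + e) * (t * (l - radius)) by ring.
rewrite tm; lra.
Qed.

End Argmin.

Variable w : C.

Lemma nS_radius_unique k L L' : is_nS_radius p s v w k L -> is_nS_radius p s v w k L' -> L = L'.
Proof.
by move=> [c1 h1 m1] [c2 h2 m2]; apply/eqP; rewrite eq_le m1 // m2.
Qed.

Lemma range_radius k a a' (xi : R) : v (w - w_wt p s v k) = xi%:E ->
  range (fun=> xi) k a a' -> is_nS_radius p s v w k ((a.+1%:R - a'%:R) / 2).
Proof.
move=> hxi rg; have [Ek aa ka' hN] := rg.
have EN : (a.+1 + a' + d = k.+1)%N by lia.
have kN : (k < T a.+1)%N by apply: (leq_trans ka'); apply: leq_ur_bound; lia.
split.
- by apply/nS_candidateP; exists a.+1, a'; split => //; lia.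
- by rewrite /nS_close hxi; apply: (Delta_close EN kN ka' hN).
move=> L' /nS_candidateP[n [n' [En nn kn' ->]]]; rewrite /nS_close hxi => hcl.
rewrite ler_pM2r ?invr_gt0 ?ltr0n //; case: (leqP n a.+1) => na.
  have : (n + a' <= a.+1 + n')%N by lia.
  by rewrite -(ler_nat R) !natrD; lra.
by have := Delta_not_close EN kN ka' hN En kn' na hcl.
Qed.

Lemma nS_radius_fin k L (xi : R) : 0 < xi -> v (w - w_wt p s v k) = xi%:E ->
  is_nS_radius p s v w k L <->
  exists a a', range (fun=> xi) k a a' /\ L = (a.+1%:R - a'%:R) / 2.
Proof.
move=> xi0 hxi; split=> [hL|[a [a' [rg ->]]]]; last exact: range_radius rg.
have dk : (d <= k.+1)%N by have := delta_le1 p_pr p11 s_le; lia.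
have [N [N' [EN kN kN' NN hN]]] := argmin p_pr p11 s_le dk xi0.
case: (leqP (N' + 2) N) => NN'.
  have rg : range (fun=> xi) k N.-1 N'.
    have N1 : N.-1.+1 = N by lia.
    by split; [lia|lia|done|rewrite N1].
  exists N.-1, N'; split => //; apply: nS_radius_unique hL _.
  exact: range_radius rg.
have [/nS_candidateP[n [n' [En nn kn' EL]]] + _] := hL; rewrite EL /nS_close hxi => hcl.
have Nn : (N < n)%N by lia.
by have := Delta_not_close EN kN kN' hN En kn' Nn hcl.
Qed.

(** At [w = w_k] closeness is automatic, so the radius is the largest candidate and the left end is
    [d_ur]. *)
Lemma nS_radius_inf k L : v (w - w_wt p s v k) = +oo%E ->
  is_nS_radius p s v w k L <->
  exists a a', [/\ (a + a' + d = k)%N, (a' < a)%N, d_ur p s k = a'%:Z &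
                   L = (a.+1%:R - a'%:R) / 2].
Proof.
move=> hxi; have main a a' : (a + a' + d = k)%N -> (a' < a)%N -> d_ur p s k = a'%:Z ->
    is_nS_radius p s v w k ((a.+1%:R - a'%:R) / 2).
  move=> Ek aa ua; split; last 1 first.
  - move=> L' /nS_candidateP[n [n' [En nn]]]; rewrite -(d_ur_le p_pr p11 s_le) ua => un -> _.
    rewrite ler_pM2r ?invr_gt0 ?ltr0n //.
    have : (n + a' <= a.+1 + n')%N by lia.
    by rewrite -(ler_nat R) !natrD; lra.
  - apply/nS_candidateP; exists a.+1, a'; split => //; try by lia.
    by rewrite -(d_ur_le p_pr p11 s_le) ua.
  - by rewrite /nS_close hxi leey.
split=> [hL|[a [a' [h1 h2 h3 ->]]]]; last exact: main.
have [/nS_candidateP[n [n' [En nn kn' EL]]] _ _] := hL.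
have u0 := d_ur_ge0 p_pr p11 s_le k.
have [u Eu] : exists u : nat, d_ur p s k = u%:Z by exists `|d_ur p s k|%N; lia.
have un : (u <= n')%N by move: kn'; rewrite -(d_ur_le p_pr p11 s_le) Eu; lia.
have g1 : (k - d - u + u + d = k)%N by lia.
have g2 : (u < k - d - u)%N by lia.
exists (k - d - u)%N, u; split => //.
by apply: nS_radius_unique hL (main _ _ g1 g2 Eu).
Qed.

End Radius.

(** * The Newton polygon of the ghost series *)

Lemma closure_open_interval (R : realType) (a b : R) : a < b ->
  closure [set x : R | a < x < b] = [set x | a <= x <= b].
Proof.
move=> ab; apply/seteqP; split.
  have -> : [set x : R | a < x < b] = [set` `]a, b[].
    by apply/seteqP; split => x /=; rewrite in_itv.
  by move=> x /itv_closure; rewrite /= in_itv.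
move=> x /= /andP[ax xb] B /nbhs_ballP[e /= e0 he].
pose m := (a + b) / 2; pose t := Num.min 1 (e / (2 * (b - a))).
have t0 : 0 < t by rewrite lt_min ltr01 divr_gt0 // mulr_gt0 // subr_gt0.
have t1 : t <= 1 by rewrite ge_min lexx.
have te : t * (b - a) <= e / 2.
  rewrite -ler_pdivlMr ?subr_gt0 // ge_min; apply/orP; right.
  by rewrite le_eqVlt; apply/orP; left; apply/eqP; field; lra.
exists (x + t * (m - x)); split => /=.
  have h1 : 0 <= (1 - t) * (x - a) by apply: mulr_ge0; lra.
  have h2 : 0 <= (1 - t) * (b - x) by apply: mulr_ge0; lra.
  have h3 : 0 < t * (m - a) by apply: mulr_gt0; rewrite /m; lra.
  have h4 : 0 < t * (b - m) by apply: mulr_gt0; rewrite /m; lra.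
  by apply/andP; split; lra.
apply: he; rewrite -ball_normE /= opprD addNKr normrN normrM (gtr0_norm t0).
have : `|m - x| <= b - a by rewrite ler_norml /m; apply/andP; split; lra.
by move/(ler_wpM2l (ltW t0)); lra.
Qed.

Section Main.
Variables (p s : nat) (R : realType) (C : closedFieldType) (v : C -> \bar R) (w : C).
Hypotheses (p_pr : prime p) (p11 : (11 <= p)%N) (s_le : (s <= p - 2)%N).
Hypotheses (hC : is_Cp p v) (hw : (0 < v w)%E).

Local Notation d := (delta_eps p s).
Local Notation T := (ur_bound p s d).
Local Notation K := (Iw_bound p s d).
Local Notation E := (@slope R p s d).
Local Notation F := (@height R p s d).
Local Notation X := (wdist p).
Local Notation xh := (@dist_row R p).
Local Notation H := (@hat_height R p s d).
Local Notation Eh := (@hat_slope R p s d).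
Local Notation cw := (@half_weight R p s d).
Local Notation range := (@steinberg_range R p s d).
Local Notation mu := (@chord_slope R p s d).
Local Notation mult := (ghost_mult p s).
Local Notation W := (w_wt p s v).

Let v_val : is_valuation v. Proof. by case: hC. Qed.
Let d_le : (d <= 1)%N. Proof. exact: delta_le1. Qed.

Definition wval i := v (w - W i).

Lemma wval_gt0 i : (0 < wval i)%E.
Proof.
rewrite /wval; apply: lt_le_trans (v_add_ge v_val w (- W i)); rewrite lt_min hw (valN v_val).
by apply: lt_le_trans (w_wt_ge1 s p_pr p11 hC i); rewrite lte_fin.
Qed.

Lemma wval_min i j : i != j -> (Order.min (wval i) (X i j)%:R%:E <= wval j)%E.
Proof.
move=> ij; rewrite /wval -(w_wt_sub p_pr p11 s_le hC ij).
have -> : w - W j = (w - W i) + (W i - W j) by ring.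
exact: v_add_ge.
Qed.

Lemma wval_min2 i j : i != j -> (Order.min (wval i) (wval j) <= (X i j)%:R%:E)%E.
Proof.
move=> ij; rewrite /wval -(w_wt_sub p_pr p11 s_le hC ij) minC.
have -> : W i - W j = (w - W j) + - (w - W i) by ring.
by apply: le_trans (v_add_ge v_val _ _); rewrite (valN v_val).
Qed.

(* Truncation keeps the ultrametric inequalities and makes a vanishing factor finite. *)
Definition trunc_val (B : R) i : R := fine (Order.min (wval i) B%:E).

Lemma trunc_valE B i : 0 < B -> (trunc_val B i)%:E = Order.min (wval i) B%:E.
Proof.
move=> B0; rewrite /trunc_val fineK // fin_numE; have := wval_gt0 i.
by rewrite minEle; case: ifP; case: (wval i) => [r| |] //=; rewrite leye_eq.
Qed.

Lemma trunc_val_eq B i : 0 < B -> (wval i <= B%:E)%E -> (trunc_val B i)%:E = wval i.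
Proof. by move=> B0 h; rewrite trunc_valE // (min_l h). Qed.

Lemma trunc_val_inf B i : wval i = +oo%E -> trunc_val B i = B.
Proof. by move=> h; rewrite /trunc_val h min_r // leey. Qed.

Lemma trunc_val_le B i : 0 < B -> ((trunc_val B i)%:E <= wval i)%E.
Proof. by move=> B0; rewrite trunc_valE // ge_min lexx. Qed.

Lemma trunc_val_mono B B' i : 0 < B -> B <= B' -> trunc_val B i <= trunc_val B' i.
Proof.
move=> B0 BB; have B0' := lt_le_trans B0 BB.
by rewrite -lee_fin !trunc_valE // le_min !ge_min lexx lee_fin BB orbT.
Qed.

Section Trunc.
Variable B : R.
Hypothesis B0 : 0 < B.

Lemma trunc_val_gt0 i : 0 < trunc_val B i.
Proof. by rewrite -lte_fin trunc_valE // lt_min wval_gt0 lte_fin. Qed.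

Lemma trunc_val_min i j : i != j -> Num.min (trunc_val B i) (X i j)%:R <= trunc_val B j.
Proof.
move=> ij; rewrite -lee_fin EFin_min !trunc_valE // le_min; apply/andP; split.
  by apply: le_trans (wval_min ij); rewrite le_min !ge_min !lexx orbT.
by rewrite !ge_min lexx !orbT.
Qed.

Lemma trunc_val_min2 i j : i != j -> Num.min (trunc_val B i) (trunc_val B j) <= (X i j)%:R.
Proof.
move=> ij; rewrite -lee_fin EFin_min !trunc_valE //.
by apply: le_trans (wval_min2 ij); rewrite le_min !ge_min !lexx !orbT.
Qed.

End Trunc.

Lemma range_mult x k a a' m : range x k a a' -> (a' < m <= a)%N -> (0 < mult m k)%N.
Proof.
clear v_val hC hw; move=> rg hm; have Ek := range_sum rg; rewrite (ghost_mult_gt0 p_pr p11 s_le).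
have : d_ur p s k <= a'%:Z by rewrite d_ur_le // (range_ur_bound rg).
have -> : d_Iw p s k = a.+1%:Z + a'%:Z by apply: d_Iw_sub => //; lia.
lia.
Qed.

Lemma range_large k : exists B0 : R, forall x m, (0 < mult m k)%N -> B0 <= x k ->
  exists a a', [/\ range x k a a', d_ur p s k = a'%:Z & (a' < m <= a)%N].
Proof.
have u0 := d_ur_ge0 p_pr p11 s_le k.
have [u Eu] : exists u : nat, d_ur p s k = u%:Z by exists `|d_ur p s k|%N; lia.
pose N := (k.+1 - d - u)%N.
pose f n := `|H k N - H k n - cw k * (N%:R - n%:R)|.
(* The sum dominates each deviation of [H k] from slope [cw k], and distinct abscissae differ by at
   least 1; so for larger [x k] the minimizer is the last admissible index. *)
exists (\sum_(n < k.+2) f n) => x m; rewrite ghost_mult_gt0 // Eu /d_Iw => hm hx.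
have Ek : (N.-1 + u + d = k)%N by rewrite /N; lia.
have EN : (N.-1.+1 = N)%N by rewrite /N; lia.
exists N.-1, u; split => //; last by rewrite /N; lia.
split => //; [by rewrite /N; lia|by rewrite -d_ur_le // Eu|].
rewrite EN => n n' En kn kn'.
have un' : (u <= n')%N by move: kn'; rewrite -d_ur_le // Eu; lia.
have x0 : 0 <= x k by apply: le_trans hx; apply: sumr_ge0 => i _; apply: normr_ge0.
split=> hn; last by move: hn; rewrite /N; lia.
case: (eqVneq n N) => [->|nN]; first by rewrite !subrr mulr0.
have fx : f n <= x k.
  apply: le_trans hx; have nk : (n < k.+2)%N by lia.
  by rewrite (bigD1 (Ordinal nk)) //= lerDl sumr_ge0 // => i _; apply: normr_ge0.
have d1 : 1 <= N%:R - n%:R :> R by rewrite -natrB // ler1n; lia.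
have := le_trans (ler_norm _) fx; have := ler_peMr x0 d1; lra.
Qed.

(* For finite [v(w - w_k)] the range does not depend on [B] once [B] is large;
   for [w = w_k] it is the whole interval [(d_ur, d_Iw - d_ur)]. *)
Definition nS_range k a a' := exists B0 : R, forall B, B0 <= B -> range (trunc_val B) k a a'.

Lemma nS_range_fin k a a' (xi : R) : wval k = xi%:E -> range (fun=> xi) k a a' <-> nS_range k a a'.
Proof.
move=> hxi; have xi0 : 0 < xi by rewrite -lte_fin -hxi wval_gt0.
have tk B : xi <= B -> trunc_val B k = xi.
  by move=> h; apply: EFin_inj; rewrite trunc_val_eq ?hxi ?lee_fin //; apply: lt_le_trans h.
split=> [rg|[B0 h]].
  by exists xi => B /tk hB; apply: range_ext rg.
have := h (Num.max B0 xi); rewrite le_max lexx => /(_ isT).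
by apply: range_ext; rewrite tk // le_max lexx orbT.
Qed.

Lemma nS_rangeP k (y : R) : nS p s v w k y <->
  exists a a', nS_range k a a' /\ a'%:R < y < a.+1%:R.
Proof.
have dI a a' : (a + a' + d = k)%N -> (d_Iw p s k)%:~R / 2 = (a.+1%:R + a'%:R) / 2 :> R.
  move=> Ek; rewrite (d_Iw_sub p_pr p11 s_le (_ : a.+1 + a' + d = k.+1)%N); last by lia.
  by rewrite rmorphD /= -!pmulrn.
have conv a a' : (a + a' + d = k)%N ->
    ((d_Iw p s k)%:~R / 2 - (a.+1%:R - a'%:R) / 2 < y < (d_Iw p s k)%:~R / 2 + (a.+1%:R - a'%:R) / 2)
    = (a'%:R < y < a.+1%:R).
  by move=> /dI ->; congr (_ && _); congr (_ < _); field.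
have rsum a a' : nS_range k a a' -> (a + a' + d = k)%N.
  by case=> B0 /(_ B0 (lexx _)) /range_sum.
suff main L : is_nS_radius p s v w k L <-> exists a a', nS_range k a a' /\ L = (a.+1%:R - a'%:R) / 2.
  split=> [[L /main[a [a' [h ->]]] hy]|[a [a' [h hy]]]].
    by exists a, a'; split => //; rewrite -(conv a a') // (rsum _ _ h).
  exists ((a.+1%:R - a'%:R) / 2); first by apply/main; exists a, a'.
  by rewrite conv // rsum.
have := wval_gt0 k; case Ex: (wval k) => [xi| |] // xi0.
  rewrite (nS_radius_fin p_pr p11 s_le hC (w := w) (k := k) L (xi := xi)) //.
  by split=> -[a [a' [h ->]]]; exists a, a'; split => //; apply/(nS_range_fin _ _ Ex).
rewrite (nS_radius_inf p_pr p11 s_le (w := w) (k := k) L) //.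
have [B0 hB] := range_large k.
split=> [[a [a' [Ek aa ua ->]]]|[a [a' [h ->]]]]; exists a, a'; split => //.
- exists B0 => B hb; have [||b [b' [rg ub hb']]] := hB (trunc_val B) a.
  + rewrite ghost_mult_gt0 // ua (d_Iw_sub p_pr p11 s_le (_ : a.+1 + a' + d = k.+1)%N); lia.
  + by rewrite (trunc_val_inf _ Ex).
  have Eb := range_sum rg; have [<- <- //] : b = a /\ b' = a' by lia.
- exact: rsum.
- by case: h => B1 /(_ B1 (lexx _)) /range_lt.
case: h => B1 h1; pose B := Num.max B0 B1.
have rg := h1 B ltac:(by rewrite le_max lexx orbT).
have aa := range_lt rg; have ma : (0 < mult a k)%N by apply: range_mult rg _; rewrite aa leqnn.
have [|b [b' [rg' ub _]]] := hB (trunc_val B) a ma; first by rewrite (trunc_val_inf _ Ex) le_max lexx.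
by have [_ ->] : a = b /\ a' = b' by apply: range_unique rg rg'.
Qed.

(** A larger slope moves the largest minimizer to the right, so raising the bound only widens a
    range. *)
Lemma trunc_range_mono B B' k a a' : 0 < B -> B <= B' -> range (trunc_val B) k a a' ->
  exists b b', [/\ range (trunc_val B') k b b', (b' <= a')%N & (a <= b)%N].
Proof.
move=> B0 BB rg; have B0' := lt_le_trans B0 BB.
have dk : (d <= k.+1)%N by lia.
have [N [N' [EN kN kN' NN hN]]] := argmin p_pr p11 s_le dk (trunc_val_gt0 B0' k).
have [Ek aa ka' ha] := rg; have tt := trunc_val_mono k B0 BB.
have aN : (a.+1 <= N)%N.
  rewrite leqNgt; apply/negP => Na.
  have [/(_ (ltnW Na)) h1 _] := ha N N' EN kN kN'.
  have E1 : (a.+1 + a' + d = k.+1)%N by lia.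
  have kT : (k < T a.+1)%N by apply: (range_ur_bound_ge rg); lia.
  have [_ /(_ Na) h2] := hN _ _ E1 kT ka'.
  have d0 : 0 < a.+1%:R - N%:R :> R by rewrite subr_gt0 ltr_nat.
  have := ler_wpM2r (ltW d0) tt; lra.
have N1 : N.-1.+1 = N by lia.
exists N.-1, N'; split; [|lia|lia].
by split; [lia|lia|done|rewrite N1].
Qed.

Lemma trunc_range_nS B k a a' : 0 < B -> range (trunc_val B) k a a' ->
  exists b b', [/\ nS_range k b b', (b' <= a')%N & (a <= b)%N].
Proof.
move=> B0 rg; have := wval_gt0 k; case Ex: (wval k) => [xi| |] // _.
  have BB : B <= Num.max B xi by rewrite le_max lexx.
  have [b [b' [rb h1 h2]]] := trunc_range_mono B0 BB rg.
  exists b, b'; split => //; apply/(nS_range_fin _ _ Ex); apply: range_ext rb.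
  by apply: EFin_inj; rewrite trunc_val_eq ?Ex ?lee_fin ?lt_max ?B0 // le_max lexx orbT.
have [B1 hB] := range_large k; pose B' := Num.max B B1.
have BB : B <= B' by rewrite le_max lexx.
have [b [b' [rb h1 h2]]] := trunc_range_mono B0 BB rg.
have mb : (0 < mult b k)%N by apply: (range_mult rb); rewrite leqnn (range_lt rb).
exists b, b'; split => // ; exists B1 => B2 hB2.
have [|c [c' [rc uc _]]] := hB (trunc_val B2) b mb; first by rewrite (trunc_val_inf _ Ex).
have [|e [e' [re ue _]]] := hB (trunc_val B') b mb; first by rewrite (trunc_val_inf _ Ex) le_max lexx orbT.
have [Eb Eb'] : b = e /\ b' = e' by apply: range_unique rb re.
have Ec := range_sum rc; have Ee := range_sum re.
have [<- <- //] : c = b /\ c' = b' by lia.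
Qed.

Lemma nS_range_trunc2 k a a' k2 b b' (B1 : R) : nS_range k a a' -> nS_range k2 b b' -> exists B : R,
  [/\ 0 < B, B1 <= B, range (trunc_val B) k a a' & range (trunc_val B) k2 b b'].
Proof.
move=> [B2 h2] [B3 h3]; exists (Num.max (Num.max 1 B1) (Num.max B2 B3)).
split; [by rewrite !lt_max ltr01|by rewrite !le_max lexx ?orbT|apply: h2|apply: h3];
  by rewrite !le_max lexx ?orbT.
Qed.

Lemma nS_range_nested k a a' k2 b b' : nS_range k a a' -> nS_range k2 b b' -> (a' <= b)%N -> (b' <= a)%N ->
  (a' <= b')%N && (b <= a)%N || (b' <= a')%N && (a <= b)%N.
Proof.
move=> ra rb; have [B [B0 _ {}ra {}rb]] := nS_range_trunc2 1 ra rb.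
exact: (range_nested p_pr p11 s_le (trunc_val_min B0) (trunc_val_min2 B0) d_le ra rb).
Qed.

Lemma nS_range_unique k a a' b b' : nS_range k a a' -> nS_range k b b' -> a = b /\ a' = b'.
Proof.
move=> ra rb; have [B [B0 _ {}ra {}rb]] := nS_range_trunc2 1 ra rb.
by apply: range_unique ra rb.
Qed.

Lemma nS_set k a a' : nS_range k a a' -> nS p s v w k = [set y : R | a'%:R < y < a.+1%:R].
Proof.
move=> ra; apply/seteqP; split => y; last by move=> hy; apply/nS_rangeP; exists a, a'.
by move=> /nS_rangeP[b [b' [rb hy]]]; have [-> ->] := nS_range_unique ra rb.
Qed.

Lemma nS_nat k (n : nat) : nS p s v w k n%:R <->
  exists a a', nS_range k a a' /\ (a' < n <= a)%N.
Proof.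
by split=> [/nS_rangeP|] [a [a' [ra h]]]; [|apply/nS_rangeP]; exists a, a'; split => //;
  move: h; rewrite !ltr_nat.
Qed.

Lemma nS_disjoint_or_nested k k2 :
  [\/ nS p s v w k `&` nS p s v w k2 = set0,
      nS p s v w k `<=` nS p s v w k2 | nS p s v w k2 `<=` nS p s v w k].
Proof.
case: (pselect (exists a a', nS_range k a a')) => [[a [a' ra]]|nr]; last first.
  by constructor 2 => y /nS_rangeP[a [a' [ra _]]]; exfalso; apply: nr; exists a, a'.
case: (pselect (exists a a', nS_range k2 a a')) => [[b [b' rb]]|nr]; last first.
  by constructor 3 => y /nS_rangeP[b [b' [rb _]]]; exfalso; apply: nr; exists b, b'.
have sub (n m n2 m2 : nat) : (n2 <= n)%N -> (m <= m2)%N ->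
    [set y : R | n%:R < y < m%:R] `<=` [set y : R | n2%:R < y < m2%:R].
  move=> h1 h2 y /= /andP[h3 h4]; apply/andP; split.
    by apply: le_lt_trans h3; rewrite ler_nat.
  by apply: lt_le_trans h4 _; rewrite ler_nat.
rewrite (nS_set ra) (nS_set rb).
case: (leqP a' b) => h1; last first.
  constructor 1; rewrite -subset0 => y /= [/andP[h2 _] /andP[_ h3]].
  have : b.+1%:R <= a'%:R :> R by rewrite ler_nat.
  lra.
case: (leqP b' a) => h2; last first.
  constructor 1; rewrite -subset0 => y /= [/andP[_ h3] /andP[h4 _]].
  have : a.+1%:R <= b'%:R :> R by rewrite ler_nat.
  lra.
case/orP: (nS_range_nested ra rb h1 h2) => /andP[h3 h4].
  by constructor 3; apply: sub.
by constructor 2; apply: sub.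
Qed.

(** Large enough for the weights below [M]: finite values are untouched, and a weight with [w = w_k]
    has a range over every abscissa where its factor occurs. Hence no factor vanishes at an abscissa
    outside all ranges. *)
Definition good_bound (M : nat) (B : R) := 0 < B /\ forall k, (k < M)%N ->
  (wval k != +oo%E -> (trunc_val B k)%:E = wval k) /\
  (wval k = +oo%E -> forall m, (0 < mult m k)%N ->
     exists a a', range (trunc_val B) k a a' /\ (a' < m <= a)%N).

Lemma good_bound_ex M : exists B0, forall B, B0 <= B -> good_bound M B.
Proof.
elim: M => [|M [B0 IHM]].
  by exists 1 => B h; split => //; apply: lt_le_trans h.
have [B1 h1] := range_large M.
exists (Num.max B0 (Num.max B1 (fine (wval M)))) => B; rewrite !ge_max => /and3P[/IHM [hB hk] g1 g2].
split => // k; rewrite ltnS leq_eqVlt => /predU1P[->|]; last exact: hk.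
split=> [hx|hx m hm].
  rewrite trunc_val_eq //; have := wval_gt0 M; move: g2 hx; case: (wval M) => [r| |] //=.
have [|a [a' [ra _ ha]]] := h1 (trunc_val B) m hm; first by rewrite (trunc_val_inf _ hx).
by exists a, a'.
Qed.

Lemma good_bound_height M B m : good_bound M B -> (T m <= M)%N -> outside_ranges p s d (trunc_val B) m ->
  v (ghost p s v m).[w] = (F (trunc_val B) m)%:E.
Proof.
move=> [B0 hk] mM om; apply: v_ghost => // k mk.
have kM : (k < M)%N.
  apply: leq_trans mM; rewrite ltnNge; apply/negP => /(ghost_mult_ge p_pr p11 s_le) h.
  by move: mk; rewrite h.
have [h1 h2] := hk k kM; case: (eqVneq (wval k) +oo%E) => [hx|/h1 -> //].
by have [a [a' [ra ha]]] := h2 hx m mk; have := om _ _ _ ra; rewrite ha.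
Qed.

Lemma trunc_height_le m B : 0 < B -> ((F (trunc_val B) m)%:E <= v (ghost p s v m).[w])%E.
Proof. by move=> B0; apply: v_ghost_ge => // k; apply: trunc_val_le. Qed.

Lemma outside_trunc n B : (forall k, ~ nS p s v w k n%:R) -> 0 < B -> outside_ranges p s d (trunc_val B) n.
Proof.
move=> hn B0 k a a' rg; apply/negP => ha.
have [b [b' [rb h1 h2]]] := trunc_range_nS B0 rg.
by apply: (hn k); apply/nS_nat; exists b, b'; split => //; lia.
Qed.

Lemma finite_pointE (A : set R) (u : nat -> \bar R) (n : nat) (y : R) :
  A n%:R -> u n = y%:E -> finite_points A u (n%:R, y).
Proof. by move=> An un; exists n. Qed.

Lemma outside_vertex (n : nat) : (forall k, ~ nS p s v w k n%:R) ->
  vertex_abscissa (newton_polygon v (fun i => (ghost p s v i).[w])) n%:R.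
Proof.
move=> hn; have [B0 hB] := good_bound_ex (T n); have [Bp hk] := hB B0 (lexx _).
have on := outside_trunc hn Bp.
have [c [e [e0 he]]] := outside_support p_pr p11 s_le (trunc_val_gt0 Bp) (trunc_val_min Bp) (trunc_val_min2 Bp) d_le on.
apply: (@hull_vertex _ _ n%:R (F (trunc_val B0) n) c e) => //.
  by apply: finite_pointE => //; apply: good_bound_height (leqnn _) on.
move=> [_ y] [m [_ /= -> hm]] /=; apply: le_trans (he m) _.
by rewrite -lee_fin -hm; apply: trunc_height_le.
Qed.

Lemma nS_not_vertex (n : nat) k : nS p s v w k n%:R ->
  ~ vertex_abscissa (newton_polygon v (fun i => (ghost p s v i).[w])) n%:R.
Proof.
move=> /nS_nat[a [a' [[B1 h1] ha]]].
(* A range over [n] has [k < T n], so its ends are at most [T n + 1]; [T] of that bounds the weights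
   whose factors occur there. *)
have [B0 hB] := good_bound_ex (T (T n).+1); pose B := Num.max B0 B1.
have gB : good_bound (T (T n).+1) B by apply: hB; rewrite le_max lexx.
have Bp : 0 < B by case: gB.
have rg : range (trunc_val B) k a a' by apply: h1; rewrite le_max lexx orbT.
have [k2 [b [b' [rb hb o1 o2]]]] :=
  maximal_range p_pr p11 s_le (trunc_val_min Bp) (trunc_val_min2 Bp) d_le rg ha.
have kTn : (k2 < T n)%N by apply: (range_ur_bound_ge rb); lia.
have bT : (b.+1 <= (T n).+1)%N by have := range_sum rb; lia.
have bT' : (b' <= (T n).+1)%N by have := range_lt rb; lia.
pose m := mu (trunc_val B) k2 b.
apply: (@hull_not_vertex _ _ b'%:R (F (trunc_val B) b') b.+1%:R (F (trunc_val B) b.+1) n%:R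
          (F (trunc_val B) b.+1 - m * b.+1%:R) m).
- by apply: finite_pointE => //; apply: good_bound_height gB _ o1; apply: leq_ur_bound.
- by apply: finite_pointE => //; apply: good_bound_height gB _ o2; apply: leq_ur_bound.
- by rewrite (range_left p_pr p11 s_le (trunc_val_min Bp) (trunc_val_min2 Bp) rb) -/m; ring.
- by ring.
- move=> [_ y] [i [_ /= -> hi]] /=.
  have := maximal_support p_pr p11 s_le (trunc_val_gt0 Bp) (trunc_val_min Bp) (trunc_val_min2 Bp) d_le i rb o1 o2.
  have := trunc_height_le i Bp; rewrite hi lee_fin -/m; lra.
- by rewrite ltr_nat; lia.
- by rewrite ltr_nat; lia.
Qed.

End Main.

(** * Integrality of chord slopes *)

Section Span.
Variables (R : realType) (alpha : R).

Definition int_span (y : R) := exists i j : int, y = i%:~R + j%:~R * alpha.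

Lemma span_int (i : int) : int_span i%:~R.
Proof. by exists i, 0; rewrite mul0r addr0. Qed.

Lemma span_nat (n : nat) : int_span n%:R.
Proof. exact: (span_int n). Qed.

Lemma span_alpha : int_span alpha.
Proof. by exists 0, 1; rewrite add0r mul1r. Qed.

Lemma spanD x y : int_span x -> int_span y -> int_span (x + y).
Proof.
by move=> [i [j ->]] [i' [j' ->]]; exists (i + i'), (j + j'); rewrite !rmorphD /=; ring.
Qed.

Lemma spanMz (m : int) x : int_span x -> int_span (m%:~R * x).
Proof. by move=> [i [j ->]]; exists (m * i), (m * j); rewrite !rmorphM /=; ring. Qed.

Lemma spanN x : int_span x -> int_span (- x).
Proof. by move/(spanMz (-1)); rewrite rmorphN mulN1r. Qed.

Lemma span_sum (I : Type) (r : seq I) (P : pred I) (f : I -> R) :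
  (forall i, P i -> int_span (f i)) -> int_span (\sum_(i <- r | P i) f i).
Proof. by move=> h; elim/big_ind: _ => //; [exact: (span_int 0)|exact: spanD]. Qed.

End Span.

Section Slope.
Variables (p s : nat) (R : realType).
Hypotheses (p_pr : prime p) (p11 : (11 <= p)%N) (s_le : (s <= p - 2)%N).
Local Notation d := (delta_eps p s).
Local Notation T := (ur_bound p s d).
Local Notation E := (@slope R p s d).
Local Notation F := (@height R p s d).
Local Notation mult := (ghost_mult p s).

Lemma slope_mult (x : nat -> R) a :
  E x a = \sum_(k < T a.+1) ((mult a.+1 k)%:Z - (mult a k)%:Z)%:~R * x k.
Proof.
have -> : E x a = F x a.+1 - F x a by rewrite heightS addrC addKr.
rewrite !(ghost_mult_F p_pr p11 s_le x (b := T a.+1)) ?leqnn ?leq_ur_bound // -sumrB.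
by apply: eq_bigr => k _; rewrite rmorphB /= -!pmulrn mulrBl.
Qed.

Lemma slope_mult_ext (x y : nat -> R) a :
  (forall k, mult a.+1 k != mult a k -> x k = y k) -> E x a = E y a.
Proof.
move=> h; rewrite !slope_mult; apply: eq_bigr => k _.
by case: (eqVneq (mult a.+1 k) (mult a k)) => [->|/h ->//]; rewrite subrr !mul0r.
Qed.

Lemma slope_int_span (alpha : R) (x : nat -> R) a :
  (forall k, mult a.+1 k != mult a k -> int_span alpha (x k)) -> int_span alpha (E x a).
Proof.
move=> h; rewrite slope_mult; apply: span_sum => k _.
case: (eqVneq (mult a.+1 k) (mult a k)) => [->|/h hk]; last exact: spanMz.
by rewrite subrr mul0r; apply: (span_int _ 0).
Qed.

Lemma half_weight_int_span (alpha : R) k : int_span alpha (half_weight R p s d k).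
Proof.
have [m Em] : exists m, p = m.*2.+1.
  exists p./2; have := odd_double_half p; have [|->] := even_prime p_pr; first by lia.
  by rewrite add1n => h; rewrite -{1}h.
have -> : half_weight R p s d k = (s%:Z + m%:Z * (k%:Z - d%:Z))%:~R.
  by rewrite rmorphD rmorphM rmorphB /= -!pmulrn /half_weight {1}Em -natr1 -muln2 natrM; field.
exact: span_int.
Qed.

Lemma chord_slope_int_span (alpha : R) (x : nat -> R) k a :
  (forall i, mult a.+1 i != mult a i -> int_span alpha (x i)) -> int_span alpha (x k) ->
  int_span alpha (chord_slope p s d x k a).
Proof.
move=> hx hk; rewrite /chord_slope; apply: spanD; first exact: slope_int_span.
apply: spanN; apply: spanD; last exact: spanN.
apply: spanD; last by apply: spanN; apply: half_weight_int_span.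
apply: slope_int_span => i _; rewrite /dist_row; case: ifP => _; [exact: (span_int _ 0)|exact: span_nat].
Qed.

End Slope.

(** * Maximal ranges: straightness and slope *)

Section Maximal.
Variables (p s : nat) (R : realType) (C : closedFieldType) (v : C -> \bar R) (w : C).
Hypotheses (p_pr : prime p) (p11 : (11 <= p)%N) (s_le : (s <= p - 2)%N).
Hypotheses (hC : is_Cp p v) (hw : (0 < v w)%E).

Local Notation d := (delta_eps p s).
Local Notation T := (ur_bound p s d).
Local Notation E := (@slope R p s d).
Local Notation F := (@height R p s d).
Local Notation X := (wdist p).
Local Notation range := (@steinberg_range R p s d).
Local Notation mu := (@chord_slope R p s d).
Local Notation mult := (ghost_mult p s).
Local Notation W := (w_wt p s v).
Local Notation tr := (trunc_val p s v w).
Local Notation xe := (wval p s v w).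
Local Notation rE := (nS_range p s v w).
Local Notation nSw := (nS p s v w).

Let d_le : (d <= 1)%N. Proof. exact: delta_le1. Qed.

Lemma nS_ends k a a' k2 : maximal_nS p s v w k -> rE k a a' ->
  ~ nSw k2 a'%:R /\ ~ nSw k2 a.+1%:R.
Proof.
move=> [_ hmax] ra; have aa : (a' < a)%N by case: ra => B0 /(_ B0 (lexx _)) /range_lt.
have main (m : nat) : ((m == a') || (m == a.+1)) -> ~ nSw k2 m%:R.
  move=> hm hn; have /(nS_nat p_pr p11 s_le hC hw) [b [b' [rb hb]]] := hn.
  have sub : nSw k `<=` nSw k2.
    have h1 : (a' <= b)%N by lia. have h2 : (b' <= a)%N by lia.
    have := nS_range_nested p_pr p11 s_le hC hw ra rb h1 h2 => hh.
    have [h3 h4] : (b' <= a')%N /\ (a.+1 <= b.+1)%N by lia.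
    rewrite (nS_set p_pr p11 s_le hC hw ra) (nS_set p_pr p11 s_le hC hw rb) => y /= /andP[g1 g2].
    by apply/andP; split; [apply: le_lt_trans g1|apply: lt_le_trans g2 _]; rewrite ler_nat.
  move: hn; rewrite (hmax k2 sub) (nS_set p_pr p11 s_le hC hw ra) /= !ltr_nat; lia.
by split; apply: main; rewrite eqxx ?orbT.
Qed.

Lemma maximal_nS_range k : maximal_nS p s v w k -> exists a a', rE k a a'.
Proof.
by move=> [[y /(nS_rangeP p_pr p11 s_le hC hw) [a [a' [ra _]]]] _]; exists a, a'.
Qed.

Lemma ghost_root m k : (0 < mult m k)%N -> (ghost p s v m).[W k] = 0.
Proof.
move=> mk; have kT : (k < T m)%N.
  by rewrite ltnNge; apply/negP => /(ghost_mult_ge p_pr p11 s_le) h; rewrite h in mk.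
rewrite (ghost_prod p_pr p11 s_le v (leqnn _)) horner_prod (bigD1 (Ordinal kT)) //=.
by rewrite horner_exp hornerXsubC subrr expr0n gtn_eqF // mul0r.
Qed.

Section OneRange.
Variables (k a a' : nat) (B : R).
Hypothesis kmax : maximal_nS p s v w k.
Hypothesis ra : rE k a a'.
Hypothesis gB : good_bound p s v w (T a.+1) B.
Hypothesis rg : range (tr B) k a a'.

Let Bp : 0 < B. Proof. by case: gB. Qed.
Let aa : (a' < a)%N. Proof. exact: range_lt rg. Qed.
Let tm := trunc_val_min p_pr p11 s_le hC hw Bp.
Let tm2 := trunc_val_min2 p_pr p11 s_le hC hw Bp.
Let sg := mu (tr B) k a.
Let I := [set x : R | a'%:R <= x <= a.+1%:R].

Lemma end_value n : (n == a') || (n == a.+1) ->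
  v (ghost p s v n).[w] = (F (tr B) n)%:E.
Proof.
move=> hn; apply: (good_bound_height p_pr p11 s_le hC gB); first by apply: leq_ur_bound; lia.
apply: (outside_trunc p_pr p11 s_le hC hw _ Bp) => k2.
have [h1 h2] := nS_ends k2 kmax ra.
by case/orP: hn => /eqP ->.
Qed.

Lemma end_line n : (n == a') || (n == a.+1) ->
  F (tr B) n = (F (tr B) a.+1 - sg * a.+1%:R) + sg * n%:R.
Proof.
case/orP => /eqP ->; last by ring.
by rewrite (range_left p_pr p11 s_le tm tm2 rg) -/sg; ring.
Qed.

Lemma maximal_hull x : I x ->
  lower_hull (finite_points I (fun n => v (ghost p s v n).[w])) x
  = ((F (tr B) a.+1 - sg * a.+1%:R) + sg * x)%:E.
Proof.
move=> /andP[x1 x2]; have a1 : a'%:R <= a.+1%:R :> R by rewrite ler_nat; lia.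
apply: (@hull_line _ _ a'%:R (F (tr B) a') a.+1%:R (F (tr B) a.+1)) => //.
- apply: finite_pointE; first by rewrite /I /= lexx.
  by apply: end_value; rewrite eqxx.
- apply: finite_pointE; first by rewrite /I /= lexx andbT.
  by apply: end_value; rewrite eqxx orbT.
- by apply: end_line; rewrite eqxx.
- by apply: end_line; rewrite eqxx orbT.
move=> [z1 y] [n [/= /andP[n1 n2] -> hn]]; rewrite !ler_nat in n1 n2.
have := range_line p_pr p11 s_le tm tm2 rg (_ : a' <= n <= a.+1)%N.
rewrite n1 n2 => /(_ isT); have := trunc_height_le p_pr p11 s_le hC hw n Bp.
by rewrite hn lee_fin -/sg; lra.
Qed.

(** [alpha_set] sees only weights active at an interior abscissa. A weight that becomes active at
    [a + 1] has its left kink at [a], inside the range, where its value is the integer [X i k]. *)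
Lemma kink_mult i : mult a.+1 i != mult a i -> (0 < mult a i)%N \/ tr B i = (X i k)%:R.
Proof.
case: (posnP (mult a i)) => [m0 m1|]; [right|by left].
have : (0 < mult a.+1 i)%N by rewrite m0 in m1; rewrite lt0n.
have := ghost_mult_gt0 p_pr p11 s_le a i; rewrite m0 ltnn ghost_mult_gt0 // => hn hp.
have [u1 u2] : d_ur p s i <= a%:Z /\ ~~ (d_ur p s i <= a.-1%:Z) by move: aa; lia.
rewrite d_ur_le // in u1; rewrite d_ur_le // -leqNgt in u2.
have E1 : a.-1.+1 = a by lia.
have [||ik lt] := window_ur_far p_pr p11 s_le rg (_ : a' <= a.-1 < a)%N (_ : T a.-1 <= i < T a.-1.+1)%N.
- by lia.
- by rewrite u2 E1.
exact: (ultra_eq tm tm2 ik lt).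
Qed.

Lemma sigma_alpha : (forall n : nat, I n%:R -> (ghost p s v n).[w] != 0) ->
  exists2 alpha : R, is_maximum (alpha_set p s v w k) alpha%:E & int_span alpha sg.
Proof.
move=> hI; have finx n i : (a' <= n <= a.+1)%N -> (0 < mult n i)%N -> xe i = (tr B i)%:E.
  move=> hn mi; have iT : (i < T a.+1)%N.
    apply: leq_trans (leq_ur_bound p s d (_ : n <= a.+1)%N); last by lia.
    by rewrite ltnNge; apply/negP => /(ghost_mult_ge p_pr p11 s_le) h; rewrite h in mi.
  have [_ /(_ i iT) [-> //]] := gB; apply/eqP => xi.
  have wi : w = W i by apply/eqP; rewrite -subr_eq0; apply/eqP; case: hC => -[h0 _ _ _] _ _ _; apply/h0.
  have := hI n; rewrite wi ghost_root // eqxx => h; have : false by apply: h; rewrite /I /= !ler_nat.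
  by [].
have nSE n : nSw k n%:R <-> (a' < n <= a)%N.
  by rewrite (nS_set p_pr p11 s_le hC hw ra) /= !ltr_nat.
pose Q i := [exists n : 'I_a.+1, (a' < n)%N && (0 < mult n i)%N].
pose alpha : R := \big[Num.max/0]_(i < T a.+1 | Q i) tr B i.
have QP i : Q i <-> exists2 n, nSw k n%:R & (0 < mult n i)%N.
  split=> [/existsP[n /andP[h1 h2]]|[n /nSE hn mi]].
    by exists n => //; apply/nSE; rewrite h1 -ltnS ltn_ord.
  have na : (n < a.+1)%N by lia.
  by apply/existsP; exists (Ordinal na); rewrite /= mi andbT; lia.
have Qx i : Q i -> xe i = (tr B i)%:E.
  by move/QP => [n /nSE hn]; apply: finx; lia.
have QT i : Q i -> (i < T a.+1)%N.
  move/QP => [n /nSE hn mi]; apply: leq_trans (leq_ur_bound p s d (_ : n <= a.+1)%N); last by lia.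
  by rewrite ltnNge; apply/negP => /(ghost_mult_ge p_pr p11 s_le) h; rewrite h in mi.
have Qle i : Q i -> tr B i <= alpha.
  by move=> Qi; apply: (le_bigmax_cond 0 (fun i : 'I_(T a.+1) => tr B i) (j := Ordinal (QT i Qi))).
have a_in : alpha = 0 \/ exists2 i, Q i & alpha = tr B i.
  rewrite /alpha; elim/big_ind: _ => [|x y hx hy|i Qi]; [by left| |by right; exists i].
  by rewrite maxEle; case: ifP.
exists alpha.
  split.
    case: a_in => [->|[i Qi ->]]; [by left|right].
    by exists i; [apply/QP|exact: Qx].
  move=> _ [->|[i /= /QP Qi <-]]; first by rewrite lee_fin /alpha bigmax_ge_id.
  by rewrite -/(xe i) Qx // lee_fin Qle.
(* If [alpha] is attained at [j], the ultrametric rule turns every smaller value into the integer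
   [X i j]. *)
have main i : Q i -> int_span alpha (tr B i).
  move=> Qi; case: (eqVneq (tr B i) alpha) => [->|ne]; first exact: span_alpha.
  have lt : tr B i < alpha by rewrite lt_neqAle ne Qle.
  case: a_in => [a0|[j Qj Ej]].
    by move: lt; rewrite a0 ltNge ltW // trunc_val_gt0.
  rewrite Ej in lt; have ij : i != j by apply/negP => /eqP E; rewrite E ltxx in lt.
  have ji : j != i by rewrite eq_sym.
  have h1 := tm2 ij; rewrite (min_l (ltW lt)) in h1.
  have h2 := tm ji; rewrite wdistC ge_min leNgt lt /= in h2.
  have -> : tr B i = (X i j)%:R by apply/eqP; rewrite eq_le h1 h2.
  exact: span_nat.
have Qa i : (0 < mult a i)%N -> Q i.
  by move=> mi; apply/QP; exists a => //; apply/nSE; rewrite leqnn aa.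
apply: chord_slope_int_span => //.
  by move=> i /kink_mult[/Qa/main//|->]; apply: span_nat.
by apply/main/Qa; apply: (range_mult p_pr p11 s_le rg); rewrite leqnn aa.
Qed.

Lemma end_mult0 n i : xe i = +oo%E -> (n == a') || (n == a.+1) -> mult n i = 0%N.
Proof.
move=> xi hn; apply/eqP; rewrite -leqn0 leqNgt; apply/negP => mi.
have iT : (i < T a.+1)%N.
  apply: leq_trans (leq_ur_bound p s d (_ : n <= a.+1)%N); last by lia.
  by rewrite ltnNge; apply/negP => /(ghost_mult_ge p_pr p11 s_le) h; rewrite h in mi.
have [_ /(_ i iT) [_ /(_ xi n mi) [b [b' [rb hb]]]]] := gB.
have : outside_ranges p s d (tr B) n.
  apply: (outside_trunc p_pr p11 s_le hC hw _ Bp) => k2.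
  by have [h1 h2] := nS_ends k2 kmax ra; case/orP: hn => /eqP ->.
by move=> /(_ _ _ _ rb); rewrite hb.
Qed.

Lemma sigma_int k0 : w = W k0 -> sg \is a Num.int.
Proof.
move=> wk; have x0 : xe k0 = +oo%E.
  by rewrite /wval wk subrr; case: hC => -[h _ _ _] _ _ _; apply/h.
have xX i : i != k0 -> xe i = (X i k0)%:R%:E.
  by move=> ik; rewrite /wval wk (w_wt_sub p_pr p11 s_le hC) 1?eq_sym // wdistC.
have trX i : i != k0 -> (0 < mult a.+1 i)%N || (0 < mult a i)%N -> tr B i = (X i k0)%:R.
  move=> ik hm; apply: EFin_inj; rewrite -xX //.
  have iT : (i < T a.+1)%N.
    rewrite ltnNge; apply/negP => h; move: hm; rewrite (ghost_mult_ge p_pr p11 s_le h).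
    by rewrite (ghost_mult_ge p_pr p11 s_le) // (leq_trans _ h) // leq_ur_bound.
  by have [_ /(_ i iT) [-> //]] := gB; rewrite xX.
have mne i : mult a.+1 i != mult a i -> (0 < mult a.+1 i)%N || (0 < mult a i)%N.
  by case: (mult a.+1 i) => [|m] //=; case: (mult a i).
case: (eqVneq k k0) => [kk|kk].
  (* The truncated value [B] of [k] cancels in [chord_slope], and so do all distances. *)
  suff -> : sg = half_weight R p s d k.
    have [i [j ->]] : int_span (0 : R) (half_weight R p s d k) by apply: half_weight_int_span.
    by rewrite mulr0 addr0 intr_int.
  have Ek := range_sum rg; have kT := range_ur_bound rg.
  have kTa : (k < T a)%N by apply: (range_ur_bound_ge rg); apply: ltnW.
  rewrite /sg /chord_slope (slope_mult_ext p_pr p11 s_le (y := fun i => dist_row R p k i + tr B k * indic R k i)).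
    rewrite slope_linear (slope_indic R p_pr p11 s_le Ek kTa kT) aa (ltnW aa) /= /hat_slope; ring.
  move=> i hi; rewrite /dist_row /indic; case: eqVneq => [->|ik] /=; first by ring.
  by rewrite -kk in trX; rewrite trX // ?mne //; ring.
(* A range of [k0] over [a] would contain that of [k], as its value is the bound [B]; by maximality
   they would coincide, and equal ranges have the same weight. *)
have ma0 : mult a k0 = 0%N.
  apply/eqP; rewrite -leqn0 leqNgt; apply/negP => mi.
  have iT : (k0 < T a.+1)%N.
    apply: leq_trans (leq_ur_bound p s d (leqnSn a)).
    by rewrite ltnNge; apply/negP => /(ghost_mult_ge p_pr p11 s_le) h; rewrite h in mi.
  have [_ /(_ _ iT) [_ /(_ x0 a mi) [b [b' [rb hb]]]]] := gB.
  have xx : tr B k <= tr B k0 by rewrite (trunc_val_inf _ x0) -lee_fin trunc_valE // ge_min lexx orbT.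
  have [h1 h2] := range_nested_le p_pr p11 s_le tm tm2 d_le rb rg xx ltac:(lia) ltac:(lia).
  have [c [c' [rc h3 h4]]] := trunc_range_nS p_pr p11 s_le hC hw Bp rb.
  have [n1 n2] := nS_ends k0 kmax ra.
  have ca : (a' <= c')%N.
    rewrite leqNgt; apply/negP => h; apply: n1; apply/(nS_nat p_pr p11 s_le hC hw).
    by exists c, c'; split => //; lia.
  have cb : (c <= a)%N.
    rewrite leqNgt; apply/negP => h; apply: n2; apply/(nS_nat p_pr p11 s_le hC hw).
    by exists c, c'; split => //; lia.
  have Ec : (c + c' + d = k0)%N by case: rc => B1 /(_ B1 (lexx _)) /range_sum.
  by have := range_sum rg; lia.
have ma1 : mult a.+1 k0 = 0%N by apply: end_mult0; rewrite ?eqxx ?orbT.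
have : int_span (0 : R) sg.
  apply: chord_slope_int_span => //.
    move=> i hi; have ik : i != k0 by apply/negP => /eqP E; rewrite E ma0 ma1 eqxx in hi.
    by rewrite trX // ?mne //; apply: span_nat.
  have mk : (0 < mult a k)%N by apply: (range_mult p_pr p11 s_le rg); rewrite leqnn aa.
  by rewrite trX // ?mk ?orbT //; apply: span_nat.
by case=> i [j ->]; rewrite mulr0 addr0 intr_int.
Qed.

End OneRange.

Lemma maximal_nS_straight k : maximal_nS p s v w k ->
  let I := closure (nSw k) in
  exists c sigma : R,
    [/\ forall x : R, I x ->
          lower_hull (finite_points I (fun n => v (ghost p s v n).[w])) x = (c + sigma * x)%:E,
        (forall n : nat, I n%:R -> (ghost p s v n).[w] != 0) ->
          exists2 alpha : R, is_maximum (alpha_set p s v w k) alpha%:E &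
            exists a b : int, sigma = a%:~R + b%:~R * alpha &
        forall k0 : nat, w = W k0 ->
          sigma \is a Num.int /\
          forall n : nat, (I `\` nSw k) n%:R ->
            v (ghost_hat p s v n k0).[w] = (c + sigma * n%:R)%:E].
Proof.
move=> kmax; have [a [a' ra]] := maximal_nS_range kmax.
have [B0 hB] := good_bound_ex p_pr p11 s_le hC hw (T a.+1).
have [B1 h1] := ra; pose B := Num.max B0 B1.
have gB : good_bound p s v w (T a.+1) B by apply: hB; rewrite le_max lexx.
have rg : range (tr B) k a a' by apply: h1; rewrite le_max lexx orbT.
have aa : (a' < a)%N := range_lt rg.
have IE : closure (nSw k) = [set x : R | a'%:R <= x <= a.+1%:R].
  rewrite (nS_set p_pr p11 s_le hC hw ra) closure_open_interval // ltr_nat; lia.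
rewrite /= IE; exists (F (tr B) a.+1 - mu (tr B) k a * a.+1%:R), (mu (tr B) k a); split.
- exact: (maximal_hull kmax ra gB rg).
- exact: (sigma_alpha ra gB rg).
move=> k0 wk; split; first exact: (sigma_int kmax ra gB rg wk).
move=> n [/= hI]; rewrite (nS_set p_pr p11 s_le hC hw ra) /= => hn.
have {hI}hn : (n == a') || (n == a.+1).
  by move: hI hn; rewrite !ler_nat !ltr_nat; lia.
have x0 : xe k0 = +oo%E.
  by rewrite /wval wk subrr; case: hC => -[h _ _ _] _ _ _; apply/h.
(* The factor of [k0] has exponent 0 at both ends, so its removal changes nothing there. *)
have m0 : mult n k0 = 0%N by exact: (end_mult0 kmax ra gB rg x0 hn).
by rewrite ghost_hat_mult0 // (end_value kmax ra gB rg hn) (end_line gB rg hn).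
Qed.

End Maximal.

Theorem theorem4p13 (p s : nat) (R : realType) (C : closedFieldType)
    (v : C -> \bar R) (w : C)
    (p_prime : prime p) (p_ge11 : (11 <= p)%N) (s_le : (s <= p - 2)%N)
    (hC : is_Cp p v) (hw : (0 < v w)%E) :
  [/\ forall kb kb' : nat,
        [\/ nS p s v w kb `&` nS p s v w kb' = set0,
            nS p s v w kb `<=` nS p s v w kb' |
            nS p s v w kb' `<=` nS p s v w kb],
      [set n : int | vertex_abscissa
                       (newton_polygon v (fun i => (ghost p s v i).[w])) n%:~R]
      = [set n : int | 0 <= n /\ forall kb : nat, ~ nS p s v w kb n%:~R] &
      forall kb : nat, maximal_nS p s v w kb ->
        let I := closure (nS p s v w kb) in
        exists c sigma : R,
          [/\ forall x : R, I x ->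
                lower_hull (finite_points I (fun n => v (ghost p s v n).[w])) x
                = (c + sigma * x)%:E,
              (forall n : nat, I n%:R -> (ghost p s v n).[w] != 0) ->
                exists2 alpha : R, is_maximum (alpha_set p s v w kb) alpha%:E &
                  exists a b : int, sigma = a%:~R + b%:~R * alpha &
              forall kb0 : nat, w = w_wt p s v kb0 ->
                sigma \is a Num.int /\
                forall n : nat, (I `\` nS p s v w kb) n%:R ->
                  v (ghost_hat p s v n kb0).[w] = (c + sigma * n%:R)%:E]].
Proof.
split.
- by move=> k k2; apply: nS_disjoint_or_nested.
- apply/seteqP; split=> n /=.
    move=> hv; have n0 : 0 <= n.
      rewrite leNgt; apply/negP => n0; have [] := hv.
      rewrite /newton_polygon hull_pinfty ?ltrz0 //.
      by move=> z [m [_ -> _]]; apply: ler0n.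
    split => // k; move: hv; case: n n0 => // n _ hv hn.
    by apply: (nS_not_vertex p_prime p_ge11 s_le hC hw hn hv).
  by case=> n0 hn; case: n n0 hn => // n _ hn; apply: outside_vertex.
- by move=> k; apply: maximal_nS_straight.
Qed.
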